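(* Consider the set of all algebraic subgroups of $\mathrm{Aut}^*\mathbf A^n$ whose connected component of identity is an $(n-1)$-dimensional torus, ordered by inclusion. Up to conjugacy in $\mathrm{Aut}^*\mathbf A^n$, the group $$N_{\mathrm{SL}_n}(D_n^* )=N_{\mathrm{GL}_n}(D_n)\cap\mathrm{SL}_n$$ is the unique maximal element of this set.
   Context: $k$ is an algebraically closed field of characteristic $0$; $\mathbf A^n$ is affine space over $k$ with standard coordinate functions $x_1,\ldots,x_n$. $\mathrm{Aut}\,\mathbf A^n$ is the group of polynomial automorphisms of $\mathbf A^n$, an element $g$ being written $(g_1,\ldots,g_n)$ with $g_i=g^*(x_i)$; $\mathrm{Jac}(g)=\det(\partial g_i/\partial x_j)$ and $\mathrm{Aut}^*\mathbf A^n=\{g\in\mathrm{Aut}\,\mathbf A^n\mid\mathrm{Jac}(g)=1\}$. A subgroup of $\mathrm{Aut}\,\mathbf A^n$ is called algebraic if it is the image of an algebraic group under a homomorphism to $\mathrm{Aut}\,\mathbf A^n$ for which the action map on $\mathbf A^n$ is a morphism. $\mathrm{GL}_n\subset\mathrm{Aut}\,\mathbf A^n$ is the subgroup of linear transformations, $\mathrm{SL}_n=\mathrm{GL}_n\cap\mathrm{Aut}^*\mathbf A^n$, $D_n=\{(t_1x_1,\ldots,t_nx_n)\mid t_i\in k\setminus\{0\}\}$ is the diagonal torus of $\mathrm{GL}_n$, and $D_n^*=D_n\cap\mathrm{Aut}^*\mathbf A^n$. $N_H(S)$ is the normalizer of $S$ in $H$. *)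

(* Defs.v *)
From HB Require Import structures.
From mathcomp Require Import all_boot all_order all_algebra.
From mathcomp Require Import all_classical topology.
From mathcomp Require Import mpoly.

Set Implicit Arguments.
Unset Strict Implicit.
Unset Printing Implicit Defensive.

Import GRing.Theory.

Local Open Scope classical_set_scope.
Local Open Scope ring_scope.

(* Varieties are classical varieties over k in the sense of Serre, presented  *)
(* as topological spaces carrying a sheaf of k-valued functions.  The sheaf   *)
(* is given by its stalks: regular_at x f says that the germ at x of the      *)
(* function f is regular, and a function on an open set U is a section iff    *)
(* it is regular at each point of U.  Values of f away from x are irrelevant. *)
HB.mixin Record isFunSpace (k : fieldType) T & Topological T := {
  regular_at : T -> (T -> k) -> Prop;
  regular_at_germ : forall (x : T) (f g : T -> k),
    (\forall y \near x, f y = g y) -> regular_at x f -> regular_at x g;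
  regular_at_near : forall (x : T) (f : T -> k),
    regular_at x f -> \forall y \near x, regular_at y f
}.

#[short(type="funSpaceType")]
HB.structure Definition FunSpace (k : fieldType) :=
  {T of isFunSpace k T & Topological T}.

Definition is_morphism (k : fieldType) (X Y : funSpaceType k) (h : X -> Y) :=
  continuous h /\
  forall (x : X) (f : Y -> k), regular_at (h x) f -> regular_at x (f \o h).

Definition is_isomorphism (k : fieldType) (X Y : funSpaceType k) (h : X -> Y) :=
  is_morphism h /\ exists2 h' : Y -> X, is_morphism h' & cancel h h' /\ cancel h' h.

Section SubSpace.
Variables (k : fieldType) (X : funSpaceType k) (A : set X).

Definition sub_regular_at (x : set_type A) (f : set_type A -> k) :=
  exists2 g : X -> k, regular_at (val x) g & \forall y \near x, f y = g (val y).

Fact sub_regular_at_germ (x : set_type A) (f g : set_type A -> k) :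
  (\forall y \near x, f y = g y) -> sub_regular_at x f -> sub_regular_at x g.
Proof.
move=> fg [h hx fh]; exists h => //.
by near=> y; rewrite -(near fg y) // (near fh y).
Unshelve. all: by end_near. Qed.

Fact sub_regular_at_near (x : set_type A) (f : set_type A -> k) :
  sub_regular_at x f -> \forall y \near x, sub_regular_at y f.
Proof.
move=> [h hx fh].
have hx' : \forall y \near x, regular_at (val y) h.
  have := @initial_continuous _ _ (set_val : set_type A -> X) x.
  by move=> /(_ _ (regular_at_near _ _ hx)).
have /near_join {}fh := fh.
by near=> y; exists h; [apply: (near hx' y)|apply: (near fh y)].
Unshelve. all: by end_near. Qed.

HB.instance Definition _ := isFunSpace.Build k (set_type A)
  sub_regular_at_germ sub_regular_at_near.
End SubSpace.

Section AffineSpace.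
Variables (k : fieldType) (m : nat).

Definition affine : Type := {ffun 'I_m -> k}.

HB.instance Definition _ := Choice.on affine.

Definition nonvanishing (p : {mpoly k[m]}) : set affine :=
  [set x | p.@[x] != 0].

HB.instance Definition _ := @isSubBaseTopological.Build affine
  (set affine) (range nonvanishing) id.

Lemma open_nonvanishing p : open (nonvanishing p).
Proof.
exists [set nonvanishing p]; last by rewrite bigcup_set1.
move=> _ ->; apply: finI_from1; exact: imageT.
Qed.

Definition affine_regular_at (x : affine) (f : affine -> k) :=
  exists p q : {mpoly k[m]}, q.@[x] != 0 /\
    \forall y \near x, f y = p.@[y] / q.@[y].

Fact affine_regular_at_germ (x : affine) (f g : affine -> k) :
  (\forall y \near x, f y = g y) -> affine_regular_at x f ->
  affine_regular_at x g.
Proof.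
move=> fg [p [q [qx fpq]]]; exists p, q; split=> //.
by near=> y; rewrite -(near fg y) // (near fpq y).
Unshelve. all: by end_near. Qed.

Fact affine_regular_at_near (x : affine) (f : affine -> k) :
  affine_regular_at x f -> \forall y \near x, affine_regular_at y f.
Proof.
move=> [p [q [qx fpq]]].
have {}qx : nbhs x (nonvanishing q).
  by apply: open_nbhs_nbhs; split=> //; exact: open_nonvanishing.
have /near_join {}fpq := fpq.
by near=> y; exists p, q; split; [apply: (near qx y)|apply: (near fpq y)].
Unshelve. all: by end_near. Qed.

HB.instance Definition _ := isFunSpace.Build k affine
  affine_regular_at_germ affine_regular_at_near.

End AffineSpace.

(* The product of varieties: its topology (finer than the product topology)   *)
(* and its functions are generated by the sums of f_i(x) g_i(y) with f_i and  *)
(* g_i regular.                                                               *)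
Section Product.
Variables (k : fieldType) (X Y : funSpaceType k).

Definition vprod : Type := (X * Y)%type.

HB.instance Definition _ := Choice.on vprod.

Definition tensor r (f : 'I_r -> X -> k) (g : 'I_r -> Y -> k) (z : vprod) : k :=
  \sum_(i < r) f i z.1 * g i z.2.

Definition vprod_subbase : set (set vprod) :=
  [set W | exists (U : set X) (V : set Y) (r : nat)
     (f : 'I_r -> X -> k) (g : 'I_r -> Y -> k),
   [/\ open U /\ open V,
       forall i x, U x -> regular_at x (f i),
       forall i y, V y -> regular_at y (g i)
     & W = [set z | [/\ U z.1, V z.2 & tensor f g z != 0]]]].

HB.instance Definition _ := @isSubBaseTopological.Build vprod
  (set vprod) vprod_subbase id.

Lemma open_vprod_subbase W : vprod_subbase W -> open W.
Proof.
move=> DW; exists [set W]; last by rewrite bigcup_set1.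
by move=> _ ->; apply: finI_from1.
Qed.

Definition vprod_regular_at (z : vprod) (h : vprod -> k) :=
  exists (r s : nat) (f : 'I_r -> X -> k) (g : 'I_r -> Y -> k)
         (f' : 'I_s -> X -> k) (g' : 'I_s -> Y -> k),
  [/\ (forall i, regular_at z.1 (f i)) /\ (forall i, regular_at z.2 (g i)),
      (forall i, regular_at z.1 (f' i)) /\ (forall i, regular_at z.2 (g' i)),
      tensor f' g' z != 0
    & \forall w \near z, h w = tensor f g w / tensor f' g' w].

Fact vprod_regular_at_germ (z : vprod) (h h' : vprod -> k) :
  (\forall w \near z, h w = h' w) -> vprod_regular_at z h ->
  vprod_regular_at z h'.
Proof.
move=> hh' [r [s [f [g [f' [g' [fg fg' nz hE]]]]]]].
exists r, s, f, g, f', g'; split=> //.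
by near=> w; rewrite -(near hh' w) // (near hE w).
Unshelve. all: by end_near. Qed.

Fact vprod_regular_at_near (z : vprod) (h : vprod -> k) :
  vprod_regular_at z h -> \forall w \near z, vprod_regular_at w h.
Proof.
move=> [r [s [f [g [f' [g' [[fz gz] [fz' gz'] nz hE]]]]]]].
have nearU (Z : funSpaceType k) (t : Z) q (e : 'I_q -> Z -> k) :
    (forall i, regular_at t (e i)) ->
    \forall u \near t, forall i, regular_at u (e i).
  by move=> et; apply: filter_forall => i; apply: regular_at_near.
have [U [oU Uz] Uff'] : exists2 U, open_nbhs z.1 U &
    forall x, U x -> (forall i, regular_at x (f i)) /\
                     (forall i, regular_at x (f' i)).
  have : nbhs z.1 [set x | (forall i, regular_at x (f i)) /\
                         (forall i, regular_at x (f' i))].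
    by apply: filterI; exact: nearU.
  by rewrite nbhsE => -[U ? UP]; exists U => // x /UP[].
have [V [oV Vz] Vgg'] : exists2 V, open_nbhs z.2 V &
    forall y, V y -> (forall i, regular_at y (g i)) /\
                     (forall i, regular_at y (g' i)).
  have : nbhs z.2 [set y | (forall i, regular_at y (g i)) /\
                         (forall i, regular_at y (g' i))].
    by apply: filterI; exact: nearU.
  by rewrite nbhsE => -[V ? VP]; exists V => // y /VP[].
pose W : set vprod := [set w | [/\ U w.1, V w.2 & tensor f' g' w != 0]].
have nW : \forall w \near z, W w.
  apply: open_nbhs_nbhs; split=> //; apply: open_vprod_subbase.
  exists U, V, s, f', g'; split=> //.
  - by move=> i x /Uff' [_]; apply.
  - by move=> i y /Vgg' [_]; apply.
have /near_join {}hE := hE.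
near=> w.
have [/Uff' [? ?] /Vgg' [? ?] ?] : W w by exact: (near nW w).
by exists r, s, f, g, f', g'; split=> //; apply: (near hE w).
Unshelve. all: by end_near. Qed.

HB.instance Definition _ := isFunSpace.Build k vprod
  vprod_regular_at_germ vprod_regular_at_near.

End Product.

(* Affine varieties are the spaces isomorphic to closed subsets of affine     *)
(* space, varieties are covered by finitely many affine open sets and         *)
(* separated; irreducibility is not required, and algebraic groups below are  *)
(* not assumed to be affine.                                                  *)
Section Varieties.
Variable k : fieldType.

Definition is_affine_variety (X : funSpaceType k) :=
  exists (m : nat) (Z : set (affine k m)) (h : X -> set_type Z),
    closed Z /\ is_isomorphism h.

Definition is_variety (X : funSpaceType k) :=
  (exists (r : nat) (U : 'I_r -> set X),
     [/\ forall i, open (U i), forall i, is_affine_variety (set_type (U i))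
       & \bigcup_i U i = setT]) /\
  closed [set z : vprod X X | z.1 = z.2].

End Varieties.

HB.mixin Record isAlgGroup (k : fieldType) G & FunSpace k G & Group G := {
  alg_is_variety : is_variety G;
  alg_mul_morphism : is_morphism (fun z : vprod G G => (z.1 * z.2)%g);
  alg_inv_morphism : is_morphism (fun x : G => x^-1%g)
}.

#[short(type="algGroupType")]
HB.structure Definition AlgGroup (k : fieldType) :=
  {G of isAlgGroup k G & FunSpace k G & Group G}.

Definition is_torus (k : fieldType) (r : nat) (G : algGroupType k) :=
  exists f : G -> set_type [set t : affine k r | forall i, t i != 0],
    is_isomorphism f /\
    forall (x y : G) i, val (f (x * y)%g) i = val (f x) i * val (f y) i.

Section Normalizer.
Variable G : groupType.

Definition conj_set (g : G) (S : set G) : set G := [set (g * h / g)%g | h in S].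

Definition normalizer (H S : set G) : set G :=
  [set g | H g /\ conj_set g S = S].

End Normalizer.

Section PolyAut.
Variables (k : fieldType) (n : nat).

Definition pcomp (g h : n.-tuple {mpoly k[n]}) : n.-tuple {mpoly k[n]} :=
  [tuple tnth g i \mPo h | i < n].

Definition pid : n.-tuple {mpoly k[n]} := [tuple 'X_i | i < n].

(* An automorphism g is stored together with its inverse, which it determines *)
(* (polyAut_inj).                                                             *)
Record polyAut := PolyAut {
  polyAut_pair : n.-tuple {mpoly k[n]} * n.-tuple {mpoly k[n]};
  polyAut_pairP : (pcomp polyAut_pair.1 polyAut_pair.2 == pid) &&
                  (pcomp polyAut_pair.2 polyAut_pair.1 == pid)
}.

HB.instance Definition _ := [isSub for polyAut_pair].
HB.instance Definition _ := [Choice of polyAut by <:].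

(* The component g_i = g^*(x_i).                                              *)
Definition polyAut_coord (g : polyAut) (i : 'I_n) : {mpoly k[n]} :=
  tnth (polyAut_pair g).1 i.

Lemma comp_mpolyA (p : {mpoly k[n]}) g h :
  (p \mPo g) \mPo h = p \mPo pcomp g h.
Proof.
rewrite [X in X \mPo h]comp_mpolyEX [RHS]comp_mpolyEX raddf_sum.
apply: eq_bigr => m _; rewrite /= !comp_mpolyZ !comp_mpolyX rmorph_prod /=; congr (_ *: _).
by apply: eq_bigr => i _; rewrite rmorphXn /= tnth_mktuple.
Qed.

Lemma pcompA : associative pcomp.
Proof.
move=> f g h; apply: eq_from_tnth => i.
by rewrite !tnth_mktuple comp_mpolyA.
Qed.

Lemma pcompi1 : right_id pid pcomp.
Proof.
by move=> g; apply: eq_from_tnth => i; rewrite tnth_mktuple comp_mpoly_id.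
Qed.

Lemma pcomp1i : left_id pid pcomp.
Proof.
move=> g; apply: eq_from_tnth => i.
by rewrite !tnth_mktuple comp_mpolyXU -tnth_nth.
Qed.

Lemma polyAut_inj g h :
  (forall i, polyAut_coord g i = polyAut_coord h i) -> g = h.
Proof.
move=> /eq_from_tnth gh; apply: val_inj; move: gh.
case: g h => [[g g'] /= /andP[_ /eqP g'g]] [[h h'] /= /andP[/eqP hh' _]] gh.
by congr pair => //; rewrite -[g']pcompi1 -hh' pcompA -gh g'g pcomp1i.
Qed.

Fact one_proof : (pcomp pid pid == pid) && (pcomp pid pid == pid).
Proof. by rewrite pcomp1i eqxx. Qed.

Definition polyAut_one := @PolyAut (pid, pid) one_proof.

Fact inv_proof (g : polyAut) :
  let p := ((polyAut_pair g).2, (polyAut_pair g).1) in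
  (pcomp p.1 p.2 == pid) && (pcomp p.2 p.1 == pid).
Proof. by rewrite /= andbC polyAut_pairP. Qed.

Definition polyAut_inv (g : polyAut) := PolyAut (inv_proof g).

Fact mul_proof (g h : polyAut) :
  let p := (pcomp (polyAut_pair g).1 (polyAut_pair h).1,
            pcomp (polyAut_pair h).2 (polyAut_pair g).2) in
  (pcomp p.1 p.2 == pid) && (pcomp p.2 p.1 == pid).
Proof.
case: g h => [[g g'] /= /andP[/eqP gg' /eqP g'g]].
move=> [[h h'] /= /andP[/eqP hh' /eqP h'h]].
rewrite -!pcompA (pcompA h) hh' pcomp1i gg' eqxx /=.
by rewrite (pcompA g') g'g pcomp1i h'h.
Qed.

Definition polyAut_mul (g h : polyAut) := PolyAut (mul_proof g h).

Fact polyAut_mulA : associative polyAut_mul.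
Proof. by move=> f g h; apply: val_inj; rewrite /= !pcompA. Qed.

Fact polyAut_mul1g : left_id polyAut_one polyAut_mul.
Proof.
by case=> -[g g'] p; apply: val_inj; rewrite /= pcomp1i pcompi1.
Qed.

Fact polyAut_mulg1 : right_id polyAut_one polyAut_mul.
Proof.
by case=> -[g g'] p; apply: val_inj; rewrite /= pcomp1i pcompi1.
Qed.

Fact polyAut_mulVg : left_inverse polyAut_one polyAut_inv polyAut_mul.
Proof.
move=> [[g g'] p]; apply: val_inj => /=.
by case/andP: p => _ /= /eqP ->.
Qed.

Fact polyAut_mulgV : right_inverse polyAut_one polyAut_inv polyAut_mul.
Proof.
move=> [[g g'] p]; apply: val_inj => /=.
by case/andP: p => /= /eqP ->.
Qed.

HB.instance Definition _ := isGroup.Build polyAut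
  polyAut_mulA polyAut_mul1g polyAut_mulg1 polyAut_mulVg polyAut_mulgV.

Definition polyAut_act (g : polyAut) (x : affine k n) : affine k n :=
  [ffun i => (polyAut_coord g i).@[x]].

Lemma polyAut_actM (g h : polyAut) x :
  polyAut_act (g * h)%g x = polyAut_act g (polyAut_act h x).
Proof.
apply/ffunP => i; rewrite !ffunE /polyAut_coord /= tnth_mktuple comp_mpoly_meval.
by apply: meval_eq => j; rewrite ffunE.
Qed.

Definition Jac (g : polyAut) : {mpoly k[n]} :=
  \det (\matrix_(i < n, j < n) (polyAut_coord g i)^`M(j)).

Definition AutS : set polyAut := [set g | Jac g = 1].

Definition GLn : set polyAut :=
  [set g | exists A : 'M[k]_n,
     forall i, polyAut_coord g i = \sum_(j < n) A i j *: 'X_j].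

Definition SLn : set polyAut := GLn `&` AutS.

Definition diagT : set polyAut :=
  [set g | exists t : 'I_n -> k,
     forall i, t i != 0 /\ polyAut_coord g i = t i *: 'X_i].

Definition diagTS : set polyAut := diagT `&` AutS.

Definition is_algebraic_hom (G : algGroupType k)
    (phi : {multiplicative G -> polyAut}) :=
  is_morphism (fun z : vprod G (affine k n) => polyAut_act (phi z.1) z.2).

Definition is_algebraic (H : set polyAut) :=
  exists (G : algGroupType k) (phi : {multiplicative G -> polyAut}),
    is_algebraic_hom phi /\ H = range phi.

(* The algebraic subgroup H = phi(G) carries the structure of G / ker phi, so *)
(* its identity component is phi(G^0), where G^0 is the connected component   *)
(* of 1 in the Zariski topology of G.                                         *)
Definition is_identity_component (H H0 : set polyAut) :=
  exists (G : algGroupType k) (phi : {multiplicative G -> polyAut}),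
    [/\ is_algebraic_hom phi, H = range phi
      & H0 = phi @` connected_component setT (1%g : G)].

(* For injective phi the structure G / ker phi carried by phi(G) is that of   *)
(* G; in characteristic 0 it does not depend on the choice of phi.            *)
Definition is_torus_subgroup (r : nat) (H : set polyAut) :=
  exists (G : algGroupType k) (phi : {multiplicative G -> polyAut}),
    [/\ is_torus r G, is_algebraic_hom phi, injective phi & H = range phi].

End PolyAut.

Arguments AutS : clear implicits.
Arguments GLn : clear implicits.
Arguments SLn : clear implicits.
Arguments diagT : clear implicits.
Arguments diagTS : clear implicits.

Definition maximal_in (T : Type) (S : set (set T)) (M : set T) :=
  S M /\ forall H, S H -> M `<=` H -> H = M.

(* Main.v *)
Require Import Defs.
From HB Require Import structures.
From mathcomp Require Import all_boot all_order all_algebra.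
From mathcomp Require Import all_classical topology.
From mathcomp Require Import mpoly.
From mathcomp Require Import perm.
From mathcomp Require cyclic.
From mathcomp Require Import ring zify.

Set Implicit Arguments.
Unset Strict Implicit.
Unset Printing Implicit Defensive.

Import GRing.Theory.

Local Open Scope classical_set_scope.
Local Open Scope ring_scope.

(* A torus of dimension n - 1 in Aut^* A^n acts on A = k[x_1, ..., x_n], and
   rationality of the action of each one-parameter subgroup makes A graded by
   the characters of the torus.  Contracting the invariant form
   dx_1 ^ ... ^ dx_n with the n - 1 vector fields of the torus gives the exact
   form df of an invariant polynomial f, and a derivation T with T f = f shows
   that the ring of invariants is k[g].  The semi-invariant divisors of the
   powers of g span A, and n of them with independent differentials at a common
   zero are coordinates of A^n.  So the torus is conjugate to D_n^*.
   An automorphism normalizing D_n^* is monomial when n > 1, and the identity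
   component is normal, so every group of the family lies in a conjugate of the
   group N of monomial matrices of determinant 1.  Every element of D_n^* is an
   n!-th power and the n!-th power of a monomial matrix is diagonal, so N lies in
   its conjugate by g only if g normalizes N.  For n = 1 the torus is trivial; a
   group of the family is then finite, since a variety has finitely many
   connected components, and characteristic 0 leaves no nontrivial finite group
   of translations. *)

(** * Polynomials, derivations and Jacobians *)

(** Everything is extracted from the identity Jac(x_1, ..., x_n) = 1. Expanded over the weight
    components of the coordinates, it keeps only the tuples of total weight 0, because 1 is
    invariant. Each such tuple contributes one summand to a primitive [f] of the contracted form and
    one to [T], whose shape is dictated by the relation T(a) df = f da for invariant [a]. This
    first-order equation does the work of geometry: an eigenvector of [T] is determined by its value
    at one point, so eigenspaces are lines, and comparing top degrees shows that the eigenvalue of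
    [a] is deg a / deg f. The second difficulty is that degree is only a filtration while the weight
    spaces are infinite-dimensional; weight and degree together determine a semi-invariant divisor
    of a power of [g] up to a scalar, and Nakayama's lemma runs on that finer grading. Finally, an
    algebraic action is only given locally by fractions. Expanding the denominator at the origin and
    truncating makes the orbit of a polynomial rational in the parameter, and the group law removes
    all poles except 0. *)

Lemma mpoly_ring_ind (R : comNzRingType) n (P : {mpoly R[n]} -> Prop) :
  (forall c, P c%:MP) -> (forall i, P 'X_i) ->
  (forall p q, P p -> P q -> P (p + q)) -> (forall p q, P p -> P q -> P (p * q)) ->
  forall p, P p.
Proof.
move=> PC PX PD PM p; rewrite [p]mpolyE.
apply: (big_ind P) => [|//|m _]; first by rewrite -mpolyC0.
rewrite -mul_mpolyC; apply: (PM) => //; rewrite mpolyXE_id.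
apply: (big_ind P) => [|//|i _]; first by rewrite -mpolyC1.
by elim: (m i) => [|j IH]; rewrite ?expr0 -?mpolyC1 ?exprS; auto.
Qed.

Section MpolyBasics.
Context {k : closedFieldType} {n : nat}.
Hypothesis char0 : [pchar k] =i pred0.
Local Notation A := {mpoly k[n]}.
Implicit Types (p q a b : A).

Lemma submmm (m : 'X_{1..n}) : (m - m = 0)%MM.
Proof. by apply/mnmP => i; rewrite mnmBE mnm0E subnn. Qed.

Lemma natr_eq0 (j : nat) : (j%:R == 0 :> k) = (j == 0)%N.
Proof. by move/pcharf0P: char0 => ->. Qed.

(** The chain rule for a derivation along an arbitrary ring morphism; it serves both for
    substitution of polynomials and for restriction to a line. *)
Lemma derivation_chain (B : comNzRingType) (phi : {rmorphism A -> B}) (D : B -> B) :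
  (forall x y, D (x + y) = D x + D y) ->
  (forall x y, D (x * y) = D x * y + x * D y) ->
  (forall c, D (phi c%:MP) = 0) ->
  forall a, D (phi a) = \sum_l phi a^`M(l) * D (phi 'X_l).
Proof.
move=> DD DM D0; elim/mpoly_ring_ind => [c|i|p q IHp IHq|p q IHp IHq].
- by rewrite D0 big1 // => l _; rewrite mderivC rmorph0 mul0r.
- rewrite (bigD1 i) //= big1 => [|l li]; rewrite mderivX mnm1E.
    by rewrite eqxx scale1r submmm mpolyX0 rmorph1 mul1r addr0.
  by rewrite eq_sym (negPf li) scale0r rmorph0 mul0r.
- rewrite rmorphD DD IHp IHq -big_split; apply: eq_bigr => l _.
  by rewrite mderivD rmorphD mulrDl.
- rewrite rmorphM DM IHp IHq mulr_suml mulr_sumr -big_split; apply: eq_bigr => l _.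
  rewrite mderivM rmorphD !rmorphM /=; ring.
Qed.

Lemma mderiv_comp m (p : {mpoly k[n]}) (g : n.-tuple {mpoly k[m]}) (j : 'I_m) :
  (p \mPo g)^`M(j) = \sum_l (p^`M(l) \mPo g) * (tnth g l)^`M(j).
Proof.
rewrite (@derivation_chain _ (comp_mpoly g) (mderiv j)).
- by apply: eq_bigr => l _; rewrite /= comp_mpolyXU -tnth_nth.
- exact: mderivD.
- exact: mderivM.
- by move=> c; rewrite /= comp_mpolyC mderivC.
Qed.

Lemma mpoly_const_mderiv0 p : (forall l, p^`M(l) = 0) -> p = (p@_0%MM)%:MP.
Proof.
move=> p0; apply/mpolyP => m; rewrite mcoeffC.
have [->|m0] := eqVneq m 0%MM; first by rewrite mulr1.
rewrite mulr0; have [i mi] : exists i, m i != 0%N.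
  apply/existsP; apply: contra_neqT m0; rewrite negb_exists => /forallP h.
  by apply/mnmP => i; rewrite mnm0E; apply/eqP; have := h i; rewrite negbK.
have := mcoeff_deriv i (m - U_(i))%MM p; rewrite p0 mcoeff0 submK ?lep1mP //.
by move/esym/eqP; rewrite -mulr_natr mulf_eq0 natr_eq0 orbF => /eqP.
Qed.

End MpolyBasics.

Lemma poly_eval0 (k : closedFieldType) (p : {poly k}) : (forall t, p.[t] = 0) -> p = 0.
Proof.
move=> p0; apply/eqP; apply: contraT => /closed_nonrootP[x].
by rewrite /root p0 eqxx.
Qed.

Lemma ord_widen_or_max n (i : 'I_n.+1) :
  (exists j, i = widen_ord (leqnSn n) j) \/ i = ord_max.
Proof.
have [->|/eqP ni] := eqVneq i ord_max; [by right|left].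
have li : (i < n)%N.
  have := ltn_ord i; rewrite ltnS leq_eqVlt => /orP[/eqP e|//].
  by case: ni; apply: val_inj.
by exists (Ordinal li); apply: val_inj.
Qed.

(** * Polynomials as univariate polynomials in the last variable *)

Section Muni.
Context {R : idomainType} {n : nat}.
Implicit Types (p : {mpoly R[n.+1]}).

Lemma muniXmax : muni 'X_ord_max = 'X :> {poly {mpoly R[n]}}.
Proof.
rewrite muniE msuppX big_seq1 mcoeffX eqxx scale1r mnm1E eqxx expr1.
rewrite (_ : [multinom _ | _ < _] = 0%MM) ?mpolyX0 ?scale1r //.
apply/mnmP => i; rewrite mnmE mnm1E mnm0E; apply/eqP; rewrite eqb0 -val_eqE /=.
by rewrite gtn_eqF.
Qed.

Lemma muniXwiden (i : 'I_n) : muni 'X_(widen_ord (leqnSn n) i) = ('X_i)%:P :> {poly {mpoly R[n]}}.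
Proof.
rewrite muniE msuppX big_seq1 mcoeffX eqxx scale1r mnm1E -val_eqE /= ltn_eqF //.
rewrite expr0 -mul_polyC mulr1; congr ('X_[_])%:P.
by apply/mnmP => j; rewrite mnmE !mnm1E -!val_eqE.
Qed.

Lemma meval_muni p (v : 'I_n.+1 -> R) :
  p.@[v] = (map_poly (meval (fun i => v (widen_ord (leqnSn n) i))) (muni p)).[v ord_max].
Proof.
elim/mpoly_ring_ind: p => [c|i|p q IHp IHq|p q IHp IHq].
- by rewrite mevalC muniC map_polyC /= hornerC mevalC.
- rewrite mevalXU; have [[j ->]|->] := ord_widen_or_max i.
    by rewrite muniXwiden map_polyC /= hornerC mevalXU.
  by rewrite muniXmax map_polyX hornerX.
- by rewrite mevalD muniD rmorphD hornerD IHp IHq.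
- by rewrite mevalM muniM rmorphM hornerM IHp IHq.
Qed.

Lemma muniK p : (map_poly (@mwiden _ _) (muni p)).['X_ord_max] = p.
Proof.
elim/mpoly_ring_ind: p => [c|i|p q IHp IHq|p q IHp IHq].
- by rewrite muniC map_polyC /= hornerC mwidenC.
- have [[j ->]|->] := ord_widen_or_max i.
    rewrite muniXwiden map_polyC /= hornerC mwidenX mnmwiden1; congr 'X_[_].
  by rewrite muniXmax map_polyX hornerX.
- by rewrite muniD rmorphD hornerD; congr (_ + _).
- by rewrite muniM rmorphM hornerM; congr (_ * _).
Qed.

Lemma muni_inj : injective (@muni n R).
Proof. by move=> p q pq; rewrite -[p]muniK pq muniK. Qed.

End Muni.

Lemma mpoly_eval0 (k : closedFieldType) n (p : {mpoly k[n]}) :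
  (forall v : 'I_n -> k, p.@[v] = 0) -> p = 0.
Proof.
elim: n p => [|n IH] p p0.
  have e := nvar0_mpolyC p; have := p0 (fun=> 0).
  by rewrite e mevalC => ->; rewrite mpolyC0.
apply: muni_inj; rewrite muni0; apply/polyP => j; rewrite coef0; apply: IH => v.
rewrite -coef_map /=; suff -> : map_poly (meval v) (muni p) = 0 by rewrite coef0.
apply: poly_eval0 => t.
pose w (i : 'I_n.+1) := if unlift ord_max i is Some j then v j else t.
have := p0 w; rewrite meval_muni {2}/w unlift_none => <-; congr (_.[_]).
apply: eq_map_poly => q; apply: meval_eq => i; rewrite /w.
have -> : widen_ord (leqnSn n) i = lift ord_max i.
  by apply: val_inj; rewrite /= /bump leqNgt ltn_ord.
by rewrite liftK.
Qed.

Section Euler.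
Context {k : closedFieldType} {n : nat}.
Hypothesis char0 : [pchar k] =i pred0.
Local Notation A := {mpoly k[n]}.
Implicit Types (p q a b f z : A).

Definition euler a : A := \sum_l 'X_l * a^`M(l).

Lemma mcoeff_euler a m : (euler a)@_m = a@_m *+ mdeg m.
Proof.
rewrite raddf_sum mdegE -sumrMnr; apply: eq_bigr => l _ /=.
have [ml0|ml0] := eqVneq (m l) 0%N.
  rewrite ml0 mulr0n; apply: memN_msupp_eq0; rewrite mulrC.
  apply/negP; rewrite (perm_mem (msuppMX _ _)) => /mapP[m' _ mE].
  by move: ml0; rewrite mE mnmDE mnm1E eqxx.
have e : (U_(l) + (m - U_(l)))%MM = m by rewrite addmC submK ?lep1mP.
rewrite mulrC -{1}e mcoeffMX mcoeff_deriv addmC e mnmBE mnm1E eqxx.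
by rewrite subn1 prednK // lt0n.
Qed.

Lemma msize_coef_le p N : (forall m, (N <= mdeg m)%N -> p@_m = 0) -> (msize p <= N)%N.
Proof.
move=> pN; have [->|p0] := eqVneq p 0; first by rewrite msize0.
rewrite -mlead_deg // ltnNge; apply/negP => /pN /eqP.
by rewrite mleadc_eq0 (negPf p0).
Qed.

Lemma msize_coef0 p m : (msize p <= mdeg m)%N -> p@_m = 0.
Proof. by move=> h; apply: memN_msupp_eq0; apply: msize_mdeg_ge. Qed.

Lemma msize_euler a : a != 0 ->
  (msize (euler a - (msize a).-1%:R *: a) < msize a)%N.
Proof.
move=> a0; rewrite [X in (_ < X)%N](mpolySpred _ a0) ltnS.
apply: msize_coef_le => m mm; rewrite mcoeffB mcoeffZ mcoeff_euler -[_ *+ mdeg m]mulr_natl.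
move: mm; rewrite leq_eqVlt => /orP[/eqP <-|mm]; first by rewrite subrr.
by rewrite (@msize_coef0 a) ?mulr0 ?subr0 // (mpolySpred _ a0).
Qed.

(* Comparing top-degree parts: [z] has leading part [(deg a / deg f) a]. *)
Lemma euler_lead_lt f a z : (1 < msize f)%N -> a != 0 ->
  z * euler f = f * euler a ->
  (msize (z - ((msize a).-1%:R / (msize f).-1%:R) *: a)%R < msize a)%N.
Proof.
move=> f1 a0 zf; set e := (msize a).-1; set d := (msize f).-1.
have f0 : f != 0 by rewrite -(msize_poly_eq0 f) -lt0n; exact: ltnW f1.
have d0 : d%:R != 0 :> k by rewrite natr_eq0 // /d -lt0n -subn1 subn_gt0.
set b := z - _.
have [->|b0] := eqVneq b 0; first by rewrite msize0 lt0n msize_poly_eq0.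
set a' := euler a - e%:R *: a; set f' := euler f - d%:R *: f.
have bE : b * euler f = f * a' - (e%:R / d%:R) *: (a * f').
  rewrite /b /a' /f' mulrBl zf !mulrBr -!scalerAl -!scalerAr scalerBr !scalerA.
  rewrite divfK // (mulrC f a); set u := _ *: (a * f); set v := _ *: (a * euler f).
  by rewrite opprB addrA subrK.
have sa' : (msize a' < msize a)%N by apply: msize_euler.
have sf' : (msize f' < msize f)%N by apply: msize_euler.
have sEf : msize (euler f) = msize f.
  have : euler f = d%:R *: f + f' by rewrite addrC subrK.
  move=> ->; apply/eqP; rewrite eqn_leq; apply/andP; split.
    by rewrite (leq_trans (msizeD_le _ _)) // geq_max msizeZ // leqnn ltnW.
  rewrite leqNgt; apply/negP => lt.
  have : (msize (d%:R *: f) < msize f)%N.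
    rewrite (_ : d%:R *: f = (d%:R *: f + f') - f'); last by rewrite addrK.
    by rewrite (leq_ltn_trans (msizeD_le _ _)) // gtn_max lt msizeN.
  by rewrite msizeZ // ltnn.
have Ef0 : euler f != 0 by rewrite -msize_poly_eq0 sEf msize_poly_eq0.
have sM p q : (msize (p * q) <= (msize p + msize q).-1)%N.
  have [->|p0] := eqVneq p 0; first by rewrite mul0r msize0.
  have [->|q0] := eqVneq q 0; first by rewrite mulr0 msize0.
  by rewrite msizeM.
have : (msize (b * euler f) < (msize a + msize f).-1)%N.
  rewrite bE (leq_ltn_trans (msizeD_le _ _)) // gtn_max msizeN.
  have h1 := sM f a'; have h2 := sM a f'.
  have h3 : (msize ((e%:R / d%:R) *: (a * f')) <= msize (a * f'))%N by exact: msizeZ_le.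
  apply/andP; split.
    apply: (leq_ltn_trans h1); move: sa' f1; clear; move: (msize f) (msize a') (msize a); lia.
  apply: (leq_ltn_trans h3); apply: (leq_ltn_trans h2).
  move: sf' f1; clear; move: (msize f) (msize f') (msize a); lia.
rewrite msizeM // sEf; move: f1; clear; move: (msize f) (msize b) (msize a); lia.
Qed.

End Euler.

(** * Restriction to lines and first-order linear equations *)

Section Line.
Context {k : closedFieldType} {n : nat}.
Hypothesis char0 : [pchar k] =i pred0.
Local Notation A := {mpoly k[n]}.
Implicit Types (a f : A).

Definition restr_line (v w : 'I_n -> k) (a : A) : {poly k} :=
  mmap polyC (fun l => (v l)%:P + w l *: 'X) a.

HB.instance Definition _ v w := GRing.RMorphism.copy (restr_line v w)
  (mmap polyC (fun l => (v l)%:P + w l *: 'X)).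

Lemma restr_lineX v w i : restr_line v w 'X_i = (v i)%:P + w i *: 'X.
Proof. by rewrite /restr_line mmapX mmap1U. Qed.

Lemma horner_restr_line v w a t : (restr_line v w a).[t] = a.@[fun l => v l + w l * t].
Proof.
elim/mpoly_ring_ind: a => [c|i|p q IHp IHq|p q IHp IHq].
- by rewrite /restr_line mmapC hornerC mevalC.
- by rewrite restr_lineX mevalXU hornerD hornerC hornerZ hornerX.
- by rewrite rmorphD hornerD IHp IHq mevalD.
- by rewrite rmorphM hornerM IHp IHq mevalM.
Qed.

Lemma deriv_restr_line v w a :
  (restr_line v w a)^`() = \sum_l restr_line v w a^`M(l) * (w l)%:P.
Proof.
rewrite (derivation_chain (D := fun p => p^`())).
- apply: eq_bigr => l _; rewrite /= restr_lineX derivD derivC add0r.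
  by rewrite derivZ derivX alg_polyC.
- exact: derivD.
- exact: derivM.
- by move=> c; rewrite /= /restr_line mmapC derivC.
Qed.

(** Write [p = r X^m] with [r(0)] nonzero and [m > 0]. Dividing the equation by [X^(m-1)] and
    evaluating at 0 leaves [m q(0) r(0) = 0], which characteristic 0 forbids. *)
Lemma linear_ode_poly (p q c : {poly k}) :
  q.[0] != 0 -> p.[0] = 0 -> q * p^`() = p * c -> p = 0.
Proof.
move=> q0 p0 E; apply/eqP; apply: contraT => pn0.
have [m [r rn0 pE]] := multiplicity_XsubC p 0.
rewrite pn0 /= in rn0; move: pE; rewrite subr0 => pE.
case: m pE => [|m] pE.
  by move: p0 rn0; rewrite pE expr0 mulr1 /root => ->; rewrite eqxx.
have : q * (r^`() * 'X + r *+ m.+1) = r * 'X * c.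
  apply: (mulIf (expf_neq0 m (negbT (polyX_eq0 _)))); move: E; rewrite pE.
  rewrite derivM derivXn exprS /= -(mulr_natr 'X^m) -(mulr_natr r) => E.
  transitivity (q * (r^`() * ('X * 'X^m) + r * ('X^m * m.+1%:R))); first by ring.
  by rewrite E; ring.
move/(congr1 (fun p => p.[0])); rewrite !(hornerE, hornerMn, mulr0, mul0r, add0r) => /eqP.
rewrite mulf_eq0 (negPf q0) -mulr_natr mulf_eq0 natr_eq0 // orbF.
by rewrite /= -/(root r 0) (negPf rn0).
Qed.

(* An integral curve argument: [a] solves a linear differential equation that
   is regular at [v], so it vanishes identically as soon as it vanishes at [v]. *)
Lemma linear_ode_vanish a f (u : 'I_n -> A) (v : 'I_n -> k) :
  (forall l, f * a^`M(l) = a * u l) -> f.@[v] != 0 -> a.@[v] = 0 -> a = 0.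
Proof.
move=> ode fv av; apply: mpoly_eval0 => w.
pose w' l := w l - v l.
suff pa0 : restr_line v w' a = 0.
  have := horner_restr_line v w' a 1; rewrite pa0 horner0 => ->.
  by apply: meval_eq => l; rewrite /w' mulr1 addrC subrK.
set p := restr_line v w' a; set q := restr_line v w' f.
have q0 : q.[0] != 0.
  by rewrite horner_restr_line; under meval_eq => l do rewrite mulr0 addr0.
have p0 : p.[0] = 0.
  by rewrite horner_restr_line -[RHS]av; apply: meval_eq => l; rewrite mulr0 addr0.
pose c := \sum_l restr_line v w' (u l) * (w' l)%:P.
have E : q * p^`() = p * c.
  rewrite deriv_restr_line !mulr_sumr; apply: eq_bigr => l _.
  by rewrite !mulrA -!rmorphM /= ode.
exact: (linear_ode_poly q0 p0 E).
Qed.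

End Line.

(** The part of integral closedness that is needed: an element of the fraction field whose m-th
    power lies in [R] lies in [R]. In this form it passes from [R] to polynomials over [R]. *)
Definition root_closed (R : comNzRingType) := forall (u v z : R) m,
  (0 < m)%N -> v != 0 -> u ^+ m = v ^+ m * z -> exists y, u = v * y.

Section RootClosed.
Variables (k : closedFieldType) (R : idomainType) (iota : {rmorphism k -> R}).

Lemma exists_notin (s : seq k) : exists a, a \notin s.
Proof.
have : \prod_(b <- s) ('X - b%:P) != 0 :> {poly k}.
  by apply: monic_neq0; apply: monic_prod_XsubC.
by move/closed_nonrootP=> [a]; rewrite root_prod_XsubC; exists a.
Qed.

(* Divided differences at the points of [k], whose differences are invertible. *)
Lemma dvd_of_evals (c : R) N (q : {poly R}) (s : seq k) : (size q <= N)%N ->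
  (forall a, a \notin s -> exists y, q.[iota a] = c * y) -> exists q', q = c *: q'.
Proof.
elim: N q s => [|N IH] q s.
  by rewrite leqn0 size_poly_eq0 => /eqP -> _; exists 0; rewrite scaler0.
move=> sq qs; have [a0 a0s] := exists_notin s.
have /factor_theorem[q1 q1E] : root (q - q.[iota a0]%:P) (iota a0).
  by rewrite /root !hornerE subrr.
have qE : q = q1 * ('X - (iota a0)%:P) + q.[iota a0]%:P by rewrite -q1E subrK.
have [y0 y0E] := qs _ a0s.
have [||q' q'E] := IH q1 (a0 :: s).
- have [->|q10] := eqVneq q1 0; first by rewrite size_poly0.
  have [sq1|sq1] := leqP (size q) 1.
    move: q1E; rewrite (size1_polyC sq1) hornerC subrr => /esym/eqP.
    by rewrite mulf_eq0 (negPf q10) polyXsubC_eq0.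
  have : size (q1 * ('X - (iota a0)%:P)) = size q.
    rewrite -q1E size_polyDl // size_polyN.
    exact: leq_ltn_trans (size_polyC_leq1 _) sq1.
  rewrite size_Mmonic ?monicXsubC // size_XsubC addn2 /= => e.
  by move: sq; rewrite -e.
- move=> a; rewrite inE negb_or => /andP[aa0 as_].
  have [y yE] := qs _ as_.
  exists ((y - y0) * iota (a - a0)^-1).
  have aa : iota (a - a0) * iota (a - a0)^-1 = 1.
    by rewrite -rmorphM mulfV ?rmorph1 // subr_eq0.
  have : q.[iota a] - q.[iota a0] = q1.[iota a] * iota (a - a0).
    by rewrite {1}qE !hornerE addrK rmorphB.
  rewrite yE y0E -mulrBr => E.
  by rewrite mulrA E -mulrA aa mulr1.
exists (q' * ('X - (iota a0)%:P) + y0%:P).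
by rewrite qE q'E y0E scalerDr -scalerAl -!mul_polyC -polyCM.
Qed.

(** Divisibility over the fraction field gives [c u = q v] with a nonzero constant [c] of [R], and
    then [q^m = c^m z]. Root closedness of [R] makes [c] divide [q] at every point of [k], hence [c]
    divides [q] itself. *)
Lemma root_closed_poly : root_closed R -> root_closed {poly R}.
Proof.
move=> RC u v z m m0 v0 uvz.
have vm0 : v ^+ m != 0 by rewrite expf_neq0.
have /Pdiv.Idomain.dvdpP[[c q] /= c0 cq] : (v %| u)%R.
  by rewrite -(dvdp_pexp2r _ _ m0) uvz dvdp_mulr.
have qm : q ^+ m = (c ^+ m)%:P * z.
  apply: (mulIf vm0); rewrite -exprMn -cq exprZn uvz -mul_polyC; ring.
have [|q' q'E] := @dvd_of_evals c (size q) q [::] (leqnn _).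
  move=> a _; apply: (RC _ _ z.[iota a] m m0 c0).
  by rewrite -horner_exp qm !hornerE.
exists q'; apply: (@mulfI _ c%:P); first by rewrite polyC_eq0.
by rewrite mul_polyC cq q'E -mul_polyC; ring.
Qed.
End RootClosed.

Lemma root_closed_mpoly (k : closedFieldType) n : root_closed {mpoly k[n]}.
Proof.
elim: n => [|n IH] u v z m m0 v0 uvz.
  have v00 : v@_0%MM != 0.
    by apply: contraNneq v0 => e; rewrite [v]nvar0_mpolyC e mpolyC0.
  exists (u * (v@_0%MM)^-1%:MP); rewrite [v in v * _]nvar0_mpolyC mulrCA -mpolyCM.
  by rewrite divff // mulr1.
have [||y yE] := root_closed_poly (@mpolyC n k) IH (u := muni u) (v := muni v) (z := muni z) m0.
- by rewrite -(inj_eq (@muni_inj _ _)) muni0 in v0.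
- have e w : muni (w ^+ m) = muni w ^+ m by exact: rmorphXn.
  by have := congr1 (@muni n k) uvz; rewrite muniM !e.
exists (map_poly (@mwiden _ _) y).['X_ord_max].
rewrite -[u]muniK yE rmorphM hornerM; congr (_ * _); exact: muniK.
Qed.

Section Misc.
Context {k : closedFieldType} {n : nat}.
Hypothesis char0 : [pchar k] =i pred0.
Local Notation A := {mpoly k[n]}.
Implicit Types (a p : A).

Definition jac (a : 'I_n -> A) : A := \det (\matrix_(i, j) (a i)^`M(j)).

Lemma jac_comp (a : 'I_n -> A) (g : n.-tuple A) :
  jac (fun i => a i \mPo g) = (jac a \mPo g) * jac (tnth g).
Proof.
rewrite /jac -[_ \mPo g]/((comp_mpoly g : {rmorphism _ -> _}) _) -det_map_mx -det_mulmx; congr (\det _).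
apply/matrixP => i j; rewrite !mxE mderiv_comp; apply: eq_bigr => l _.
by rewrite !mxE.
Qed.

Lemma jac_id : jac (fun i => 'X_i) = 1.
Proof.
rewrite /jac (_ : \matrix_(i, j) _ = 1%:M) ?det1 //; apply/matrixP => i j.
rewrite !mxE mderivX mnm1E; case: eqP => [->|_]; last by rewrite scale0r.
by rewrite submmm mpolyX0 scale1r.
Qed.

Lemma msize_mderiv a l : a != 0 -> (msize a^`M(l) < msize a)%N.
Proof.
move=> a0; rewrite [X in (_ < X)%N](mpolySpred _ a0) ltnS.
apply: msize_coef_le => m mm; rewrite mcoeff_deriv msize_coef0 ?mul0rn //.
by rewrite mdegD mdeg1 addn1 (mpolySpred _ a0).
Qed.

(** Differentiating a relation [a(u) = 0] gives a linear relation between the rows of an invertible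
    matrix, so the partial derivatives of [a] are relations of smaller degree. By induction they
    vanish, and [a] is a constant. *)
Lemma jac_indep (u : n.-tuple A) a : jac (tnth u) != 0 -> a \mPo u = 0 -> a = 0.
Proof.
move=> J0; move: {2}(msize a).+1 (ltnSn (msize a)) => N.
elim: N a => // N IH a aN au; have [//|a0] := eqVneq a 0.
have /mpoly_const_mderiv0 ac : forall l, a^`M(l) = 0.
  pose v := \row_l (a^`M(l) \mPo u).
  have v0 : v = 0.
    apply/eqP; apply: contraNT J0 => v0; apply/det0P; exists v => //.
    apply/rowP => j; rewrite mxE [RHS]mxE; transitivity ((a \mPo u)^`M(j)); last by rewrite au mderiv0.
    rewrite mderiv_comp; by apply: eq_bigr => l _; rewrite !mxE.
  move=> l; apply: IH; last by have := congr1 (fun v : 'rV_n => v 0 l) v0; rewrite !mxE.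
  exact: leq_trans (msize_mderiv _ a0) aN.
by move: au; rewrite ac // comp_mpolyC.
Qed.

Lemma horner_alg_transc (g : A) (P : {poly k}) : (1 < msize g)%N ->
  horner_alg g P = 0 -> P = 0.
Proof.
move=> g1; move: {2}(size P).+1 (ltnSn (size P)) => N.
elim: N P => // N IH P PN Pg; have [//|P0] := eqVneq P 0.
have P'0 : P^`() = 0.
  apply: IH; first by apply: leq_trans (lt_size_deriv P0) PN.
  have [l gl] : exists l, g^`M(l) != 0.
    apply/existsP; apply: contraTT g1; rewrite negb_exists => /forallP h.
    have -> : g = (g@_0%MM)%:MP.
      by apply: mpoly_const_mderiv0 => // l; apply/eqP; have := h l; rewrite negbK.
    by rewrite msizeC -leqNgt; case: (_ != 0).
  apply: (mulIf gl); rewrite mul0r -[RHS](mderiv0 _ l) -Pg.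
  elim/poly_ind: P {PN Pg P0} => [|P c IHP]; first by rewrite deriv0 !rmorph0 mderiv0 mul0r.
  rewrite derivMXaddC !rmorphD !rmorphM /= !horner_algX !horner_algC mderivD mderivM.
  by rewrite -IHP alg_mpolyC mderivC addr0; ring.
move: Pg; rewrite [P]size1_polyC; last first.
  rewrite leqNgt; apply/negP => s1; have := lead_coef_eq0 P; rewrite (negPf P0).
  have := coef_deriv P (size P).-2; rewrite P'0 coef0 prednK ?(ltn_predRL) // => /esym/eqP.
  by rewrite -mulr_natr mulf_eq0 natr_eq0 // lead_coefE => /orP[->|/eqP //]; lia.
by rewrite horner_algC => /eqP; rewrite alg_mpolyC mpolyC_eq0 => /eqP ->.
Qed.
End Misc.

(** * Semi-invariants of a torus action *)

Section Characters.
Context {k : closedFieldType} {r : nat}.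
Hypothesis char0 : [pchar k] =i pred0.

Definition torus_char (chi : 'rV[int]_r) (t : 'I_r -> k) : k :=
  \prod_i t i ^ chi 0 i.

Definition torus_pt (t : 'I_r -> k) := forall i, t i != 0.

Lemma torus_charD chi psi t : torus_pt t ->
  torus_char (chi + psi) t = torus_char chi t * torus_char psi t.
Proof.
by move=> t0; rewrite -big_split; apply: eq_bigr => i _; rewrite mxE expfzDr.
Qed.

Lemma torus_char0 t : torus_char 0 t = 1.
Proof. by rewrite /torus_char big1 // => i _; rewrite mxE expr0z. Qed.

Lemma torus_char_neq0 chi t : torus_pt t -> torus_char chi t != 0.
Proof. by move=> t0; apply/prodf_neq0 => i _; rewrite expfz_neq0. Qed.

Lemma expz2_eq1 (z : int) : (2%:R : k) ^ z = 1 -> z = 0.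
Proof.
have E (m : nat) : (2%:R : k) ^+ m = 1 -> m = 0%N.
  move=> /eqP; rewrite -natrX -subr_eq0 -[X in _ - X]/(1%:R) -natrB ?expn_gt0 // natr_eq0 //.
  by case: m => // m; rewrite subn_eq0 leqNgt -{1}(expn0 2) ltn_exp2l.
case: z => m; first by rewrite -exprnP => /E ->.
by rewrite NegzE -exprnN => /eqP; rewrite invr_eq1 => /eqP /E.
Qed.

Lemma nat2_neq0 : (2%:R : k) != 0.
Proof. by rewrite natr_eq0 //. Qed.

(** In characteristic 0 the element 2 has infinite multiplicative order, so the point with 2 in a
    place where the exponents differ, and 1 elsewhere, separates the characters. *)
Lemma torus_char_sep chi psi : chi != psi ->
  exists2 t, torus_pt t & torus_char chi t != torus_char psi t.
Proof.
move=> cp; have [i ip] : exists i, chi 0 i != psi 0 i.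
  apply/existsP; apply: contraNT cp; rewrite negb_exists => /forallP h.
  by apply/eqP/rowP => i; apply/eqP; have := h i; rewrite negbK.
pose t j : k := if j == i then 2%:R else 1.
have t0 : torus_pt t by move=> j; rewrite /t; case: (j == i); rewrite ?nat2_neq0 ?oner_eq0.
have tE (xi : 'rV_r) : torus_char xi t = 2%:R ^ xi 0 i.
  rewrite /torus_char (bigD1 i) //= /t eqxx big1 ?mulr1 // => j /negPf ->.
  exact: exp1rz.
exists t => //; apply: contraNneq ip; rewrite !tE => e.
rewrite -subr_eq0; apply/eqP/expz2_eq1.
by rewrite expfzDr ?nat2_neq0 // e -expfzDr ?nat2_neq0 // subrr expr0z.
Qed.
End Characters.

Section Homogeneous.
Context {k : closedFieldType} {r n : nat}.
Hypothesis char0 : [pchar k] =i pred0.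
Local Notation A := {mpoly k[n]}.
Local Notation W := 'rV[int]_r.
Variable G : ('I_r -> k) -> n.-tuple A.

Definition semiinv (chi : W) (a : A) :=
  forall t, torus_pt t -> a \mPo G t = torus_char chi t *: a.

Lemma semiinv0 chi : semiinv chi 0.
Proof. by move=> t _; rewrite comp_mpoly0 scaler0. Qed.

Lemma semiinvD chi a b : semiinv chi a -> semiinv chi b -> semiinv chi (a + b).
Proof. by move=> ha hb t t0; rewrite comp_mpolyD ha // hb // scalerDr. Qed.

Lemma semiinvZ chi c a : semiinv chi a -> semiinv chi (c *: a).
Proof. by move=> ha t t0; rewrite comp_mpolyZ ha // !scalerA mulrC. Qed.

Lemma semiinvN chi a : semiinv chi a -> semiinv chi (- a).
Proof. by rewrite -scaleN1r; apply: semiinvZ. Qed.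

Lemma semiinvB chi a b : semiinv chi a -> semiinv chi b -> semiinv chi (a - b).
Proof. by move=> ha hb; apply: semiinvD => //; apply: semiinvN. Qed.

Lemma semiinv_sum chi (I : Type) (s : seq I) (P : pred I) (F : I -> A) :
  (forall i, P i -> semiinv chi (F i)) -> semiinv chi (\sum_(i <- s | P i) F i).
Proof.
by move=> h; apply: (big_ind (semiinv chi)) => //; [exact: semiinv0|exact: semiinvD].
Qed.

Lemma semiinvM chi psi a b : semiinv chi a -> semiinv psi b -> semiinv (chi + psi) (a * b).
Proof.
move=> ha hb t t0; rewrite rmorphM /= ha // hb // torus_charD //.
by rewrite -scalerAl -scalerAr scalerA.
Qed.

Lemma semiinvC c : semiinv 0 c%:MP.
Proof. by move=> t t0; rewrite comp_mpolyC torus_char0 scale1r. Qed.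

Lemma semiinv1 : semiinv 0 1.
Proof. by rewrite -mpolyC1; exact: semiinvC. Qed.

Lemma semiinvX chi a j : semiinv chi a -> semiinv (chi *+ j) (a ^+ j).
Proof.
by move=> ha; elim: j => [|j IH]; rewrite ?expr0 ?exprS ?mulrS; [exact: semiinv1|exact: semiinvM].
Qed.

Lemma semiinv_prod (I : Type) (s : seq I) (chi : I -> W) (F : I -> A) :
  (forall i, semiinv (chi i) (F i)) -> semiinv (\sum_(i <- s) chi i) (\prod_(i <- s) F i).
Proof.
move=> h; elim: s => [|i s IH]; rewrite ?big_nil ?big_cons; first exact: semiinv1.
exact: semiinvM.
Qed.

(** Artin's argument: act by a point separating [psi] from the first weight [chi] and subtract a
    multiple of the relation, which removes the term of weight [chi]. *)
Lemma semiinv_indep (s : seq W) (F : W -> A) : uniq s ->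
  (forall chi, chi \in s -> semiinv chi (F chi)) ->
  \sum_(chi <- s) F chi = 0 -> forall chi, chi \in s -> F chi = 0.
Proof.
elim: s F => [|chi s IH] F //= /andP[chis us] hF sF.
have F0 psi : psi \in s -> F psi = 0.
  move=> psis; have cp : psi != chi by apply: contraNneq chis => <-.
  have [t t0 tcp] := torus_char_sep char0 cp.
  have h1 : torus_char chi t *: (\sum_(xi <- s) F xi) = \sum_(xi <- s) torus_char xi t *: F xi.
    move: sF; rewrite big_cons => /eqP; rewrite addr_eq0 => /eqP sF.
    have := congr1 (comp_mpoly (G t)) sF; rewrite hF ?mem_head // sF scalerN.
    rewrite raddfN /= => /oppr_inj ->; rewrite [LHS]raddf_sum /=.
    by apply: eq_big_seq => xi xis; rewrite hF // inE xis orbT.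
  have /eqP : (torus_char psi t - torus_char chi t) *: F psi = 0.
    apply: (IH (fun xi => (torus_char xi t - torus_char chi t) *: F xi)) => // [xi xis|].
      by apply: semiinvZ; apply: hF; rewrite inE xis orbT.
    under eq_bigr do rewrite scalerBl.
    by rewrite sumrB -h1 scaler_sumr subrr.
  by rewrite mscalerI subr_eq0 (negPf tcp) => /eqP.
move=> psi; rewrite inE => /orP[/eqP ->|]; last exact: F0.
by move: sF; rewrite big_cons big_seq big1 ?addr0.
Qed.

(** Grouping terms by weight reduces to independence. Thus an operator that is scalar on each weight
    space is well defined on sums with repeated weights; [semiinv_extract] is the case of a
    projection. *)
Lemma semiinv_weighted (L : seq (W * A)) (c : W -> k) :
  (forall p, p \in L -> semiinv p.1 p.2) -> \sum_(p <- L) p.2 = 0 ->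
  \sum_(p <- L) c p.1 *: p.2 = 0.
Proof.
move=> hL sL; set s := undup (map fst L).
have group (g : W * A -> A) :
    \sum_(p <- L) g p = \sum_(psi <- s) \sum_(p <- L | p.1 == psi) g p.
  rewrite (exchange_big_dep xpredT) //= big_seq [RHS]big_seq; apply: eq_bigr => p pL.
  rewrite -big_filter (_ : [seq psi <- s | p.1 == psi] = [:: p.1]) ?big_seq1 //.
  rewrite -(filter_pred1_uniq (undup_uniq (map fst L))) ?mem_undup ?map_f //.
  by apply: eq_filter => psi; rewrite /= eq_sym.
rewrite group big1_seq // => psi /= psis.
under eq_bigr => p /eqP -> do [].
rewrite -scaler_sumr (semiinv_indep (F := fun psi => \sum_(p <- L | p.1 == psi) p.2) (s := s)) ?scaler0 ?undup_uniq //.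
- move=> chi _; rewrite big_seq_cond; apply: semiinv_sum => p /andP[pL /eqP <-].
  exact: hL.
- by rewrite -group.
Qed.

Lemma semiinv_extract (L : seq (W * A)) psi :
  (forall p, p \in L -> semiinv p.1 p.2) -> \sum_(p <- L) p.2 = 0 ->
  \sum_(p <- L | p.1 == psi) p.2 = 0.
Proof.
move=> hL sL; rewrite -[RHS](semiinv_weighted (fun chi => (chi == psi)%:R) hL sL).
rewrite big_mkcond; apply: eq_bigr => p _.
by case: eqP => _; rewrite ?scale1r ?scale0r.
Qed.

Lemma semiinv_inj chi psi a : a != 0 -> semiinv chi a -> semiinv psi a -> chi = psi.
Proof.
move=> a0 ha hb; apply/eqP; apply: contraT => cp.
have [t t0 /eqP[]] := torus_char_sep char0 cp.
have /eqP := ha t t0; rewrite hb // -subr_eq0 -scalerBl mscalerI (negPf a0) orbF.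
by rewrite subr_eq0 => /eqP.
Qed.

Lemma semiinv_cancel chi psi a b : a != 0 -> semiinv chi a -> semiinv (chi + psi) (a * b) ->
  semiinv psi b.
Proof.
move=> a0 ha hab t t0; have := hab t t0; rewrite rmorphM /= ha // torus_charD // => e.
apply: (@mulfI _ (torus_char chi t *: a)).
  by rewrite mscalerI negb_or torus_char_neq0.
by rewrite e -scalerAr -scalerAl scalerA mulrC.
Qed.

(** Acting by [t] scales each row by a character; the chain rule contributes Jac(G t) = 1, so that
    no further character appears in the weight. *)
Lemma semiinv_jac (a : 'I_n -> A) (psi : 'I_n -> W) :
  (forall t, torus_pt t -> jac (tnth (G t)) = 1) ->
  (forall m, semiinv (psi m) (a m)) -> semiinv (\sum_m psi m) (jac a).
Proof.
move=> J1 ha t t0; rewrite -[LHS]mulr1 -(J1 t t0) -jac_comp.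
rewrite /jac (_ : \matrix_(i, j) _ =
  diag_mx (\row_m (torus_char (psi m) t)%:MP) *m \matrix_(i, j) (a i)^`M(j)).
  rewrite det_mulmx det_diag -mul_mpolyC; congr (_ * _).
  under eq_bigr do rewrite mxE.
  rewrite -rmorph_prod; congr (_%:MP).
  elim/big_rec2: _ => [|m x y _ ->]; first by rewrite torus_char0.
  by rewrite torus_charD.
apply/matrixP => i j; rewrite mul_diag_mx !mxE ha // mderivZ.
by rewrite mul_mpolyC.
Qed.

End Homogeneous.

(** * The Euler vector field of a torus action *)

Section Determinants.
Variables (R : comNzRingType) (n : nat).

Lemma det_sum_rows (I : finType) (F : 'I_n -> I -> 'I_n -> R) :
  \det (\matrix_(i, j) \sum_c F i c j) =
  \sum_(t : {ffun 'I_n -> I}) \det (\matrix_(i, j) F i (t i) j).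
Proof.
rewrite /determinant exchange_big; apply: eq_bigr => s _ /=.
rewrite -mulr_sumr; congr (_ * _).
under eq_bigr do rewrite mxE.
rewrite bigA_distr_bigA; apply: eq_bigr => t _.
by apply: eq_bigr => i _; rewrite mxE.
Qed.

Lemma det_col0 (M : 'M[R]_n.+1) : (forall i, M (lift ord0 i) ord0 = 0) ->
  \det M = M ord0 ord0 * \det (\matrix_(i, j) M (lift ord0 i) (lift ord0 j)).
Proof.
move=> M0; rewrite (expand_det_col _ ord0) big_ord_recl big1 => [|i _]; last first.
  by rewrite M0 mul0r.
rewrite addr0 /cofactor addn0 expr0 mul1r; congr (_ * \det _).
by apply/matrixP => i j; rewrite !mxE.
Qed.

(** The entry of [b] at [ord0] is overwritten, not shifted: a tuple of functions exchanges its first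
    member for [a]. *)
Definition fun_cons (T : Type) (a : T) (b : 'I_n.+1 -> T) (m : 'I_n.+1) : T :=
  if unlift ord0 m is Some _ then b m else a.

Lemma fun_cons0 T (a : T) b : fun_cons a b ord0 = a.
Proof. by rewrite /fun_cons unlift_none. Qed.

Lemma fun_consS T (a : T) b m : fun_cons a b (lift ord0 m) = b (lift ord0 m).
Proof. by rewrite /fun_cons liftK. Qed.

Lemma det_cons_row (u : 'I_n.+1 -> R) (M : 'I_n.+1 -> 'I_n.+1 -> R) :
  \det (\matrix_(i, j) fun_cons u M i j) =
  \sum_l u l * cofactor (\matrix_(i, j) fun_cons (fun=> 0) M i j) ord0 l.
Proof.
rewrite (expand_det_row _ ord0); apply: eq_bigr => l _.
rewrite mxE fun_cons0; congr (_ * (_ * \det _)).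
by apply/matrixP => i j; rewrite !mxE !fun_consS.
Qed.
End Determinants.

Lemma mpoly_mul_const (R : idomainType) n (a b : {mpoly R[n]}) c : c != 0 ->
  a * b = c%:MP -> exists2 c', c' != 0 & a = c'%:MP.
Proof.
move=> c0 abc; have a0 : a != 0.
  by apply: contraNneq c0 => a0; move/eqP: abc; rewrite a0 mul0r eq_sym mpolyC_eq0.
have b0 : b != 0.
  by apply: contraNneq c0 => b0; move/eqP: abc; rewrite b0 mulr0 eq_sym mpolyC_eq0.
have : msize (a * b) = 1%N by rewrite abc msizeC c0.
rewrite msizeM // (mpolySpred _ a0) (mpolySpred _ b0) => e.
apply/msize_poly1P; move: e; rewrite addSn addnS /= => -[/eqP].
rewrite addn_eq0 => /andP[/eqP e _]; by rewrite (mpolySpred _ a0) e.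
Qed.

Lemma mderiv_prod (R : comNzRingType) n (I : finType) (a : I -> {mpoly R[n]}) j :
  (\prod_m a m)^`M(j) = \sum_m (a m)^`M(j) * \prod_(l | l != m) a l.
Proof.
elim: (index_enum I) (index_enum_uniq I) => [|y s IH] /=.
  by rewrite !big_nil -mpolyC1 mderivC.
case/andP => ys us; rewrite !big_cons mderivM IH // eqxx /= mulr_sumr; congr (_ + _).
  by congr (_ * _); rewrite [RHS]big_seq_cond [LHS]big_seq; apply: eq_bigl => l; case: eqP => [->|]; rewrite ?andbT ?(negPf ys).
rewrite big_seq [RHS]big_seq; apply: eq_bigr => m ms.
rewrite big_cons ifT; first by ring.
by apply: contraNneq ys => ->.
Qed.

Lemma jac_const_row (k : closedFieldType) n (a : 'I_n -> {mpoly k[n]}) m c :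
  a m = c%:MP -> jac a = 0.
Proof.
move=> am; rewrite /jac (expand_det_row _ m) big1 // => j _.
by rewrite mxE am mderivC mul0r.
Qed.

Section TorusDerivations.
Context {k : closedFieldType} {r : nat}.
Hypothesis char0 : [pchar k] =i pred0.
Local Notation A := {mpoly k[r.+1]}.
Local Notation W := 'rV[int]_r.
Variable G : ('I_r -> k) -> r.+1.-tuple A.
Hypothesis G_jac : forall t, torus_pt t -> jac (tnth (G t)) = 1.
Variables (I : finType) (wt : I -> W) (x : 'I_r.+1 -> I -> A).
Hypothesis wt_inj : injective wt.
Hypothesis semiinv_x : forall l j, semiinv G (wt j) (x l j).
Hypothesis x_sum : forall l, 'X_l = \sum_j x l j.
Hypothesis faithful : forall lam : W, lam != 0 ->
  exists l j, x l j != 0 /\ \sum_i wt j 0 i * lam 0 i != 0.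
Implicit Types (a b : A).
Local Notation semiinv := (semiinv G).

(** The vector field of the i-th factor of the torus, that is, the derivative of the action at
    [t = 1], written directly through the weights of the coordinates. *)
Definition wder_coord (i : 'I_r) (l : 'I_r.+1) : A := \sum_j (wt j 0 i)%:~R *: x l j.
Definition wder (i : 'I_r) a : A := \sum_l a^`M(l) * wder_coord i l.

Lemma wderD i a b : wder i (a + b) = wder i a + wder i b.
Proof. by rewrite -big_split; apply: eq_bigr => l _; rewrite mderivD mulrDl. Qed.

Lemma wderM i a b : wder i (a * b) = wder i a * b + a * wder i b.
Proof.
rewrite mulr_suml mulr_sumr -big_split; apply: eq_bigr => l _ /=.
by rewrite mderivM; ring.
Qed.

(** Carrying the values of the derivations along with the decomposition makes an induction over ring
    operations possible; terms of equal weight need not be collected. *)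
Lemma wder_decomp a : exists L : seq (W * A),
  [/\ forall p, p \in L -> semiinv p.1 p.2, a = \sum_(p <- L) p.2
    & forall i, wder i a = \sum_(p <- L) (p.1 0 i)%:~R *: p.2].
Proof.
elim/mpoly_ring_ind: a => [c|l|a b [L [hL aE La]] [M [hM bE Mb]]|a b [L [hL aE La]] [M [hM bE Mb]]].
- exists [:: (0, c%:MP)]; split=> [p|//|i]; rewrite ?big_seq1 ?inE //.
    by move/eqP => ->; exact: semiinvC.
  by rewrite mxE scale0r /wder big1 // => l _; rewrite mderivC mul0r.
- exists [seq (wt j, x l j) | j <- index_enum I]; split=> [p /mapP[j _ ->]||i]; first exact: semiinv_x.
    by rewrite big_map x_sum.
  rewrite big_map /wder (bigD1 l) //= big1 ?addr0 => [|l' ll']; rewrite mderivX mnm1E.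
    by rewrite eqxx submmm mpolyX0 scale1r mul1r.
  by rewrite eq_sym (negPf ll') scale0r mul0r.
- exists (L ++ M); split=> [p|//|i]; rewrite ?big_cat ?aE ?bE //.
    by rewrite mem_cat => /orP[/hL|/hM].
  by rewrite -aE -bE wderD La Mb.
- exists [seq (p.1 + q.1, p.2 * q.2) | p <- L, q <- M]; split=> [p||i].
  + by case/allpairsP => -[p1 p2] /= [/hL h1 /hM h2 ->]; exact: semiinvM.
  + rewrite big_allpairs_dep aE bE mulr_suml; apply: eq_bigr => p _.
    by rewrite mulr_sumr.
  + rewrite wderM La Mb aE bE mulr_suml [X in _ + X]mulr_suml -big_split big_allpairs_dep.
    apply: eq_bigr => p _ /=; rewrite mulr_sumr [X in _ + X]mulr_sumr -big_split.
    apply: eq_bigr => q _ /=.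
    by rewrite mxE rmorphD scalerDl -scalerAl -scalerAr.
Qed.

Lemma wderE i chi a : semiinv chi a -> wder i a = (chi 0 i)%:~R *: a.
Proof.
have [L [hL aE ->]] := wder_decomp a; move=> ha.
have := semiinv_weighted char0 (G := G) (L := (chi, - a) :: L) (fun psi => (psi 0 i)%:~R).
rewrite !big_cons /= -aE addNr scalerN => h; apply/eqP; rewrite -subr_eq0 addrC.
apply/eqP/h => // p; rewrite inE => /orP[/eqP -> /=|]; last exact: hL.
exact: semiinvN.
Qed.

Definition wframe (u : 'I_r.+1 -> A) : 'M[A]_r.+1 :=
  \matrix_(i, l) fun_cons u (fun i l => if unlift ord0 i is Some i' then wder_coord i' l else 0) i l.

(** The coefficient of dx_l in the contraction of the volume form with the vector fields of the
    torus. *)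
Definition wcof (l : 'I_r.+1) : A := cofactor (wframe (fun=> 0)) ord0 l.

Lemma det_wframe u : \det (wframe u) = \sum_l u l * wcof l.
Proof. exact: det_cons_row. Qed.

Lemma det_wframe_jac u (a : 'I_r.+1 -> A) :
  \det (wframe u) * jac a = \det (\matrix_(i, m)
    if unlift ord0 i is Some i' then wder i' (a m) else \sum_l u l * (a m)^`M(l)).
Proof.
rewrite /jac -(det_tr (\matrix_(i, j) (a i)^`M(j))) -det_mulmx.
congr (\det _); apply/matrixP => i m; rewrite !mxE.
under eq_bigr do rewrite !mxE.
case: (unliftP ord0 i) => [i' ->|->]; rewrite ?fun_cons0 ?fun_consS.
  by rewrite liftK; apply: eq_bigr => l _; rewrite mulrC.
by [].
Qed.

Definition wt_minor (psi : 'I_r.+1 -> W) : int :=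
  \det (\matrix_(m < r, i < r) psi (lift ord0 m) 0 i).

(* Evaluating the volume form on the vector fields of the torus and on
   [d/dx_j] in the coordinates [a]. *)
Lemma jac_wcof0 (a : 'I_r.+1 -> A) (psi : 'I_r.+1 -> W) j :
  (forall m, semiinv (psi m) (a m)) -> psi ord0 = 0 ->
  jac a * wcof j = (a ord0)^`M(j) * ((wt_minor psi)%:~R *: \prod_m a (lift ord0 m)).
Proof.
move=> ha psi0; have -> : wcof j = \det (wframe (fun l => (l == j)%:R)).
  rewrite det_wframe (bigD1 j) //= eqxx mul1r big1 ?addr0 // => l /negPf ->.
  by rewrite mul0r.
rewrite mulrC det_wframe_jac det_col0 => [|i]; last first.
  by rewrite mxE liftK (wderE _ (ha _)) psi0 mxE scale0r.
rewrite mxE unlift_none (bigD1 j) //= eqxx mul1r big1 ?addr0 => [|l /negPf ->]; last first.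
  by rewrite mul0r.
congr (_ * _).
rewrite (_ : \matrix_(i, j0) _ = (map_mx (fun z => (z%:~R : k)%:MP)
   (\matrix_(m < r, i < r) psi (lift ord0 m) 0 i))^T *m diag_mx (\row_m a (lift ord0 m))).
  rewrite det_mulmx det_diag det_tr -mul_mpolyC; congr (_ * _).
    have -> : map_mx (fun z => (z%:~R : k)%:MP) (\matrix_(m < r, i < r) psi (lift ord0 m) 0 i)
     = map_mx (@mpolyC r.+1 k) (map_mx intr (\matrix_(m < r, i < r) psi (lift ord0 m) 0 i)).
      by apply/matrixP => u v; rewrite !mxE.
    by rewrite !det_map_mx.
  by apply: eq_bigr => m _; rewrite mxE.
apply/matrixP => i m; rewrite mul_mx_diag !mxE liftK (wderE _ (ha _)).
by rewrite mul_mpolyC.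
Qed.

(** Modulo the differentials of the other members, the differential of the product is [a_0]'s
    differential times the product of the others. This trades a balanced tuple for one whose first
    member is invariant. *)
Lemma jac_cons_prod (a : 'I_r.+1 -> A) :
  jac (fun_cons (\prod_m a m) a) = (\prod_m a (lift ord0 m)) * jac a.
Proof.
pose B : 'M[A]_r.+1 := \matrix_(i, m) fun_cons (fun m => \prod_(l | l != m) a l) (fun i m => (i == m)%:R) i m.
have dB : \det B = \prod_m a (lift ord0 m).
  rewrite det_col0 => [|i]; last by rewrite mxE fun_consS eq_sym (negPf (neq_lift _ _)).
  rewrite mxE fun_cons0 (_ : \matrix_(i, j) _ = 1%:M) ?det1 ?mulr1.
    by rewrite big_mkcond big_ord_recl eqxx /= mul1r; apply: eq_bigr.
  by apply/matrixP => i j; rewrite !mxE fun_consS (inj_eq lift_inj).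
rewrite -dB /jac -det_mulmx; congr (\det _); apply/matrixP => i j; rewrite !mxE.
rewrite [RHS](eq_bigr (fun m => fun_cons (fun m => \prod_(l | l != m) a l)
  (fun i m => (i == m)%:R) i m * (a m)^`M(j))); last by move=> m _; rewrite /B !mxE.
case: (unliftP ord0 i) => [i' ->|->]; rewrite ?fun_cons0 ?fun_consS.
  rewrite (bigD1 (lift ord0 i')) //= eqxx mul1r big1 ?addr0 // => m mi.
  by rewrite eq_sym (negPf mi) mul0r.
rewrite mderiv_prod; apply: eq_bigr => m _; by rewrite mulrC.
Qed.


Local Notation T := {ffun 'I_r.+1 -> I}.
Let tup (t : T) (m : 'I_r.+1) : A := x m (t m).
Let twt (t : T) (m : 'I_r.+1) : W := wt (t m).
Let balanced (t : T) := \sum_m twt t m == 0.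

Lemma semiinv_tup t m : semiinv (twt t m) (tup t m).
Proof. exact: semiinv_x. Qed.

(** Multilinear expansion of Jac(X_0, ..., X_r) = 1 over weight components: the summands are
    semi-invariant, their total is invariant, hence only those of weight 0 contribute. *)
Lemma sum_jac_balanced : \sum_(t : T | balanced t) jac (tup t) = 1.
Proof.
have sJ : \sum_(t : T) jac (tup t) = 1.
  rewrite -[RHS]jac_id /jac.
  rewrite (_ : \matrix_(i, j) ('X_i)^`M(j) = \matrix_(i, j) \sum_c (x i c)^`M(j) :> 'M[A]__).
    by rewrite (det_sum_rows (fun i c j => (x i c)^`M(j))).
  by apply/matrixP => i j; rewrite !mxE x_sum raddf_sum.
(* The entry -1 makes the total zero, so extraction at weight 0 returns the balanced part minus
   1. *)
pose L := (0, -1 : A) :: [seq (\sum_m twt t m, jac (tup t)) | t <- index_enum T].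
have hL p : p \in L -> semiinv p.1 p.2.
  rewrite inE => /orP[/eqP ->|/mapP[t _ ->]]; first by apply: semiinvN; exact: semiinv1.
  exact: semiinv_jac (semiinv_tup t).
have := semiinv_extract char0 0 hL; rewrite /L !big_cons !big_map /= eqxx sJ addNr.
by move=> /(_ erefl) /eqP; rewrite addrC subr_eq0 => /eqP.
Qed.

Definition invf : A := \sum_(t : T | balanced t) (wt_minor (twt t))%:~R *: \prod_m tup t m.

Lemma semiinv_invf : semiinv 0 invf.
Proof.
apply: semiinv_sum => t /eqP <-; apply: semiinvZ.
by apply: semiinv_prod => m; exact: semiinv_tup.
Qed.

(** Replacing the first member by the product of all members makes it invariant and multiplies both
    sides by the product of the remaining members, which is then cancelled. A zero member makes both
    sides vanish. *)
Lemma jac_wcof_balanced t j : balanced t ->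
  jac (tup t) * wcof j = (wt_minor (twt t))%:~R *: (\prod_m tup t m)^`M(j).
Proof.
move=> /eqP bt; have [[m am]|a0] := pselect (exists m, tup t m = 0).
  rewrite (jac_const_row (m := m) (c := 0)) ?mpolyC0 // mul0r (bigD1 m) //= am mul0r.
  by rewrite mderiv0 scaler0.
have p0 : \prod_m tup t (lift ord0 m) != 0.
  by apply/prodf_neq0 => m _; apply: contra_notN a0 => /eqP; exists (lift ord0 m).
pose w := \prod_m tup t m.
have := @jac_wcof0 (fun_cons w (tup t)) (fun_cons 0 (twt t)) j.
rewrite !fun_cons0 /w jac_cons_prod => /(_ _ erefl) h; apply: (mulfI p0).
rewrite mulrA h => [|m].
  rewrite -!scalerAr mulrC; congr (_%:~R *: _).
    by congr (\det _); apply/matrixP => u v; rewrite !mxE fun_consS.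
  by congr (_ * _); apply: eq_bigr => m _; rewrite fun_consS.
case: (unliftP ord0 m) => [m' ->|->]; rewrite ?fun_cons0 ?fun_consS; first exact: semiinv_tup.
by rewrite -bt; apply: semiinv_prod => l; exact: semiinv_tup.
Qed.

(* The contraction of the volume form with the vector fields of the torus is
   the exact form [d invf]. *)
Lemma mderiv_invf j : invf^`M(j) = wcof j.
Proof.
rewrite raddf_sum -[RHS]mul1r -[X in _ = X * _]sum_jac_balanced mulr_suml; apply: eq_bigr => t bt /=.
by rewrite jac_wcof_balanced // mderivZ.
Qed.

(** In each balanced Jacobian the argument takes the place of the first member, which becomes a
    factor in front. Weights are therefore preserved. *)
Definition eulerT (a : A) : A :=
  \sum_(t : T | balanced t) tup t ord0 * jac (fun_cons a (tup t)).

Lemma jac_cons a (b : 'I_r.+1 -> A) : jac (fun_cons a b) = \sum_l a^`M(l) * jac (fun_cons 'X_l b).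
Proof.
have E c : jac (fun_cons c b) = \sum_l c^`M(l) *
    cofactor (\matrix_(i, j) fun_cons (fun=> 0) (fun i j => (b i)^`M(j)) i j) ord0 l.
  rewrite -(det_cons_row (fun l => c^`M(l))) /jac; congr (\det _).
  apply/matrixP => i j; rewrite !mxE.
  by case: (unliftP ord0 i) => [i' ->|->]; rewrite ?fun_cons0 ?fun_consS.
rewrite E; apply: eq_bigr => l _; congr (_ * _); rewrite E (bigD1 l) //= big1 ?addr0.
  by rewrite mderivX mnm1E eqxx submmm mpolyX0 scale1r mul1r.
by move=> i il; rewrite mderivX mnm1E eq_sym (negPf il) scale0r mul0r.
Qed.

Lemma eulerTE a : eulerT a = \sum_l a^`M(l) * eulerT 'X_l.
Proof.
transitivity (\sum_(t : T | balanced t) \sum_l a^`M(l) * (tup t ord0 * jac (fun_cons 'X_l (tup t)))).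
  apply: eq_bigr => t _; rewrite (jac_cons a (tup t)) mulr_sumr.
  by apply: eq_bigr => l _; rewrite mulrCA.
rewrite exchange_big; apply: eq_bigr => l _.
by rewrite -mulr_sumr.
Qed.

Lemma eulerTM a b : eulerT (a * b) = eulerT a * b + a * eulerT b.
Proof.
rewrite eulerTE [eulerT a]eulerTE [eulerT b]eulerTE mulr_suml mulr_sumr -big_split.
by apply: eq_bigr => l _ /=; rewrite mderivM; ring.
Qed.

Lemma eulerT_linear c a b : eulerT (c *: a + b) = c *: eulerT a + eulerT b.
Proof.
rewrite eulerTE [eulerT a]eulerTE [eulerT b]eulerTE scaler_sumr -big_split.
by apply: eq_bigr => l _ /=; rewrite mderivD mderivZ mulrDl scalerAl.
Qed.

Lemma semiinv_eulerT chi a : semiinv chi a -> semiinv chi (eulerT a).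
Proof.
move=> ha; apply: semiinv_sum => t /eqP bt.
have <- : twt t ord0 + \sum_m fun_cons chi (twt t) m = chi.
  rewrite big_ord_recl fun_cons0; under eq_bigr do rewrite fun_consS.
  by rewrite addrCA; move: bt; rewrite big_ord_recl => ->; rewrite addr0.
apply: semiinvM; first exact: semiinv_tup.
apply: semiinv_jac => // m; case: (unliftP ord0 m) => [m' ->|->]; rewrite ?fun_cons0 ?fun_consS //.
exact: semiinv_tup.
Qed.

(** Each summand of [eulerT a], multiplied by the contracted form, yields the derivative of [a]
    times the weight minor and the product of the full tuple, which is the corresponding summand of
    [invf]. *)
Lemma eulerT_invf a j : semiinv 0 a -> eulerT a * invf^`M(j) = invf * a^`M(j).
Proof.
move=> ha; rewrite mderiv_invf !mulr_suml; apply: eq_bigr => t bt.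
have := @jac_wcof0 (fun_cons a (tup t)) (fun_cons 0 (twt t)) j; rewrite !fun_cons0.
move=> /(_ _ erefl) h; rewrite -mulrA h => [|m].
  rewrite big_ord_recl -!scalerAl -!scalerAr; congr (_%:~R *: _).
    by congr (\det _); apply/matrixP => u v; rewrite !mxE fun_consS.
  under eq_bigr do rewrite fun_consS.
  by ring.
case: (unliftP ord0 m) => [m' ->|->]; rewrite ?fun_cons0 ?fun_consS //.
exact: semiinv_tup.
Qed.

Lemma intr_eq0_char0 (z : int) : (z%:~R == 0 :> k) = (z == 0).
Proof.
case: z => m; first by rewrite -pmulrn natr_eq0.
by rewrite NegzE mulrNz oppr_eq0 -pmulrn natr_eq0 // oppr_eq0.
Qed.

(** Some balanced Jacobian is nonzero because they sum to 1. If its weight minor vanished, an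
    integral combination [lam] of the torus vector fields would kill all members of the tuple, hence
    be the zero field; then [lam] is orthogonal to every weight that occurs, against
    faithfulness. *)
Lemma balanced_nondeg : exists t, [/\ balanced t, jac (tup t) != 0 & wt_minor (twt t) != 0].
Proof.
have [t bt Jt] : exists2 t, balanced t & jac (tup t) != 0.
  apply: contrapT => h; have /eqP := sum_jac_balanced; rewrite big1 ?(eq_sym 0) ?oner_eq0 //.
  move=> t bt; apply/eqP; apply: contraT => Jt; case: h; by exists t.
exists t; split=> //; apply/negP; rewrite /wt_minor -det_tr => /det0P[lam lam0 hlam].
have lamS m : \sum_i lam 0 i * twt t (lift ord0 m) 0 i = 0.
  have := congr1 (fun v : 'rV_r => v 0 m) hlam; rewrite !mxE => h; rewrite -[RHS]h.
  by apply: eq_bigr => i _; rewrite !mxE.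
have lam_tup m : \sum_i lam 0 i * twt t m 0 i = 0.
  case: (unliftP ord0 m) => [m' ->|->]; first exact: lamS.
  move: bt; rewrite /balanced big_ord_recl addr_eq0 => /eqP ->.
  under eq_bigr do rewrite mxE summxE mulrN mulr_sumr.
  rewrite sumrN exchange_big big1 ?oppr0 // => m' _; exact: lamS.
have [l [j [xlj]]] := faithful lam0; case/negP.
pose d a := \sum_i (lam 0 i)%:~R *: wder i a.
have dt m : d (tup t m) = 0.
  rewrite /d; under eq_bigr do rewrite (wderE _ (semiinv_tup t m)) scalerA -intrM.
  by rewrite -scaler_suml -rmorph_sum lam_tup scale0r.
have dX l' : \sum_i (lam 0 i)%:~R *: wder_coord i l' = 0.
  pose v := \row_l0 \sum_i (lam 0 i)%:~R *: wder_coord i l0.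
  have : v = 0.
    apply/eqP; apply: contraNT Jt => v0; rewrite /jac -det_tr; apply/det0P; exists v => //.
    apply/rowP => m; rewrite !mxE -[RHS](dt m) /d /wder.
    under [RHS]eq_bigr do rewrite scaler_sumr.
    rewrite exchange_big; apply: eq_bigr => l0 _; rewrite !mxE mulr_suml; apply: eq_bigr => i _.
    by rewrite -scalerAl mulrC.
  by move/(congr1 (fun v : 'rV_r.+1 => v 0 l')); rewrite !mxE.
pose c (psi : W) : k := (\sum_i psi 0 i * lam 0 i)%:~R.
pose L := [seq (wt i, c (wt i) *: x l i) | i <- index_enum I].
have hL p : p \in L -> semiinv p.1 p.2.
  by move=> /mapP[i _ ->]; apply: semiinvZ; exact: semiinv_x.
have sL : \sum_(p <- L) p.2 = 0.
  rewrite /L big_map -[RHS](dX l) /wder_coord; under [RHS]eq_bigr do rewrite scaler_sumr.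
  rewrite exchange_big; apply: eq_bigr => i _; rewrite /c rmorph_sum scaler_suml /=.
  by apply: eq_bigr => i' _; rewrite scalerA -intrM mulrC.
have := semiinv_extract char0 (wt j) hL sL; rewrite /L big_map /= (bigD1 j) //= big1 ?addr0.
  by move/eqP; rewrite mscalerI (negPf xlj) orbF /c intr_eq0_char0.
by move=> i /andP[/eqP /wt_inj -> /eqP].
Qed.

Lemma tup_neq0 t m : jac (tup t) != 0 -> tup t m != 0.
Proof.
apply: contraNneq => am; apply/eqP.
by rewrite (jac_const_row (m := m) (c := 0)) ?mpolyC0.
Qed.

(** By Cramer's rule [c chi] is an integral combination of the weights of a nondegenerate balanced
    tuple. Multiplying by [- c] gives [- N chi] with [N = c^2] positive, and adding [K] times the
    relation that the weights sum to 0 makes all coefficients nonnegative. The factor [b ^+ N.-1]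
    brings [- N chi] back to [- chi]. *)
Lemma semiinv_opp chi b : b != 0 -> semiinv chi b ->
  exists2 b', b' != 0 & semiinv (- chi) b'.
Proof.
move=> b0 hb; have [t [/eqP bt Jt ct]] := balanced_nondeg.
set c := wt_minor (twt t) in ct.
pose M : 'M[int]_r := \matrix_(m, i) twt t (lift ord0 m) 0 i.
pose y := chi *m \adj M.
have yM : \sum_m y 0 m *: twt t (lift ord0 m) = c *: chi.
  have : y *m M = c *: chi by rewrite -mulmxA mul_adj_mx mul_mx_scalar.
  rewrite mulmx_sum_row => <-; apply: eq_bigr => m _; congr (_ *: _).
  by apply/rowP => i; rewrite !mxE.
pose N := absz (c * c); have NE : N%:Z = c * c by rewrite /N; nia.
have N0 : (0 < N)%N by rewrite /N; nia.
pose K := (\sum_m absz (c * y 0 m)%R)%N.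
pose e (m : 'I_r) := absz (K%:Z - c * y 0 m)%R.
have eE m : (e m)%:Z = K%:Z - c * y 0 m.
  have : (absz (c * y 0 m)%R <= K)%N by rewrite /K (bigD1 m) //= leq_addr.
  by rewrite /e; lia.
exists (b ^+ N.-1 * (tup t ord0 ^+ K * \prod_m tup t (lift ord0 m) ^+ e m)).
  rewrite !mulf_neq0 ?expf_neq0 ?tup_neq0 //.
  by apply/prodf_neq0 => m _; rewrite expf_neq0 // tup_neq0.
have <- : chi *+ N.-1 + (twt t ord0 *+ K + \sum_m twt t (lift ord0 m) *+ e m) = - chi.
  have natE (v : W) j : v *+ j = j%:Z *: v by rewrite -scaler_nat natz.
  have -> : \sum_m twt t (lift ord0 m) *+ e m =
      K%:Z *: (\sum_m twt t (lift ord0 m)) - c *: (c *: chi).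
    rewrite -yM !scaler_sumr -sumrB; apply: eq_bigr => m _.
    by rewrite natE eE scalerBl !scalerA.
  have -> : \sum_m twt t (lift ord0 m) = - twt t ord0.
    by apply/eqP; rewrite -addr_eq0 addrC; move: bt; rewrite big_ord_recl => ->.
  rewrite (natE (twt t ord0)) scalerN addNKr scalerA -NE -natE -[X in _ - chi *+ X](prednK N0) mulrSr.
  by rewrite opprD addNKr.
apply: semiinvM; first exact: semiinvX.
apply: semiinvM; first by apply: semiinvX; exact: semiinv_tup.
by apply: semiinv_prod => m; apply: semiinvX; exact: semiinv_tup.
Qed.

(** If [invf] were constant, the product of a nondegenerate balanced tuple would have zero
    derivatives and be a nonzero constant; its first factor would be constant too, which kills the
    Jacobian. *)
Lemma msize_invf : (1 < msize invf)%N.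
Proof.
rewrite ltnNge; apply/negP => /msize1_polyC fC.
have [t [bt Jt ct]] := balanced_nondeg.
have wC : \prod_m tup t m = ((\prod_m tup t m)@_0%MM)%:MP.
  apply: mpoly_const_mderiv0 => // l; have := jac_wcof_balanced l bt.
  rewrite -mderiv_invf fC mderivC mulr0 => /esym/eqP.
  by rewrite mscalerI intr_eq0_char0 (negPf ct) => /eqP.
have w0 : \prod_m tup t m != 0 by apply/prodf_neq0 => m _; exact: tup_neq0.
move: wC; rewrite (bigD1 ord0) //=; set c := _@_0%MM => wC.
have c0 : c != 0.
  by rewrite -(mpolyC_eq0 r.+1) -wC; move: w0; rewrite (bigD1 ord0).
have [c' _ a0] := mpoly_mul_const c0 wC.
by move: Jt; rewrite (jac_const_row a0) eqxx.
Qed.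

End TorusDerivations.

(** * Rings of invariants and linearization *)

(** Degrees force the cofactor [t] to be constant, so [q] is an eigenvector of the operator
    [gam X d/dX], whose eigenvalues on the powers of [X] are distinct in characteristic 0. *)
Lemma poly_euler_eigen (k : closedFieldType) (char0 : [pchar k] =i pred0)
  (gam : k) (t q : {poly k}) : gam != 0 -> q != 0 ->
  gam *: ('X * q^`()) = t * q -> exists c e, c != 0 /\ q = c *: 'X^e.
Proof.
move=> g0 q0 E; have st : (size t <= 1)%N.
  have [->|t0] := eqVneq t 0; first by rewrite size_poly0.
  have : (size (t * q)%R <= size q)%N.
    rewrite -E size_scale // (leq_trans (size_polyMleq _ _)) // size_polyX /=.
    exact: lt_size_deriv.
  rewrite size_mul //; have : (0 < size q)%N by rewrite size_poly_gt0.
  by move: (size t) (size q); lia.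
have [tau tE] : exists tau, t = tau%:P by exists t`_0; rewrite -size1_polyC.
have C i : gam * i%:R * q`_i = tau * q`_i.
  have := congr1 (fun p : {poly k} => p`_i) E; rewrite tE coefCM coefZ coefXM => <-.
  case: i => [|i]; first by rewrite /= !(mulr0n, mulr0, mul0r).
  by rewrite /= coef_deriv -mulrA mulr_natl.
exists (lead_coef q), (size q).-1; split; first by rewrite lead_coef_eq0.
apply/polyP => i; rewrite coefZ coefXn; case: eqP => [->|/eqP ie].
  by rewrite mulr1 lead_coefE.
have := C (size q).-1; rewrite -lead_coefE => /(mulIf _) h.
have := C i; rewrite -h ?lead_coef_eq0 // mulr0 => /eqP.
rewrite -subr_eq0 -mulrBl -mulrBr !mulf_eq0 (negPf g0) subr_eq0 => /orP[|/eqP //].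
rewrite -subr_eq0; have [h1|h1] := leqP i (size q).-1.
  by rewrite -opprB oppr_eq0 -natrB // natr_eq0 // subn_eq0 leqNgt ltn_neqAle ie h1.
by rewrite -natrB 1?ltnW // natr_eq0 // subn_eq0 leqNgt h1.
Qed.

Section InvariantRing.
Context {k : closedFieldType} {r n : nat}.
Hypothesis char0 : [pchar k] =i pred0.
Local Notation A := {mpoly k[n]}.
Local Notation W := 'rV[int]_r.
Variable G : ('I_r -> k) -> n.-tuple A.
Local Notation semiinv := (semiinv G).
Variables (f : A) (D : A -> A).
Hypothesis f_inv : semiinv 0 f.
Hypothesis f_nonconst : (1 < msize f)%N.
Hypothesis D_linear : forall c a b, D (c *: a + b) = c *: D a + D b.
Hypothesis D_M : forall a b, D (a * b) = D a * b + a * D b.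
Hypothesis D_semiinv : forall chi a, semiinv chi a -> semiinv chi (D a).
Hypothesis D_f : forall a j, semiinv 0 a -> D a * f^`M(j) = f * a^`M(j).
Implicit Types (a b : A).

Let D0 : D 0 = 0.
Proof. by have := D_linear (-1) 0 0; rewrite scaler0 addr0 scaleN1r addNr. Qed.

Let DZ c a : D (c *: a) = c *: D a.
Proof. by rewrite -[c *: a]addr0 D_linear D0 addr0. Qed.

Let DD a b : D (a + b) = D a + D b.
Proof. by rewrite -[a in LHS]scale1r D_linear scale1r. Qed.

Let DB a b : D (a - b) = D a - D b.
Proof. by rewrite DD -scaleN1r DZ scaleN1r. Qed.

Let D1 : D 1 = 0.
Proof.
by apply: (addrI (D 1)); rewrite addr0 -{3}(mulr1 1) D_M mulr1 mul1r.
Qed.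

Let d := (msize f).-1.
Let d_neq0 : d%:R != 0 :> k.
Proof. by rewrite natr_eq0 // /d -lt0n -subn1 subn_gt0. Qed.

(** Here [d] is the degree of [f]; comparing top-degree parts in [D(a) df = f da] shows that a
    nonzero member has degree [i]. *)
Definition eigen (i : nat) a := semiinv 0 a /\ D a = (i%:R / d%:R) *: a.

Lemma eigen0 i : eigen i 0.
Proof. by split; [exact: semiinv0|rewrite D0 scaler0]. Qed.

Lemma eigenZ i c a : eigen i a -> eigen i (c *: a).
Proof.
by case=> sa Da; split; [exact: semiinvZ|rewrite DZ Da !scalerA mulrC].
Qed.

Lemma eigenB i a b : eigen i a -> eigen i b -> eigen i (a - b).
Proof.
by move=> [sa Da] [sb Db]; split; [exact: semiinvB|rewrite DB Da Db scalerBr].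
Qed.

Lemma eigenM i j a b : eigen i a -> eigen j b -> eigen (i + j) (a * b).
Proof.
move=> [sa Da] [sb Db]; split; first by rewrite -[0]addr0; exact: semiinvM.
by rewrite D_M Da Db -scalerAl -scalerAr -scalerDl natrD mulrDl.
Qed.

Lemma eigen1 : eigen 0 1.
Proof. by split; [exact: semiinv1|rewrite D1 mul0r scale0r]. Qed.

Lemma eigenX i a j : eigen i a -> eigen (i * j) (a ^+ j).
Proof.
move=> ha; elim: j => [|j IH]; first by rewrite muln0; exact: eigen1.
by rewrite exprS mulnS; exact: eigenM.
Qed.

Lemma f_mderiv_neq0 : exists j, f^`M(j) != 0.
Proof.
apply/existsP; apply: contraTT f_nonconst; rewrite negb_exists => /forallP h.
have -> : f = (f@_0%MM)%:MP.
  by apply: mpoly_const_mderiv0 => // l; apply/eqP; have := h l; rewrite negbK.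
by rewrite msizeC -leqNgt; case: (_ != 0).
Qed.

Lemma eigen_f : eigen d f.
Proof.
split=> //; have [j fj] := f_mderiv_neq0.
by rewrite divff // scale1r; apply: (mulIf fj); exact: D_f.
Qed.

(** When [a] has degree [e], [D a - (e/d) a] is of smaller degree and decomposes by induction. On
    eigenvectors with smaller eigenvalue the operator [D - e/d] is invertible, and subtracting the
    preimage from [a] leaves an eigenvector of eigenvalue [e/d]. *)
Lemma eigen_decomp e a : semiinv 0 a -> (msize a <= e)%N ->
  exists2 a_ : nat -> A, (forall i, eigen i (a_ i)) & a = \sum_(i < e) a_ i.
Proof.
elim: e a => [|e IH] a sa; first rewrite leqn0 msize_poly_eq0 => /eqP ->.
  by exists (fun=> 0) => [i|]; [exact: eigen0|rewrite big_ord0].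
rewrite leq_eqVlt => /orP[/eqP sae|]; last first.
  rewrite ltnS => /(IH _ sa)[a_ ha ->]; exists (fun i => if (i < e)%N then a_ i else 0).
    by move=> i; case: ifP => _; [exact: ha|exact: eigen0].
  rewrite big_ord_recr /= ltnn addr0; apply: eq_bigr => i _; by rewrite ltn_ord.
have a0 : a != 0 by rewrite -msize_poly_eq0 sae.
pose lam (i : nat) : k := i%:R / d%:R.
have [||b_ hb bE] := IH (D a - lam e *: a).
- by apply: semiinvB; [exact: D_semiinv|exact: semiinvZ].
- rewrite -ltnS -sae /lam (_ : e = (msize a).-1) ?sae //.
  have := euler_lead_lt char0 f_nonconst a0 (z := D a); rewrite -/d sae; apply.
  rewrite /euler !mulr_sumr; apply: eq_bigr => l _.
  by rewrite mulrCA D_f // mulrCA.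
pose a_ i := (lam i - lam e)^-1 *: b_ i.
have ha i : eigen i (a_ i) by exact: eigenZ.
have lame i : (i < e)%N -> lam i - lam e != 0.
  move=> ie; rewrite -mulrBl mulf_neq0 ?invr_neq0 // -opprB oppr_eq0 -natrB 1?ltnW //.
  by rewrite natr_eq0 // subn_eq0 -ltnNge.
exists (fun i => if (i < e)%N then a_ i else
  if i == e then a - \sum_(j < e) a_ j else 0).
  move=> i; case: ifP => // _; case: eqP => [->|_]; last exact: eigen0.
  split; first by apply: semiinvB => //; apply: semiinv_sum => j _; case: (ha j).
  have DS : D (\sum_(j < e) a_ j) = lam e *: (\sum_(j < e) a_ j) + \sum_(j < e) b_ j.
    rewrite scaler_sumr -big_split [RHS](eq_bigr (fun j : 'I_e => D (a_ j))) => [|j _].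
      exact: (big_morph D DD D0).
    case: (ha j) => _ ->; rewrite -/(lam j) -[lam j](subrK (lam e)) scalerDl addrC.
    congr (_ + _); rewrite /a_ scalerA divff ?scale1r //; exact: lame.
  rewrite -/(lam e) scalerBr DB DS -bE.
  by rewrite opprD opprB addrCA [D a + _]addrC subrK addrC.
rewrite big_ord_recr /= ltnn eqxx (eq_bigr (fun j : 'I_e => a_ j)) ?[LHS](addrC _ (- _)) //.
  by rewrite addrC subrK.
by move=> i _; rewrite ltn_ord.
Qed.


Lemma eigen_vanish i a (v : 'I_n -> k) : f.@[v] != 0 -> eigen i a -> a.@[v] = 0 -> a = 0.
Proof.
move=> fv [sa Da]; apply: (linear_ode_vanish (u := fun l => (i%:R / d%:R) *: f^`M(l)) char0 _ fv).
by move=> l; rewrite -D_f // Da -scalerAl -scalerAr.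
Qed.

(** An eigenvector solves [f da = (i/d) a df], so it is determined by its value at a single point
    where [f] does not vanish. *)
Lemma eigen_line i a b : eigen i a -> eigen i b -> b != 0 -> exists c, a = c *: b.
Proof.
move=> ha hb b0.
have [v fv] : exists v, f.@[v] != 0.
  apply: contrapT => h; move: f_nonconst; rewrite (_ : f = 0) ?msize0 //.
  by apply: mpoly_eval0 => v; apply/eqP; apply: contraT => fv; case: h; exists v.
have bv : b.@[v] != 0 by apply: contraNneq b0 => bv; apply/eqP; exact: eigen_vanish hb bv.
exists (a.@[v] / b.@[v]); apply/eqP; rewrite -subr_eq0; apply/eqP.
apply: (eigen_vanish (i := i) fv).
  by apply: eigenB => //; exact: eigenZ.
by rewrite mevalB mevalZ divfK // subrr.
Qed.

(** The elements [a^d] and [b^d f^(i-j)] belong to the same eigenvalue, hence are proportional; root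
    closedness turns the divisibility of [a^d] by [b^d] into that of [a] by [b]. *)
Lemma eigen_div i j a b : a != 0 -> b != 0 -> (j <= i)%N ->
  eigen i a -> eigen j b -> exists2 y, y != 0 & eigen (i - j) y.
Proof.
move=> a0 b0 ji ha hb.
have f0 : f != 0 by rewrite -msize_poly_eq0 -lt0n ltnW.
have d0 : (0 < d)%N by rewrite /d -subn1 subn_gt0.
have hbf : eigen (i * d) (b ^+ d * f ^+ (i - j)).
  rewrite (_ : (i * d = j * d + d * (i - j))%N); last by rewrite [(d * _)%N]mulnC -mulnDl subnKC.
  by apply: eigenM; apply: eigenX => //; exact: eigen_f.
have [c ac] := eigen_line (eigenX d ha) hbf (mulf_neq0 (expf_neq0 _ b0) (expf_neq0 _ f0)).
have [y yE] := root_closed_mpoly d0 b0 (etrans ac (scalerAr c (b ^+ d) (f ^+ (i - j)))).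
exists y; first by apply: contraNneq a0 => y0; rewrite yE y0 mulr0.
have [[sa Da] [sb Db]] := (ha, hb); split.
  by apply: semiinv_cancel b0 sb _; rewrite addr0 -yE.
apply: (mulfI b0); apply: (addrI (D b * y)); rewrite -D_M -yE Da Db yE.
by rewrite -scalerAl -scalerAr -scalerDl natrB // mulrBl addrC subrK.
Qed.

(* Degrees of invariants form a saturated numerical semigroup, hence m N. *)
Lemma invariant_ring : exists g gam, [/\ semiinv 0 g, (1 < msize g)%N, gam != 0,
  D g = gam *: g & forall a, semiinv 0 a -> exists P, a = horner_alg g P].
Proof.
pose Lam i := exists2 a, a != 0 & eigen i a.
have f0 : f != 0 by rewrite -msize_poly_eq0 -lt0n ltnW.
have [m0 [m_gt0 [g g0 hg] mmin]] : exists m, [/\ (0 < m)%N, Lam m & forall i, (0 < i)%N -> Lam i -> (m <= i)%N].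
  have h : exists m, `[< (0 < m)%N /\ Lam m >].
    by exists d; apply/asboolP; split; [rewrite /d -subn1 subn_gt0|exists f => //; exact: eigen_f].
  case: (ex_minnP h) => m /asboolP[m0 mP] mmin; exists m; split=> // i i0 Li.
  by apply: mmin; apply/asboolP.
(* Dividing by a power of [g] would produce an eigenvector whose degree is the remainder modulo
   [m0], contradicting minimality unless the remainder is 0. *)
have Lmod i : Lam i -> exists q, i = (q * m0)%N.
  move=> [a a0 ha]; exists (i %/ m0)%N.
  have hq : eigen (i %/ m0 * m0) (g ^+ (i %/ m0)) by rewrite mulnC; exact: eigenX.
  have [y y0] := eigen_div a0 (expf_neq0 _ g0) (leq_trunc_div i m0) ha hq.
  rewrite {1}(divn_eq i m0) addKn => hy.
  have [i0|] := posnP (i %% m0); first by rewrite {1}(divn_eq i m0) i0 addn0.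
  move=> /mmin; rewrite leqNgt ltn_pmod // => h; case: notF; apply: h; by exists y.
have [sg Dg] := hg.
have gam0 : m0%:R / d%:R != 0 :> k by rewrite mulf_neq0 ?invr_neq0 // natr_eq0 // -lt0n.
exists g, (m0%:R / d%:R); split=> // [|a sa].
  rewrite ltnNge; apply/negP => /msize1_polyC gC; move: Dg.
  rewrite gC -[_%:MP]mulr1 mul_mpolyC DZ D1 scaler0 => /esym/eqP.
  rewrite mscalerI (negPf gam0) -mul_mpolyC mulr1 -gC; exact/negP.
have [a_ ha ->] := eigen_decomp sa (leqnn _).
apply: (big_ind (fun z => exists P, z = horner_alg g P)) => [|x y [P ->] [Q ->]|i _].
- by exists 0; rewrite rmorph0.
- by exists (P + Q); rewrite rmorphD.
have [->|ai0] := eqVneq (a_ i) 0; first by exists 0; rewrite rmorph0.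
have [q iq] : exists q, i = (q * m0)%N :> nat by apply: Lmod; exists (a_ i).
have hq : eigen i (g ^+ q) by rewrite iq mulnC; exact: eigenX.
have [c ->] := eigen_line (ha i) hq (expf_neq0 _ g0).
by exists (c%:P * 'X^q); rewrite rmorphM rmorphXn /= horner_algC horner_algX -scalerAl mul1r.
Qed.

End InvariantRing.

(** * Semi-invariant divisors of powers of the generating invariant *)

Section Monomials.
Context {k : closedFieldType} {r n : nat}.
Hypothesis char0 : [pchar k] =i pred0.
Local Notation A := {mpoly k[n]}.
Local Notation W := 'rV[int]_r.
Variable G : ('I_r -> k) -> n.-tuple A.
Local Notation semiinv := (semiinv G).
Variables (D : A -> A) (g : A) (gam : k).
Hypothesis D_M : forall a b, D (a * b) = D a * b + a * D b.
Hypothesis D_linear : forall c a b, D (c *: a + b) = c *: D a + D b.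
Hypothesis D_semiinv : forall chi a, semiinv chi a -> semiinv chi (D a).
Hypothesis g_inv : semiinv 0 g.
Hypothesis g_nonconst : (1 < msize g)%N.
Hypothesis gam_neq0 : gam != 0.
Hypothesis D_g : D g = gam *: g.
Hypothesis inv_g : forall a, semiinv 0 a -> exists P, a = horner_alg g P.
Hypothesis opp : forall chi b, b != 0 -> semiinv chi b -> exists2 b', b' != 0 & semiinv (- chi) b'.
Hypothesis decomp : forall a, exists2 L : seq (W * A),
  (forall p, p \in L -> semiinv p.1 p.2) & a = \sum_(p <- L) p.2.
Implicit Types (a b u : A).

Let hg := horner_alg g.

Let hg_inj P : hg P = 0 -> P = 0.
Proof. exact: (horner_alg_transc char0 g_nonconst). Qed.

Let g_neq0 : g != 0.
Proof. by rewrite -msize_poly_eq0 -lt0n ltnW. Qed.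

Lemma semiinv_horner P : semiinv 0 (hg P).
Proof.
rewrite /hg; elim/poly_ind: P => [|P c IH]; first by rewrite rmorph0; exact: semiinv0.
rewrite rmorphD rmorphM /= horner_algX horner_algC; apply: semiinvD.
  by rewrite -[0]addr0; exact: semiinvM.
by rewrite alg_mpolyC; exact: semiinvC.
Qed.

Lemma D_horner P : D (hg P) = hg (gam *: ('X * P^`())).
Proof.
have D0 : D 0 = 0 by have := D_linear (-1) 0 0; rewrite scaler0 addr0 scaleN1r addNr.
have D1 : D 1 = 0 by apply: (addrI (D 1)); rewrite addr0 -{3}(mulr1 1) D_M mulr1 mul1r.
rewrite /hg; elim/poly_ind: P => [|P c IH]; first by rewrite deriv0 mulr0 scaler0 !rmorph0.
rewrite derivMXaddC rmorphD rmorphM /= horner_algX horner_algC addrC D_linear D1 scaler0 add0r.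
have e a : gam *: a = horner_alg g gam%:P * a by rewrite horner_algC -scalerAl mul1r.
rewrite D_M IH D_g -!mul_polyC e !rmorphM rmorphD rmorphM /= horner_algX.
by ring.
Qed.

(** Multiplication by an element of weight [- chi] embeds the weight space into [k[g]]; an element
    with image of least degree generates, by Euclidean division. *)
Lemma isotypic_gen chi b0 : b0 != 0 -> semiinv chi b0 ->
  exists b, [/\ b != 0, semiinv chi b & forall a, semiinv chi a -> exists s, a = hg s * b].
Proof.
move=> b00 hb0; have [b' b'0 hb'] := opp b00 hb0.
have pair a : semiinv chi a -> exists q, a * b' = hg q.
  by move=> ha; apply: inv_g; rewrite -(subrr chi); exact: semiinvM.
pose P N := `[< exists b q, [/\ b != 0, semiinv chi b, b * b' = hg q & size q = N] >].
have exP : exists N, P N.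
  by have [q qE] := pair _ hb0; exists (size q); apply/asboolP; exists b0, q.
case: (ex_minnP exP) => N /asboolP[b [q [bn0 hb bq sq]]] Nmin.
exists b; split=> // a ha; have [R RE] := pair a ha.
have q0 : q != 0.
  by apply: contraNneq (mulf_neq0 bn0 b'0) => q0; rewrite bq q0 /hg rmorph0.
exists (R %/ q); apply/eqP; rewrite -subr_eq0; apply: contraT => a10.
have : P (size (R %% q)).
  apply/asboolP; exists (a - hg (R %/ q) * b), (R %% q); split=> //.
    apply: semiinvB => //; rewrite -[chi]add0r; apply: semiinvM => //.
    exact: semiinv_horner.
  by rewrite mulrBl RE -mulrA bq {1}(divp_eq R q) /hg rmorphD rmorphM addrAC subrr add0r.
by move=> /Nmin; rewrite -sq leqNgt ltn_modpN0.
Qed.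

(** In the model case of the diagonal torus, [g] is the product of the coordinates and these are the
    ordinary monomials up to scalars. *)
Definition monom u := [/\ u != 0, exists chi, semiinv chi u
  & exists u' N, u * u' = g ^+ N].

(** Take generators [b], [b2] of two opposite weight spaces. [D] multiplies each by an element of
    [k[g]], so their product [q(g)] satisfies [gam X q' = (s + t) q]; hence [q] is a scalar times a
    power of [X], and [b] divides a power of [g]. *)
Lemma monom_gen chi b0 : b0 != 0 -> semiinv chi b0 ->
  exists b, [/\ monom b, semiinv chi b & forall a, semiinv chi a -> exists s, a = hg s * b].
Proof.
move=> b00 hb0; have [b [bn0 hb bgen]] := isotypic_gen b00 hb0.
have [b1 b10 hb1] := opp bn0 hb.
have [b2 [b20 hb2 b2gen]] := isotypic_gen b10 hb1.
exists b; split=> //; split=> //; first by exists chi.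
have [q qE] : exists q, b * b2 = hg q.
  by apply: inv_g; rewrite -(subrr chi); exact: semiinvM.
have [s sE] := bgen _ (D_semiinv hb); have [t tE] := b2gen _ (D_semiinv hb2).
have q0 : q != 0.
  by apply: contraNneq (mulf_neq0 bn0 b20) => q0; rewrite qE q0 /hg rmorph0.
have E : gam *: ('X * q^`()) = (s + t) * q.
  apply/eqP; rewrite -subr_eq0; apply/eqP/hg_inj.
  have -> x y : hg (x - y) = hg x - hg y by exact: rmorphB.
  have -> : hg ((s + t) * q) = (hg s + hg t) * hg q by rewrite /hg rmorphM rmorphD.
  by rewrite -D_horner -qE D_M sE tE; ring.
have [c [e [c0 qe]]] := poly_euler_eigen char0 gam_neq0 q0 E.
exists (c^-1 *: b2), e.
rewrite -scalerAr qE qe /hg -mul_polyC rmorphM rmorphXn /= horner_algC horner_algX.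
by rewrite -scalerAl mul1r scalerA mulVf // scale1r.
Qed.

Lemma monomM u v : monom u -> monom v -> monom (u * v).
Proof.
move=> [u0 [chi hu] [u' [N uE]]] [v0 [psi hv] [v' [M vE]]]; split.
- exact: mulf_neq0.
- by exists (chi + psi); exact: semiinvM.
- by exists (u' * v'), (N + M)%N; rewrite exprD -uE -vE; ring.
Qed.

Lemma monomZ c u : c != 0 -> monom u -> monom (c *: u).
Proof.
move=> c0 [u0 [chi hu] [u' [N uE]]]; split.
- by rewrite mscalerI negb_or c0.
- by exists chi; exact: semiinvZ.
- by exists (c^-1 *: u'), N; rewrite -scalerAl -scalerAr scalerA divff // scale1r.
Qed.

Lemma monomC c : c != 0 -> monom c%:MP.
Proof.
move=> c0; rewrite -[c%:MP]mulr1 mul_mpolyC; apply: monomZ => //; split.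
- exact: oner_neq0.
- by exists 0; exact: semiinv1.
- by exists 1, 0%N; rewrite mulr1 expr0.
Qed.

Lemma monomXg j : monom (g ^+ j).
Proof.
split; first by rewrite expf_neq0.
  by exists (0 *+ j); exact: semiinvX.
by exists 1, j; rewrite mulr1.
Qed.

Lemma monom_span a : exists2 L : seq A, (forall u, u \in L -> monom u) & a = \sum_(u <- L) u.
Proof.
have [L hL ->] := decomp a.
elim: L hL => [|p L IH] hL; first by exists [::] => //; rewrite !big_nil.
have [|M hM ME] := IH; first by move=> q qL; apply: hL; rewrite inE qL orbT.
rewrite big_cons ME; have [->|p0] := eqVneq p.2 0; first by exists M => //; rewrite add0r.
have [b [mb hb bgen]] := monom_gen p0 (hL _ (mem_head _ _)).
have [s ->] := bgen _ (hL _ (mem_head _ _)).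
(* Zero coefficients are discarded, since a [monom] is nonzero. *)
exists ([seq s`_i *: (g ^+ i * b) | i <- index_iota 0 (size s) & s`_i != 0] ++ M).
  move=> u; rewrite mem_cat => /orP[|/hM //] /mapP[i]; rewrite mem_filter => /andP[si _] ->.
  by apply: monomZ => //; apply: monomM => //; exact: monomXg.
rewrite big_cat big_map big_filter; congr (_ + _).
have -> : hg s = \sum_(i < size s) s`_i *: g ^+ i.
  rewrite -{1}[s]coefK poly_def /hg rmorph_sum; apply: eq_bigr => i _.
  by rewrite -mul_polyC rmorphM rmorphXn /= horner_algC horner_algX -scalerAl mul1r.
rewrite mulr_suml [RHS]big_mkcond big_mkord.
apply: eq_bigr => i _; rewrite scalerAl.
by case: eqP => //= ->; rewrite scale0r mul0r.
Qed.


Lemma msize_monom_mul u v : u != 0 -> v != 0 -> (1 < msize v)%N -> (msize u < msize (u * v))%N.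
Proof.
move=> u0 v0 v1; rewrite msizeM //; have : (0 < msize u)%N by rewrite lt0n msize_poly_eq0.
by move: v1; move: (msize u) (msize v); lia.
Qed.

Lemma msize_gX j b : b != 0 -> msize (g ^+ j * b) = (j * (msize g).-1 + msize b)%N.
Proof.
move=> b0; elim: j => [|j IH]; first by rewrite expr0 mul1r.
rewrite exprS -mulrA msizeM ?IH ?mulf_neq0 ?expf_neq0 //.
rewrite mulSn; move: g_nonconst; case: (msize g) => // m _ /=.
by rewrite addnA.
Qed.

Definition weight_of u : W :=
  if pselect (exists chi, semiinv chi u) is left h then projT1 (cid h) else 0.

Lemma semiinv_weight_of u : monom u -> semiinv (weight_of u) u.
Proof.
case=> _ h _; rewrite /weight_of; case: pselect => // h'.
by case: (cid h').
Qed.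

Definition same_type u v := (weight_of v == weight_of u) && (msize v == msize u).

(** The factor [s] with [u = s(g) b] divides a power of [X], because [u] divides a power of [g] and
    pairing with weight [- chi] lands in [k[g]]. *)
Lemma monom_shape chi b u : semiinv chi b -> (forall a, semiinv chi a -> exists s, a = hg s * b) ->
  b != 0 -> monom u -> semiinv chi u -> exists c j, u = c *: (g ^+ j * b).
Proof.
move=> hb bgen b0 [u0 _ [u' [N uu']]] hu; have [s us] := bgen _ hu.
have hu' : semiinv (- chi) u'.
  apply: semiinv_cancel u0 hu _; rewrite subrr uu' -(mul0rn _ N); exact: semiinvX.
have [z bz] : exists z, b * u' = hg z.
  by apply: inv_g; rewrite -(subrr chi); exact: semiinvM.
have sz : s * z = 'X^N.
  apply/eqP; rewrite -subr_eq0; apply/eqP/hg_inj.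
  by rewrite /hg rmorphB rmorphM rmorphXn /= horner_algX -/hg -bz -uu' us mulrA subrr.
have /dvdp_exp_XsubCP[j _ /eqpP[[c1 c2] /= /andP[c10 c20] E]] : s %| ('X - 0%:P) ^+ N.
  by rewrite subr0 -sz dvdp_mulr.
exists (c1^-1 * c2), j; rewrite us scalerAl; congr (_ * _).
rewrite subr0 in E; have -> : s = (c1^-1 * c2) *: 'X^j.
  by rewrite -scalerA -E scalerA mulVf // scale1r.
by rewrite /hg -mul_polyC rmorphM rmorphXn /= horner_algC horner_algX -scalerAl mul1r.
Qed.

(** Monoms of one weight have the form [c g^j b] for a common [b], and the degree reveals [j]
    because [g] is not constant. Within a weight, a vanishing sum is thus a polynomial in [g], and
    its coefficients are the sums over one degree. In this way degree acts as a grading on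
    monoms. *)
Lemma monom_extract (L : seq A) u0 : (forall u, u \in L -> monom u) ->
  \sum_(u <- L) u = 0 -> monom u0 -> \sum_(u <- L | same_type u0 u) u = 0.
Proof.
move=> hL sL m0; set chi := weight_of u0.
have h0 : semiinv chi u0 by exact: semiinv_weight_of.
have [u00 _ _] := m0.
have [b [mb hb bgen]] := monom_gen u00 h0; have [b0 _ _] := mb.
have sM : \sum_(u <- L | weight_of u == chi) u = 0.
  have := semiinv_extract char0 (G := G) (L := [seq (weight_of u, u) | u <- L]) chi.
  rewrite !big_map => h; apply: h => // p /mapP[u /hL mu ->]; exact: semiinv_weight_of.
have shape u : exists p : k * nat, monom u -> semiinv chi u -> u = p.1 *: (g ^+ p.2 * b).
  have [mu|] := pselect (monom u); last by exists (0, 0%N).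
  have [hu|] := pselect (semiinv chi u); last by exists (0, 0%N).
  by have [c [j E]] := monom_shape hb bgen b0 mu hu; exists (c, j).
have [F hF] := choice shape.
have FE u : monom u -> weight_of u = chi -> u = (F u).1 *: (g ^+ (F u).2 * b).
  by move=> mu wu; apply: hF => //; rewrite -wu; exact: semiinv_weight_of.
have FS u : monom u -> weight_of u = chi -> msize u = ((F u).2 * (msize g).-1 + msize b)%N.
  move=> mu wu; rewrite {1}(FE u mu wu) msizeZ ?msize_gX //.
  by case: mu (FE u mu wu) => + _ _ E; rewrite {1}E mscalerI negb_or => /andP[].
pose P := \sum_(u <- L | weight_of u == chi) (F u).1 *: 'X^((F u).2) : {poly k}.
have P0 : P = 0.
  apply: hg_inj; apply: (mulIf b0); rewrite mul0r -[RHS]sM /hg rmorph_sum mulr_suml.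
  rewrite big_seq_cond [RHS]big_seq_cond; apply: eq_bigr => u /andP[uL /eqP wu].
  rewrite [RHS](FE u (hL _ uL) wu) scalerAl; congr (_ * _).
  by rewrite -mul_polyC rmorphM rmorphXn /= horner_algC horner_algX -scalerAl mul1r.
have := congr1 (fun P : {poly k} => P`_((F u0).2)) P0; rewrite coef0 coef_sum => C.
rewrite (_ : \sum_(u <- L | _) _ = (\sum_(u <- L | weight_of u == chi)
   ((F u).1 *: 'X^((F u).2))`_((F u0).2)) *: (g ^+ (F u0).2 * b)); first by rewrite C scale0r.
rewrite scaler_suml /same_type -/chi big_mkcondr big_seq_cond [RHS]big_seq_cond.
apply: eq_bigr => u /andP[uL /eqP wu]; have mu := hL _ uL.
rewrite coefZ coefXn FS // (FS u0) // eqn_add2r eqn_mul2r [_ == (F u).2]eq_sym.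
have -> : ((msize g).-1 == 0)%N = false by move: g_nonconst; case: (msize g) => [|[]].
by case: eqP => [e|_]; rewrite ?mulr0 ?scale0r //= mulr1 {1}(FE u mu wu) e.
Qed.

(** The ideal of the future origin: the span of the non-constant monoms. [inI_const] shows that it
    is proper, [exists_const_part] that the constants are a complement; [inI2] is its square. *)
Definition inI a := exists2 L : seq A,
  (forall u, u \in L -> monom u /\ (1 < msize u)%N) & a = \sum_(u <- L) u.

Definition inI2 a := exists2 L : seq (A * A),
  (forall p, p \in L -> [/\ monom p.1, (1 < msize p.1)%N, monom p.2 & (1 < msize p.2)%N])
  & a = \sum_(p <- L) p.1 * p.2.

Lemma inI0 : inI 0.
Proof. by exists [::]; rewrite ?big_nil. Qed.

Lemma inID a b : inI a -> inI b -> inI (a + b).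
Proof.
move=> [L hL ->] [M hM ->]; exists (L ++ M); last by rewrite big_cat.
by move=> u; rewrite mem_cat => /orP[/hL|/hM].
Qed.

Lemma inIM a b : inI a -> inI (a * b).
Proof.
move=> [L hL ->]; have [M hM ->] := monom_span b.
exists [seq u * v | u <- L, v <- M]; last first.
  rewrite big_allpairs_dep mulr_suml; apply: eq_bigr => u _.
  by rewrite mulr_sumr.
move=> _ /allpairsP[[u v] /= [/hL[mu u1] /hM mv ->]]; split; first exact: monomM.
have [[u0 _ _] [v0 _ _]] := (mu, mv).
by rewrite mulrC; apply: leq_trans (msize_monom_mul v0 u0 u1); rewrite ltnS lt0n msize_poly_eq0.
Qed.

Lemma inI20 : inI2 0.
Proof. by exists [::]; rewrite ?big_nil. Qed.

Lemma inI2D a b : inI2 a -> inI2 b -> inI2 (a + b).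
Proof.
move=> [L hL ->] [M hM ->]; exists (L ++ M); last by rewrite big_cat.
by move=> u; rewrite mem_cat => /orP[/hL|/hM].
Qed.

Lemma inI2I a b : inI a -> inI b -> inI2 (a * b).
Proof.
move=> [L hL ->] [M hM ->]; exists [seq (u, v) | u <- L, v <- M]; last first.
  by rewrite big_allpairs mulr_suml; apply: eq_bigr => u _; rewrite mulr_sumr.
by move=> _ /allpairsP[[u v] /= [/hL[mu u1] /hM[mv v1] ->]].
Qed.

Lemma inI2M a b : inI2 a -> inI2 (a * b).
Proof.
move=> [L hL ->]; rewrite mulr_suml big_seq; apply: (big_ind inI2) => [||p /hL[h1 h2 h3 h4]].
- exact: inI20.
- exact: inI2D.
rewrite -mulrA; apply: inI2I; last apply: inIM.
  by exists [:: p.1]; rewrite ?big_seq1 // => u; rewrite inE => /eqP ->.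
by exists [:: p.2]; rewrite ?big_seq1 // => u; rewrite inE => /eqP ->.
Qed.

(** A nonzero constant differs in degree from every non-constant monom, so extracting its type from
    a vanishing sum isolates it. *)
Lemma inI_const c : inI c%:MP -> c = 0.
Proof.
move=> [L hL LE]; apply/eqP; apply: contraT => c0.
have nc0 : - c != 0 by rewrite oppr_eq0.
have := monom_extract (L := (- c)%:MP :: L) (u0 := (- c)%:MP).
rewrite !big_cons -LE mpolyCN addNr /same_type !eqxx /= big1_seq ?addr0.
  move=> /(_ _ erefl) h; suff /eqP : - c%:MP_[n] = 0 by rewrite oppr_eq0 mpolyC_eq0 (negPf c0).
  apply: h; last by rewrite -mpolyCN; exact: monomC.
  by move=> u; rewrite inE => /orP[/eqP ->|/hL[]//]; rewrite -mpolyCN; exact: monomC.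
move=> u /andP[/andP[_ /eqP su]] /hL[_]; rewrite su -mpolyCN msizeC.
by case: (_ != 0).
Qed.

Lemma exists_const_part a : exists c, inI (a - c%:MP).
Proof.
have [L hL ->] := monom_span a; elim: L hL => [|u L IH] hL.
  by exists 0; rewrite big_nil mpolyC0 subr0; exact: inI0.
have [|c hc] := IH; first by move=> v vL; apply: hL; rewrite inE vL orbT.
rewrite big_cons; have [/msize1_polyC uE|u1] := leqP (msize u) 1.
  by exists (u@_0%MM + c); rewrite {1}uE mpolyCD opprD addrACA subrr add0r.
exists c; rewrite -addrA; apply: inID => //; exists [:: u]; rewrite ?big_seq1 //.
by move=> v; rewrite inE => /eqP ->; split=> //; apply: hL; exact: mem_head.
Qed.

Section OriginPoint.
Variable q : 'I_n -> k.
Hypothesis q_inI : forall l, inI ('X_l - (q l)%:MP).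

Lemma inI_eval a : inI (a - (a.@[q])%:MP).
Proof.
elim/mpoly_ring_ind: a => [c|i|a b ha hb|a b ha hb].
- by rewrite mevalC subrr; exact: inI0.
- by rewrite mevalXU.
- by rewrite mevalD mpolyCD opprD addrACA; exact: inID.
rewrite mevalM mpolyCM.
have -> : a * b - (a.@[q])%:MP * (b.@[q])%:MP =
  (a - (a.@[q])%:MP) * b + (b - (b.@[q])%:MP) * (a.@[q])%:MP by ring.
by apply: inID; exact: inIM.
Qed.

Lemma monom_eval0 u : monom u -> (1 < msize u)%N -> u.@[q] = 0.
Proof.
move=> mu u1; apply: inI_const.
have -> : (u.@[q])%:MP = (u - (u.@[q])%:MP) * (-1)%:MP + u * 1 by rewrite mpolyCN mpolyC1; ring.
apply: inID; first exact: inIM (inI_eval u).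
rewrite mulr1; exists [:: u]; rewrite ?big_seq1 // => v.
by rewrite inE => /eqP ->.
Qed.

Let lin a := \sum_l (a^`M(l)).@[q] *: ('X_l - (q l)%:MP).

Let lin_inI a : inI (lin a).
Proof.
apply: (big_ind inI) => [||l _]; [exact: inI0|exact: inID|].
by rewrite -mul_mpolyC mulrC; exact: inIM.
Qed.

Lemma taylor1 a : inI2 (a - (a.@[q])%:MP - lin a).
Proof.
elim/mpoly_ring_ind: a => [c|i|a b ha hb|a b ha hb].
- rewrite mevalC subrr sub0r /lin big1 ?oppr0; first exact: inI20.
  by move=> l _; rewrite mderivC meval0 scale0r.
- rewrite mevalXU /lin (bigD1 i) //= big1 => [|l li]; rewrite mderivX mnm1E.
    by rewrite eqxx submmm mpolyX0 scale1r meval1 scale1r addr0 subrr; exact: inI20.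
  by rewrite eq_sym (negPf li) scale0r meval0 scale0r.
- have -> : lin (a + b) = lin a + lin b.
    by rewrite -big_split; apply: eq_bigr => l _; rewrite mderivD mevalD scalerDl.
  rewrite mevalD mpolyCD !opprD; have -> (x1 x2 y1 y2 z1 z2 : A) :
    x1 + x2 + (y1 + y2) + (z1 + z2) = (x1 + y1 + z1) + (x2 + y2 + z2) by ring.
  exact: inI2D.
have -> : lin (a * b) = (a.@[q])%:MP * lin b + (b.@[q])%:MP * lin a.
  rewrite !mulr_sumr -big_split; apply: eq_bigr => l _ /=.
  by rewrite mderivM mevalD !mevalM !mul_mpolyC !scalerA -scalerDl addrC [(b.@[q]) * _]mulrC.
rewrite mevalM mpolyCM; set a0 := (a.@[q])%:MP; set b0 := (b.@[q])%:MP.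
have -> : a * b - a0 * b0 - (a0 * lin b + b0 * lin a) =
  lin a * lin b + ((a - a0 - lin a) * b + (b - b0 - lin b) * (a0 + lin a)) by ring.
by apply: inI2D; [exact: inI2I|apply: inI2D; exact: inI2M].
Qed.

Definition generated (u : n.-tuple A) a := exists p, a = p \mPo u.

(* Graded Nakayama: homogeneous lifts of a basis of the cotangent space at [q]
   generate the algebra. *)
Lemma monom_nakayama (u : n.-tuple A) : (forall m, monom (tnth u m)) ->
  (jac (tnth u)).@[q] != 0 -> forall a, generated u a.
Proof.
move=> mu Jq.
have genD a b : generated u a -> generated u b -> generated u (a + b).
  by move=> [x ->] [y ->]; exists (x + y); rewrite comp_mpolyD.
have genM a b : generated u a -> generated u b -> generated u (a * b).
  by move=> [x ->] [y ->]; exists (x * y); rewrite rmorphM.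
have genC c : generated u c%:MP by exists c%:MP; rewrite comp_mpolyC.
have genU m : generated u (tnth u m).
  by exists 'X_m; rewrite comp_mpolyXU -tnth_nth.
have u_nc m : (1 < msize (tnth u m))%N.
  rewrite ltnNge; apply/negP => /msize1_polyC um; move: Jq.
  by rewrite (jac_const_row um) meval0 eqxx.
pose M : 'M[k]_n := \matrix_(i, j) ((tnth u i)^`M(j)).@[q].
have uM : M \in unitmx.
  rewrite unitmxE unitfE; move: Jq; rewrite /jac.
  rewrite -[_.@[q]]/((meval q : {rmorphism _ -> _}) _) -det_map_mx.
  by congr (\det _ != 0); apply/matrixP => i j; rewrite !mxE.
suff gen_monom v : monom v -> generated u v.
  move=> a; have [L hL ->] := monom_span a; rewrite big_seq.
  apply: (big_ind (generated u)) => // [|v /hL]; last exact: gen_monom.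
  by rewrite -mpolyC0; exact: genC.
move: {2}(msize v).+1 (ltnSn (msize v)) => N.
elim: N v => // N IH v vN mv.
have [/msize1_polyC ->|v1] := leqP (msize v) 1; first exact: genC.
pose c : 'rV[k]_n := (\row_l (v^`M(l)).@[q]) *m invmx M.
have lin_v : lin v = \sum_m c 0 m *: lin (tnth u m).
  rewrite /lin; under [RHS]eq_bigr do rewrite scaler_sumr.
  rewrite exchange_big; apply: eq_bigr => l _; rewrite /=.
  under eq_bigr do rewrite scalerA.
  rewrite -scaler_suml; congr (_ *: _).
  have : c *m M = \row_l (v^`M(l)).@[q] by rewrite mulmxKV.
  move/(congr1 (fun x : 'rV_n => x 0 l)); rewrite !mxE => <-.
  by apply: eq_bigr => m _; rewrite !mxE.
have [R hR RE] : inI2 (v - \sum_m c 0 m *: tnth u m).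
  have hv : v - \sum_m c 0 m *: tnth u m = (v - (v.@[q])%:MP - lin v) +
     \sum_m ((tnth u m - ((tnth u m).@[q])%:MP - lin (tnth u m)) * (- c 0 m)%:MP).
    rewrite monom_eval0 // mpolyC0 subr0 lin_v -addrA -sumrN -sumrN -big_split; congr (_ + _).
    apply: eq_bigr => m _ /=; rewrite monom_eval0 // mpolyC0 subr0 mulrC mul_mpolyC.
    by rewrite scaleNr scalerBr opprB addKr.
  rewrite hv; apply: inI2D; first exact: taylor1.
  apply: (big_ind inI2) => [||m _]; [exact: inI20|exact: inI2D|].
  exact/inI2M/taylor1.
(* Every term of the relation between [v], the [tnth u m] and the products from [R] is a monom.
   Restricted to the type of [v], it keeps only products of the same degree as [v]; their factors
   are non-constant, hence of smaller degree, and induction applies. *)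
pose L := v :: [seq - c 0 m *: tnth u m | m <- enum 'I_n & c 0 m != 0]
  ++ [seq -1 *: (p.1 * p.2) | p <- R].
have hL w : w \in L -> monom w.
  rewrite inE mem_cat => /or3P[/eqP -> //|/mapP[m]|/mapP[p /hR[m1 _ m2 _] ->]].
    by rewrite mem_filter => /andP[cm _] ->; apply: monomZ; rewrite ?oppr_eq0.
  by apply: monomZ; [rewrite oppr_eq0 oner_eq0|exact: monomM].
have sL : \sum_(w <- L) w = 0.
  have e1 : \sum_(w <- [seq - c 0 m *: tnth u m | m <- enum 'I_n & c 0 m != 0]) w =
      - \sum_m c 0 m *: tnth u m.
    rewrite big_map big_filter big_enum_cond big_mkcond -sumrN; apply: eq_bigr => m _ /=.
    by rewrite -scaleNr; case: eqP => [->|] //=; rewrite oppr0 scale0r.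
  have e2 : \sum_(w <- [seq -1 *: (p.1 * p.2) | p <- R]) w = \sum_m c 0 m *: tnth u m - v.
    by rewrite big_map -opprB RE -sumrN; apply: eq_bigr => p _; rewrite scaleN1r.
  by rewrite big_cons big_cat e1 e2 /= addKr subrr.
have := monom_extract hL sL mv; rewrite big_cons /same_type !eqxx /= => /eqP.
rewrite addr_eq0 => /eqP ->; rewrite -scaleN1r -mul_mpolyC; apply: (genM); first exact: genC.
rewrite big_seq_cond; apply: (big_ind (generated u)) => [||w] //; first by rewrite -mpolyC0; exact: genC.
rewrite mem_cat => /andP[/orP[/mapP[m _ ->] _|/mapP[p /hR[m1 s1 m2 s2] ->]]].
  by rewrite -mul_mpolyC; apply: (genM); [exact: genC|exact: genU].
case/andP=> _ /eqP sp; rewrite -mul_mpolyC; apply: (genM); first exact: genC.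
have [[p10 _ _] [p20 _ _]] := (m1, m2).
move: sp; rewrite msizeZ ?oppr_eq0 ?oner_eq0 // => sp.
have l1 := msize_monom_mul p10 p20 s2; have l2 := msize_monom_mul p20 p10 s1.
rewrite mulrC sp in l2; rewrite sp in l1.
apply: (genM); apply: IH => //; [exact: leq_trans l1 vN|exact: leq_trans l2 vN].
Qed.
End OriginPoint.

(** Expanding Jac(X) = 1 over the monoms occurring in the coordinates and evaluating at [q] yields a
    tuple of monoms whose Jacobian does not vanish at [q]. *)
Lemma monom_generators : exists u : n.-tuple A,
  [/\ forall m, exists chi, semiinv chi (tnth u m), jac (tnth u) != 0 & forall a, generated u a].
Proof.
have [q hq] := choice (fun l : 'I_n => exists_const_part 'X_l).
have [F hF] : exists F : 'I_n -> seq A, forall l,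
    (forall u, u \in F l -> monom u) /\ 'X_l = \sum_(u <- F l) u.
  have /choice[F hF] : forall l : 'I_n, exists L : seq A,
      (forall u, u \in L -> monom u) /\ 'X_l = \sum_(u <- L) u.
    by move=> l; have [L h1 h2] := monom_span 'X_l; exists L.
  by exists F.
(* A common bound of the lengths, so that a choice of one monom per coordinate is a function into a
   fixed finite type; missing places count as 0. *)
pose M := \max_l size (F l).
have XE l : 'X_l = \sum_(c < M) nth 0 (F l) c.
  rewrite (proj2 (hF l)) (big_nth 0) big_mkord.
  have lM : (size (F l) <= M)%N by exact: leq_bigmax.
  rewrite (big_ord_widen M (fun c => nth 0 (F l) c) lM) big_mkcond.
  by apply: eq_bigr => c _; case: ltnP => // h; rewrite nth_default.
have J1 : \sum_(t : {ffun 'I_n -> 'I_M}) jac (fun l => nth 0 (F l) (t l)) = 1.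
  rewrite -[RHS](@jac_id k n) /jac.
  rewrite -(det_sum_rows (fun i (c : 'I_M) j => (nth 0 (F i) c)^`M(j))).
  by congr (\det _); apply/matrixP => i j; rewrite !mxE XE raddf_sum.
have [t Jt] : exists t : {ffun 'I_n -> 'I_M}, (jac (fun l => nth 0 (F l) (t l))).@[q] != 0.
  apply: contrapT => h; have /eqP := congr1 (meval q) J1; rewrite meval1 rmorph_sum big1 /=.
    by rewrite eq_sym oner_eq0.
  by move=> t _; apply/eqP; apply: contraT => Jt; case: h; exists t.
pose u := [tuple nth 0 (F l) (t l) | l < n].
have uE : jac (tnth u) = jac (fun l => nth 0 (F l) (t l)).
  by congr (\det _); apply/matrixP => i j; rewrite !mxE tnth_mktuple.
have mu m : monom (tnth u m).
  rewrite tnth_mktuple; have [h|h] := ltnP (t m) (size (F m)).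
    exact: (proj1 (hF m)) (mem_nth _ h).
  move: Jt; rewrite (jac_const_row (m := m) (c := 0)) ?meval0 ?eqxx //.
  by rewrite nth_default // mpolyC0.
rewrite -uE in Jt; exists u; split=> [m||]; first by have [_ h _] := mu m.
  by apply: contraNneq Jt => ->; rewrite meval0.
exact: (monom_nakayama hq mu Jt).
Qed.

End Monomials.

(** * Groups of polynomial automorphisms *)

Section PolyAutBasics.
Context {k : closedFieldType} {n : nat}.
Local Notation A := {mpoly k[n]}.
Local Notation pcomp := Defs.pcomp.
Implicit Types (g h : polyAut k n).

Definition aut_tuple g : n.-tuple A := (polyAut_pair g).1.

Lemma tnth_aut_tuple g i : tnth (aut_tuple g) i = polyAut_coord g i.
Proof. by []. Qed.

Lemma polyAut_coordM g h i : polyAut_coord (g * h)%g i = polyAut_coord g i \mPo aut_tuple h.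
Proof. by rewrite /polyAut_coord /= tnth_mktuple. Qed.

Lemma polyAut_coord1 i : polyAut_coord (1%g : polyAut k n) i = 'X_i.
Proof. by rewrite /polyAut_coord /= tnth_mktuple. Qed.

Lemma comp_aut1 (a : A) : a \mPo aut_tuple 1%g = a.
Proof. exact: comp_mpoly_id. Qed.

Lemma comp_autM (a : A) g h : a \mPo aut_tuple (g * h)%g = (a \mPo aut_tuple g) \mPo aut_tuple h.
Proof. by rewrite comp_mpolyA. Qed.

Lemma comp_autKV (a : A) g : (a \mPo aut_tuple g^-1%g) \mPo aut_tuple g = a.
Proof. by rewrite -comp_autM mulVg comp_aut1. Qed.

Lemma comp_X_aut g i : 'X_i \mPo aut_tuple g = polyAut_coord g i.
Proof. by rewrite comp_mpolyXU -tnth_nth. Qed.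

Lemma JacE g : Jac g = jac (tnth (aut_tuple g)).
Proof. by []. Qed.

Lemma JacM g h : Jac (g * h)%g = (Jac g \mPo aut_tuple h) * Jac h.
Proof.
rewrite !JacE -jac_comp; congr (\det _); apply/matrixP => i j.
by rewrite !mxE tnth_aut_tuple polyAut_coordM.
Qed.

Lemma Jac1 : Jac (1%g : polyAut k n) = 1.
Proof.
rewrite -[RHS](@jac_id k n); congr (\det _); apply/matrixP => i j.
by rewrite !mxE polyAut_coord1.
Qed.

Lemma Jac_const g : exists2 c, c != 0 & Jac g = c%:MP.
Proof.
have := JacM g^-1%g g; rewrite mulVg Jac1 => /esym; rewrite mulrC -mpolyC1.
by apply: mpoly_mul_const; exact: oner_neq0.
Qed.

Lemma AutSM g h : AutS k n g -> AutS k n h -> AutS k n (g * h)%g.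
Proof. by rewrite /AutS /= JacM => -> ->; rewrite comp_mpoly1 mulr1. Qed.

Lemma AutS1 : AutS k n 1%g.
Proof. exact: Jac1. Qed.

Lemma AutSV g : AutS k n g -> AutS k n g^-1%g.
Proof.
rewrite /AutS /= => Jg; have [c _ cE] := Jac_const g^-1%g.
have := JacM g^-1%g g; rewrite mulVg Jac1 Jg mulr1 cE comp_mpolyC => <-.
by [].
Qed.

Lemma AutSJ g h : AutS k n g -> AutS k n h -> AutS k n (g * h / g)%g.
Proof. by move=> Sg Sh; exact: (AutSM (AutSM Sg Sh) (AutSV Sg)). Qed.

Lemma AutSJV g h : AutS k n g -> AutS k n h -> AutS k n (g^-1 * h * g)%g.
Proof. by move=> Sg Sh; exact: (AutSM (AutSM (AutSV Sg) Sh) Sg). Qed.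

(** * Linear and monomial automorphisms *)

Definition lin_tuple (M : 'M[k]_n) : n.-tuple A := [tuple \sum_j M i j *: 'X_j | i < n].

Lemma comp_lin (M : 'M[k]_n) (g : n.-tuple A) i :
  tnth (lin_tuple M) i \mPo g = \sum_j M i j *: tnth g j.
Proof.
rewrite tnth_mktuple raddf_sum; apply: eq_bigr => j _ /=.
by rewrite comp_mpolyZ comp_mpolyXU -tnth_nth.
Qed.

Lemma pcomp_lin (M N : 'M[k]_n) : pcomp (lin_tuple M) (lin_tuple N) = lin_tuple (M *m N).
Proof.
apply: eq_from_tnth => i; rewrite tnth_mktuple comp_lin tnth_mktuple.
under eq_bigr do rewrite tnth_mktuple scaler_sumr.
rewrite exchange_big; apply: eq_bigr => j _; rewrite mxE scaler_suml.
by apply: eq_bigr => l _; rewrite scalerA.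
Qed.

Lemma lin_tuple1 : lin_tuple 1%:M = pid k n.
Proof.
apply: eq_from_tnth => i; rewrite !tnth_mktuple (bigD1 i) //= mxE eqxx scale1r.
by rewrite big1 ?addr0 // => j; rewrite mxE eq_sym => /negPf ->; rewrite scale0r.
Qed.

Fact lin_proof (M : 'M[k]_n) (uM : M \in unitmx) :
  let p := (lin_tuple M, lin_tuple (invmx M)) in
  (pcomp p.1 p.2 == pid k n) && (pcomp p.2 p.1 == pid k n).
Proof. by rewrite /= !pcomp_lin mulmxV // mulVmx // lin_tuple1 eqxx. Qed.

Definition lin_aut (M : 'M[k]_n) (uM : M \in unitmx) : polyAut k n := PolyAut (lin_proof uM).

Lemma lin_autE (M : 'M[k]_n) (uM : M \in unitmx) i :
  polyAut_coord (lin_aut uM) i = \sum_j M i j *: 'X_j.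
Proof. by rewrite /polyAut_coord /= tnth_mktuple. Qed.

Lemma jac_lin (M : 'M[k]_n) (a : 'I_n -> A) : (forall i, a i = \sum_j M i j *: 'X_j) ->
  jac a = (\det M)%:MP.
Proof.
move=> aE; rewrite -det_map_mx; congr (\det _); apply/matrixP => i j; rewrite !mxE aE.
rewrite raddf_sum (bigD1 j) //= big1 => [|l lj]; rewrite mderivZ mderivX mnm1E.
  by rewrite eqxx submmm mpolyX0 scale1r addr0 -mul_mpolyC mulr1.
by rewrite (negPf lj) scale0r scaler0.
Qed.

Lemma lin_coord_inj (M N : 'M[k]_n) :
  (forall i, \sum_j M i j *: 'X_j = \sum_j N i j *: 'X_j :> A) -> M = N.
Proof.
move=> MN; apply/matrixP => i j.
have E (P : 'M[k]_n) : (\sum_l P i l *: 'X_l : A)@_U_(j) = P i j.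
  rewrite raddf_sum (bigD1 j) //= big1 => [|l lj]; rewrite mcoeffZ mcoeffXU.
    by rewrite eqxx mulr1 addr0.
  by rewrite (negPf lj) mulr0.
by rewrite -E MN E.
Qed.

Lemma GLnP g : GLn k n g <-> exists (M : 'M[k]_n) (uM : M \in unitmx), g = lin_aut uM.
Proof.
split=> [[M gM]|[M [uM ->]]]; last by exists M => i; rewrite lin_autE.
have uM : M \in unitmx.
  rewrite unitmxE unitfE; have [c c0] := Jac_const g.
  rewrite JacE (@jac_lin M) ?tnth_aut_tuple // => /eqP.
  by rewrite -subr_eq0 -mpolyCB mpolyC_eq0 subr_eq0 => /eqP ->.
by exists M, uM; apply: polyAut_inj => i; rewrite gM lin_autE.
Qed.

Definition monomial_aut g := exists (s : 'S_n) (c : 'I_n -> k),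
  forall i, c i != 0 /\ polyAut_coord g i = c i *: 'X_(s i).

Lemma monomial_autM g h : monomial_aut g -> monomial_aut h -> monomial_aut (g * h)%g.
Proof.
move=> [s [c gE]] [s' [c' hE]]; exists (s * s')%g, (fun i => c i * c' (s i)) => i.
have [ci _] := gE i; have [ci' hi] := hE (s i); split.
  by rewrite mulf_neq0.
rewrite polyAut_coordM (proj2 (gE i)) comp_mpolyZ comp_X_aut hi scalerA permM.
by [].
Qed.

Lemma monomial_autV g : monomial_aut g -> monomial_aut g^-1%g.
Proof.
move=> [s [c gE]]; exists s^-1%g, (fun i => (c (s^-1%g i))^-1) => i.
have [ci gi] := gE (s^-1%g i); split; first by rewrite invr_neq0.
have := polyAut_coordM g g^-1%g (s^-1%g i).
rewrite mulgV polyAut_coord1 gi comp_mpolyZ comp_X_aut permKV => ->.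
by rewrite scalerA mulVf // scale1r.
Qed.

Lemma diagT_monomial g : diagT k n g -> monomial_aut g.
Proof. by move=> [t gt]; exists 1%g, t => i; rewrite perm1. Qed.

Lemma monomial_GLn g : monomial_aut g -> GLn k n g.
Proof.
move=> [s [c gE]]; exists (\matrix_(i, j) (c i *+ (s i == j))) => i.
rewrite (proj2 (gE i)) (bigD1 (s i)) //= mxE eqxx big1 ?addr0 // => j.
by rewrite mxE eq_sym => /negPf ->; rewrite scale0r.
Qed.

Lemma diag_unitmx (t : 'I_n -> k) : (forall i, t i != 0) -> diag_mx (\row_i t i) \in unitmx.
Proof.
move=> t0; rewrite unitmxE unitfE det_diag; apply/prodf_neq0 => i _.
by rewrite mxE.
Qed.

Definition diag_aut (t : 'I_n -> k) (t0 : forall i, t i != 0) := lin_aut (diag_unitmx t0).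

Lemma diag_autE t t0 i : polyAut_coord (@diag_aut t t0) i = t i *: 'X_i.
Proof.
rewrite lin_autE (bigD1 i) //= !mxE eqxx mulr1n big1 ?addr0 // => j ji.
by rewrite !mxE eq_sym (negPf ji) mulr0n scale0r.
Qed.

Lemma monomial_conj_diag g d : monomial_aut g -> diagT k n d -> diagT k n (g * d / g)%g.
Proof.
move=> [s [c gE]] [t dE].
have t0 i : t (s i) != 0 by have [] := dE (s i).
have -> : (g * d = diag_aut t0 * g)%g.
  apply: polyAut_inj => i; rewrite !polyAut_coordM diag_autE comp_mpolyZ comp_X_aut.
  rewrite (proj2 (gE i)) comp_mpolyZ comp_X_aut (proj2 (dE (s i))).
  by rewrite !scalerA mulrC.
by rewrite mulgK; exists (fun i => t (s i)) => i; rewrite diag_autE.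
Qed.

Lemma conj_set_subset g (S : set (polyAut k n)) :
  (forall x, S x -> S (g * x / g)%g) -> (forall x, S x -> S (g^-1 * x * g)%g) ->
  conj_set g S = S.
Proof.
move=> h1 h2; apply/seteqP; split=> [_ [x Sx <-]|x Sx]; first exact: h1.
exists (g^-1 * x * g)%g; first exact: h2.
by rewrite -!mulgA mulVKg mulgA mulgK.
Qed.

Lemma monomial_normalizes_diag g : monomial_aut g -> conj_set g (diagT k n) = diagT k n.
Proof.
move=> mg; apply: conj_set_subset => x; first exact: monomial_conj_diag.
by rewrite -{2}[g]invgK; apply: monomial_conj_diag; exact: monomial_autV.
Qed.

Lemma monomial_normalizes_diagS g : monomial_aut g -> AutS k n g ->
  conj_set g (diagTS k n) = diagTS k n.
Proof.
move=> mg Jg; apply: conj_set_subset => x [dx Jx]; split.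
- exact: monomial_conj_diag.
- exact: AutSJ.
- by rewrite -{2}[g]invgK; apply: monomial_conj_diag => //; exact: monomial_autV.
- exact: AutSJV.
Qed.

End PolyAutBasics.

(** * Semi-invariant coordinates of Jacobian 1 *)

Section Linearization.
Context {k : closedFieldType} {r : nat}.
Hypothesis char0 : [pchar k] =i pred0.
Local Notation A := {mpoly k[r.+1]}.
Local Notation W := 'rV[int]_r.

(** Generation gives a one-sided inverse [v]. In the other order, [u] composed with [v] minus the
    identity is a polynomial relation between the members of [u], and the Jacobian excludes nonzero
    relations. *)
Lemma generated_aut (u : r.+1.-tuple A) : jac (tnth u) != 0 ->
  (forall a, generated u a) -> exists y : polyAut k r.+1, aut_tuple y = u.
Proof.
move=> Ju gen; have [p pE] := choice (fun l : 'I_r.+1 => gen 'X_l).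
pose v : r.+1.-tuple A := [tuple p l | l < r.+1].
have vu : Defs.pcomp v u = pid k r.+1.
  by apply: eq_from_tnth => l; rewrite !tnth_mktuple -pE.
have uv : Defs.pcomp u v = pid k r.+1.
  apply: eq_from_tnth => l; rewrite !tnth_mktuple; apply/eqP; rewrite -subr_eq0; apply/eqP.
  apply: (jac_indep char0 Ju).
  by rewrite raddfB /= comp_mpolyA vu comp_mpoly_id comp_mpolyXU -tnth_nth subrr.
have P : (Defs.pcomp (u, v).1 (u, v).2 == pid k r.+1) && (Defs.pcomp (u, v).2 (u, v).1 == pid k r.+1).
  by rewrite /= uv vu eqxx.
by exists (PolyAut P).
Qed.

Variable G : ('I_r -> k) -> r.+1.-tuple A.
Hypothesis G_jac : forall t, torus_pt t -> jac (tnth (G t)) = 1.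
Variables (I : finType) (wt : I -> W) (x : 'I_r.+1 -> I -> A).
Hypothesis wt_inj : injective wt.
Hypothesis semiinv_x : forall l j, semiinv G (wt j) (x l j).
Hypothesis x_sum : forall l, 'X_l = \sum_j x l j.
Hypothesis faithful : forall lam : W, lam != 0 ->
  exists l j, x l j != 0 /\ \sum_i wt j 0 i * lam 0 i != 0.

Lemma torus_linearization : exists2 y : polyAut k r.+1, AutS k r.+1 y &
  forall m, exists chi, semiinv G chi (polyAut_coord y m).
Proof.
have D_semi chi a : semiinv G chi a -> semiinv G chi (eulerT wt x a) :=
  @semiinv_eulerT _ _ _ G_jac _ _ _ semiinv_x chi a.
have D_f := eulerT_invf char0 G_jac semiinv_x x_sum.
have [g [gam [sg g1 gam0 Dg inv_g]]] :=
  invariant_ring char0 (semiinv_invf semiinv_x)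
    (msize_invf char0 G_jac wt_inj semiinv_x x_sum faithful)
    (eulerT_linear wt x) (eulerTM wt x) D_semi D_f.
have [u [su Ju gen]] := monom_generators char0 (eulerTM wt x) (eulerT_linear wt x) D_semi sg g1
  gam0 Dg inv_g (semiinv_opp char0 G_jac wt_inj semiinv_x x_sum faithful)
  (fun a => let: ex_intro L (And3 h1 h2 _) := wder_decomp semiinv_x x_sum a in ex_intro2 _ _ L h1 h2).
have [y yu] := generated_aut Ju gen.
have [c c0 Jy] := Jac_const y.
(* Rescaling one coordinate by the inverse of the constant Jacobian leaves its weight unchanged. *)
pose t (i : 'I_r.+1) : k := if i == ord0 then c^-1 else 1.
have t0 i : t i != 0 by rewrite /t; case: (i == ord0); rewrite ?invr_neq0 ?oner_eq0.
exists (diag_aut t0 * y)%g => [|m].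
  rewrite /AutS /= JacM Jy JacE (@jac_lin _ _ (diag_mx (\row_i t i))).
    rewrite comp_mpolyC -mpolyCM det_diag (bigD1 ord0) //= mxE /t eqxx big1 ?mulr1.
      by rewrite mulVf // mpolyC1.
    by move=> i /negPf i0; rewrite mxE i0.
  by move=> i; rewrite tnth_aut_tuple lin_autE.
have [chi h] := su m; exists chi.
rewrite polyAut_coordM diag_autE comp_mpolyZ comp_X_aut; apply: semiinvZ.
by rewrite -tnth_aut_tuple yu.
Qed.

End Linearization.

(** * Automorphisms normalizing a diagonal torus *)

Section NormalizerOfDiag.
Context {k : closedFieldType} {n : nat}.
Hypothesis char0 : [pchar k] =i pred0.
Local Notation A := {mpoly k[n]}.

Lemma comp_diag_coef (a : A) (d : polyAut k n) (t : 'I_n -> k) m :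
  (forall i, polyAut_coord d i = t i *: 'X_i) ->
  (a \mPo aut_tuple d)@_m = a@_m * \prod_i t i ^+ m i.
Proof.
move=> dE; have -> : a \mPo aut_tuple d =
    \sum_(m' <- msupp a) (a@_m' * \prod_i t i ^+ m' i) *: 'X_[m'].
  rewrite {1}[a]mpolyE raddf_sum; apply: eq_bigr => m' _.
  rewrite /= comp_mpolyZ comp_mpolyX -scalerA; congr (_ *: _).
  rewrite [in RHS]mpolyXE_id -scaler_prod; apply: eq_bigr => i _.
  by rewrite tnth_aut_tuple dE exprZn.
rewrite raddf_sum /=; have [ma|ma] := boolP (m \in msupp a).
  rewrite (bigD1_seq m) ?msupp_uniq //= [X in _ + X]big1 => [|m' m'm]; rewrite mcoeffZ mcoeffX.
    by rewrite eqxx mulr1 addr0.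
  by rewrite (negPf m'm) mulr0.
rewrite (memN_msupp_eq0 ma) mul0r big1_seq // => m' /= m'a; rewrite mcoeffZ mcoeffX.
by case: eqP ma => [<-|_]; rewrite ?m'a ?mulr0.
Qed.

(** Otherwise a row of the Jacobian matrix would vanish at the origin, while its determinant is a
    nonzero constant. *)
Lemma aut_coord_linear (h : polyAut k n) i : exists j, (polyAut_coord h i)@_U_(j) != 0.
Proof.
apply: contrapT => hi.
have [c c0] := Jac_const h; move/(congr1 (fun p : A => p@_0%MM)).
rewrite mcoeffC eqxx mulr1 /Jac.
rewrite -[_@_0%MM]/((mcoeff 0%MM : {rmorphism A -> k}) _) -det_map_mx (expand_det_row _ i) big1.
  by move/eqP; rewrite eq_sym (negPf c0).
move=> j _; rewrite !mxE /= mcoeff_deriv add0m mnm0E.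
have [->|hj] := eqVneq ((polyAut_coord h i)@_U_(j)) 0; first by rewrite mul0rn mul0r.
by case: hi; exists j.
Qed.

Lemma aut_coord_nonconst (h : polyAut k n) i c : polyAut_coord h i <> c%:MP.
Proof.
move=> hi; have [c' c'0] := Jac_const h; rewrite JacE (jac_const_row (m := i) hi) => /esym/eqP.
by rewrite mpolyC_eq0 (negPf c'0).
Qed.

(* Comparing [d] = (2 at a, 1/2 at b) on the monomials of a coordinate of [h]
   shows that their exponents differ by multiples of (1, ..., 1). *)
Lemma normalizer_exponents (h : polyAut k n) :
  (forall d, diagTS k n d -> diagT k n (h * d / h)%g) ->
  forall i m1 m2, m1 \in msupp (polyAut_coord h i) -> m2 \in msupp (polyAut_coord h i) ->
  forall a b, (m1 a + m2 b = m1 b + m2 a)%N.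
Proof.
move=> hn i m1 m2 s1 s2 a b; have [->|ab] := eqVneq a b; first by [].
pose t (j : 'I_n) : k := if j == a then 2%:R else if j == b then 2%:R^-1 else 1.
have t0 j : t j != 0.
  by rewrite /t; case: (j == a); [|case: (j == b)]; rewrite ?invr_neq0 ?oner_eq0 ?nat2_neq0.
have [|t' t'E] := hn (diag_aut t0).
  split; first by exists t => j; rewrite diag_autE.
  rewrite /AutS /= JacE (@jac_lin _ _ (diag_mx (\row_i t i))); last first.
    by move=> j; rewrite tnth_aut_tuple lin_autE.
  rewrite det_diag (bigD1 a) //= (bigD1 b) 1?eq_sym //= !mxE /t !eqxx eq_sym (negPf ab).
  rewrite big1 ?mulr1 ?divff ?nat2_neq0 ?mpolyC1 // => j /andP[/negPf ja /negPf jb].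
  by rewrite mxE ja jb.
have E m : m \in msupp (polyAut_coord h i) -> \prod_j t j ^+ m j = t' i.
  rewrite mcoeff_msupp => hm; apply: (mulfI hm).
  rewrite -(comp_diag_coef _ _ (d := diag_aut t0)); last by move=> j; rewrite diag_autE.
  rewrite -polyAut_coordM -[(h * _)%g](mulgVK h) polyAut_coordM (proj2 (t'E i)).
  by rewrite comp_mpolyZ comp_X_aut mcoeffZ mulrC.
have F (m : 'X_{1..n}) : \prod_j t j ^+ m j = 2%:R ^ ((m a)%:Z - (m b)%:Z).
  rewrite (bigD1 a) //= (bigD1 b) 1?eq_sym //= /t !eqxx eq_sym (negPf ab).
  rewrite big1 ?mulr1 => [|j /andP[/negPf -> /negPf ->]]; last by rewrite expr1n.
  by rewrite exprVn expfzDr ?nat2_neq0 // -exprnP -exprnN.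
have : (2%:R : k) ^ (((m1 a)%:Z - (m1 b)%:Z) - ((m2 a)%:Z - (m2 b)%:Z)) = 1.
  rewrite expfzDr ?nat2_neq0 // -invr_expz -!F !E // divff //.
  by rewrite -(E _ s1); apply/prodf_neq0 => j _; rewrite expf_neq0.
by move/(expz2_eq1 char0); lia.
Qed.

(** Some [X_j] occurs in the coordinate [h_i], and all other exponents differ from it by multiples
    of (1, ..., 1); as [n > 1], they are all divisible by [X_j]. Composing [h_i = X_j q] with the
    inverse of [h] factors [X_i] through the non-constant j-th coordinate of the inverse, so [q] is
    constant. For [n = 1] translations are counterexamples, [D_1^*] being trivial. *)
Lemma normalizer_monomial (h : polyAut k n) : (1 < n)%N ->
  (forall d, diagTS k n d -> diagT k n (h * d / h)%g) -> monomial_aut h.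
Proof.
move=> n1 hn.
have factor i : exists j q, polyAut_coord h i = 'X_j * q.
  have [j hj] := aut_coord_linear h i; rewrite -mcoeff_msupp in hj.
  have mj m : m \in msupp (polyAut_coord h i) -> (U_(j) <= m)%MM.
    move=> hm; rewrite lep1mP -lt0n.
    have [b bj] : exists b : 'I_n, b != j.
      case: (eqVneq j (Ordinal (ltnW n1))) => [->|h0]; last by exists (Ordinal (ltnW n1)); rewrite eq_sym.
      by exists (Ordinal n1).
    have := normalizer_exponents hn hj hm j b.
    by rewrite !mnm1E eqxx eq_sym (negPf bj); lia.
  exists j, (\sum_(m <- msupp (polyAut_coord h i)) (polyAut_coord h i)@_m *: 'X_[m - U_(j)]).
  rewrite {1}[polyAut_coord h i]mpolyE mulr_sumr big_seq [RHS]big_seq.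
  by apply: eq_bigr => m hm; rewrite -scalerAr -mpolyXD addmC submK // mj.
have shape i : exists p : 'I_n * k, p.2 != 0 /\ polyAut_coord h i = p.2 *: 'X_p.1.
  have [j [q hE]] := factor i.
  have e : 'X_i = polyAut_coord h^-1%g j * (q \mPo aut_tuple h^-1%g).
    by rewrite -comp_X_aut -rmorphM /= -hE -polyAut_coordM mulgV polyAut_coord1.
  have h'0 : polyAut_coord h^-1%g j != 0.
    by have := @aut_coord_nonconst h^-1%g j 0; rewrite mpolyC0 => /eqP.
  have q0 : q \mPo aut_tuple h^-1%g != 0.
    apply: contraTneq (oner_neq0 k) => q0; have := congr1 (mcoeff U_(i)) e.
    by rewrite q0 mulr0 mcoeff0 mcoeffXU eqxx => /eqP e10; rewrite negbK; exact: e10.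
  have : msize ('X_i : A) = 2 by rewrite msizeX mdeg1.
  rewrite e msizeM // => sz.
  have s1 : (1 < msize (polyAut_coord h^-1%g j))%N.
    by rewrite ltnNge; apply/negP => /msize1_polyC /aut_coord_nonconst.
  have /msize1_polyC qC : (msize (q \mPo aut_tuple h^-1%g) <= 1)%N.
    by move: sz s1; move: (msize _) (msize _) => u v; lia.
  exists (j, (q \mPo aut_tuple h^-1%g)@_0%MM) => /=; split.
    by apply: contraNneq q0 => c0; rewrite qC c0 mpolyC0.
  by rewrite hE -[q in LHS](comp_autKV _ h) qC comp_mpolyC mulrC mul_mpolyC mcoeffC eqxx mulr1.
have [F hF] := choice shape.
have [M hM] : GLn k n h.
  exists (\matrix_(i, j) ((F i).2 *+ ((F i).1 == j))) => i.
  rewrite (proj2 (hF i)) (bigD1 (F i).1) //= mxE eqxx big1 ?addr0 // => j.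
  by rewrite mxE eq_sym => /negPf ->; rewrite scale0r.
have F_inj : injective (fun i => (F i).1).
  move=> i i' Fi; apply/eqP; apply: contraT => ii'.
  have [Fi0 hi] := hF i; have [Fi'0 hi'] := hF i'.
  have e : (F i').2 *: polyAut_coord h i = (F i).2 *: polyAut_coord h i'.
    by rewrite hi hi' Fi !scalerA mulrC.
  have := congr1 (comp_mpoly (aut_tuple h^-1%g)) e.
  rewrite !comp_mpolyZ -!polyAut_coordM mulgV !polyAut_coord1.
  move/(congr1 (mcoeff U_(i))); rewrite !mcoeffZ !mcoeffXU eqxx eq_sym (negPf ii') mulr1 mulr0.
  by move/eqP; rewrite (negPf Fi'0).
exists (perm F_inj), (fun i => (F i).2) => i; rewrite permE; exact: hF.
Qed.

Lemma GLn_normalizer_monomial (h : polyAut k n) : (0 < n)%N -> GLn k n h ->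
  (forall d, diagTS k n d -> diagT k n (h * d / h)%g) -> monomial_aut h.
Proof.
move=> n0 [M hM] hn; have [n1|n1] := ltnP 1 n; first exact: normalizer_monomial.
exists 1%g, (fun i => M i i) => i; have hi : polyAut_coord h i = M i i *: 'X_i.
  rewrite hM (bigD1 i) //= big1 ?addr0 // => j; case/eqP; apply: ord_inj.
  by have := ltn_ord i; have := ltn_ord j; move: n1; clear; lia.
split; last by rewrite perm1.
have [j] := aut_coord_linear h i; rewrite hi mcoeffZ; apply: contraNneq => ->.
by rewrite mul0r.
Qed.

Definition monoS : set (polyAut k n) := [set g | monomial_aut g /\ AutS k n g].

Lemma normalizer_SLn : (0 < n)%N -> normalizer (SLn k n) (diagTS k n) = monoS.
Proof.
move=> n0; apply/seteqP; split=> g; last first.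
  move=> [mg Jg]; split; first by split=> //; exact: monomial_GLn.
  exact: monomial_normalizes_diagS.
move=> [[Gg Jg] gD]; split=> //; apply: GLn_normalizer_monomial => // d dD.
suff : diagTS k n (g * d / g)%g by case.
by rewrite -gD; exists d.
Qed.

Lemma normalizer_GLn : (0 < n)%N -> normalizer (GLn k n) (diagT k n) `&` SLn k n = monoS.
Proof.
move=> n0; apply/seteqP; split=> g; last first.
  move=> [mg Jg]; have Gg := monomial_GLn mg; split=> //; split=> //.
  exact: monomial_normalizes_diag.
move=> [[Gg gD] [_ Jg]]; split=> //; apply: GLn_normalizer_monomial => // d [dD _].
by rewrite -gD; exists d.
Qed.

End NormalizerOfDiag.

(** * Regular functions and products of varieties *)

Section SubbaseNbhs.

Lemma nbhs_set_type (X : topologicalType) (A : set X) (x : set_type A) (U : set (set_type A)) :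
  nbhs x U -> exists2 C, open_nbhs (val x) C & forall y : set_type A, C (val y) -> U y.
Proof. by move=> [_ [[C oC <-] Cx CU]]; exists C => // y; exact: CU. Qed.

Lemma near_val (X : topologicalType) (A : set X) (x : set_type A) (P : X -> Prop) :
  (\forall y \near val x, P y) -> \forall y \near x, P (val y).
Proof.
move=> h; have := @initial_continuous _ _ (set_val : set_type A -> X) x.
by move=> /(_ _ h).
Qed.

Lemma near_open_val (X : topologicalType) (U : set X) (x : set_type U) (P : X -> Prop) :
  open U -> (\forall y \near x, P (val y)) -> \forall y \near val x, P y.
Proof.
move=> oU /nbhs_set_type[C [oC Cx] CP].
have Ux : U (val x) by exact: set_mem (valP x).
have : nbhs (val x) (C `&` U) by apply: open_nbhs_nbhs; split=> //; exact: openI.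
by apply: filterS => y [Cy Uy]; exact: (CP (exist _ y (mem_set Uy))).
Qed.

(** By multiplication, the sets where one polynomial does not vanish are stable under finite
    intersections, so this subbase is a base. *)
Lemma nbhs_affineP (k : fieldType) m (x : affine k m) (U : set (affine k m)) :
  nbhs x U <-> exists2 p : {mpoly k[m]}, p.@[x] != 0 & forall y : affine k m, p.@[y] != 0 -> U y.
Proof.
split=> [|[p px pU]]; last first.
  have : nbhs x (nonvanishing p) by apply: open_nbhs_nbhs; split=> //; exact: open_nonvanishing.
  exact: filterS.
rewrite nbhsE => -[B [[D' sD BE] Bx] BU].
move: Bx; rewrite -BE => -[i D'i ix].
have [E ED Ei] := sD _ D'i.
have [s sP si] : exists2 s : seq (set (affine k m)), forall j, j \in s -> range (@nonvanishing k m) j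
    & forall y, (forall j, j \in s -> j y) <-> (i : set (affine k m)) y.
  exists (finmap.enum_fset E); first by move=> j jE; exact: set_mem (ED j jE).
  by move=> y; rewrite -Ei; split.
have [p px pE] : exists2 p : {mpoly k[m]}, p.@[x] != 0 &
    forall y : affine k m, p.@[y] != 0 -> forall j, j \in s -> j y.
  have : forall j, j \in s -> range (@nonvanishing k m) j /\ j x.
    by move=> j js; split; [exact: sP|exact: ((si x).2 ix)].
  elim: (s) => [|j s' IH] h.
    by exists 1; rewrite ?meval1 ?oner_eq0.
  have [|p px ps] := IH; first by move=> i' i's; apply: h; rewrite inE i's orbT.
  have [[q _ qj] jx] := h j (mem_head _ _).
  exists (q * p) => [|y]; first by rewrite mevalM mulf_neq0 //; move: jx; rewrite -qj.
  rewrite mevalM mulf_eq0 negb_or => /andP[qy py] i'.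
  by rewrite inE => /orP[/eqP ->|/(ps y py) //]; rewrite -qj.
exists p => // y py; apply: BU; rewrite -BE; exists i => //; apply/si; exact: pE.
Qed.

Lemma nbhs_vprod (k : fieldType) (X Y : funSpaceType k) (z : vprod X Y) (U : set (vprod X Y)) :
  nbhs z U -> exists2 s : seq (set (vprod X Y)),
    (forall W, W \in s -> vprod_subbase W /\ W z)
    & forall w, (forall W, W \in s -> W w) -> U w.
Proof.
rewrite nbhsE => -[B [[D' sD BE] Bz] BU].
move: Bz; rewrite -BE => -[i D'i iz].
have [E ED Ei] := sD _ D'i.
have si y : (forall j, j \in finmap.enum_fset E -> j y) <-> (i : set (vprod X Y)) y.
  by rewrite -Ei; split.
exists (finmap.enum_fset E).
  by move=> j jE; split; [exact: set_mem (ED j jE)|exact: ((si z).2 iz)].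
by move=> w h; apply: BU; rewrite -BE; exists i => //; apply/si.
Qed.

End SubbaseNbhs.

Section NiceSpaces.
Variable k : fieldType.
Implicit Types (X Y : funSpaceType k).

(* Stalks of regular functions are local rings: they contain the constants and
   a germ not vanishing at the point is nonvanishing nearby and invertible. *)
Definition nice X := forall x : X,
  [/\ forall c, regular_at x (fun=> c : k),
      forall f g : X -> k, regular_at x f -> regular_at x g -> regular_at x (fun y => f y + g y),
      forall f g : X -> k, regular_at x f -> regular_at x g -> regular_at x (fun y => f y * g y)
    & forall f : X -> k, regular_at x f -> f x != 0 ->
       (\forall y \near x, f y != 0) /\ regular_at x (fun y => (f y)^-1)].

Lemma regular_cst X x c : nice X -> regular_at x (fun _ : X => c).
Proof. by move=> nX; have [h _ _ _] := nX x. Qed.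

Lemma regularD X x (f g : X -> k) : nice X -> regular_at x f -> regular_at x g ->
  regular_at x (fun y => f y + g y).
Proof. by move=> nX; have [_ h _ _] := nX x; exact: h. Qed.

Lemma regularM X x (f g : X -> k) : nice X -> regular_at x f -> regular_at x g ->
  regular_at x (fun y => f y * g y).
Proof. by move=> nX; have [_ _ h _] := nX x; exact: h. Qed.

Lemma near_regular_neq0 X x (f : X -> k) : nice X -> regular_at x f -> f x != 0 ->
  \forall y \near x, f y != 0.
Proof. by move=> nX fx f0; have [_ _ _ h] := nX x; have [] := h f fx f0. Qed.

Lemma regularV X x (f : X -> k) : nice X -> regular_at x f -> f x != 0 ->
  regular_at x (fun y => (f y)^-1).
Proof. by move=> nX fx f0; have [_ _ _ h] := nX x; have [] := h f fx f0. Qed.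

Lemma regular_near X (x : X) (f g : X -> k) : (\forall y \near x, f y = g y) ->
  regular_at x f -> regular_at x g.
Proof. exact: regular_at_germ. Qed.

Lemma regular_poly X x m (p : {mpoly k[m]}) (fs : 'I_m -> X -> k) : nice X ->
  (forall j, regular_at x (fs j)) -> regular_at x (fun y => p.@[fun j => fs j y]).
Proof.
move=> nX hfs; elim/mpoly_ring_ind: p => [c|i|p q IHp IHq|p q IHp IHq].
- by apply: regular_near (regular_cst x c nX); near=> y; rewrite mevalC.
- by apply: regular_near (hfs i); near=> y; rewrite mevalXU.
- by apply: regular_near (regularD nX IHp IHq); near=> y; rewrite mevalD.
- by apply: regular_near (regularM nX IHp IHq); near=> y; rewrite mevalM.
Unshelve. all: by end_near. Qed.

Lemma near_nonvanishing m (q : {mpoly k[m]}) (x : affine k m) : q.@[x] != 0 ->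
  \forall y \near x, q.@[y : affine k m] != 0.
Proof. by move=> qx; apply/nbhs_affineP; exists q. Qed.

Lemma nice_affine m : nice (affine k m).
Proof.
move=> x; split=> [c|f g|f g|f].
- exists c%:MP, 1; rewrite meval1 oner_eq0; split=> //.
  by near=> y; rewrite mevalC meval1 divr1.
- move=> [p [q [qx fE]]] [p' [q' [q'x gE]]]; exists (p * q' + p' * q), (q * q').
  rewrite mevalM mulf_neq0 //; split=> //; near=> y.
  have qy : q.@[y] != 0 by near: y; exact: near_nonvanishing.
  have q'y : q'.@[y] != 0 by near: y; exact: near_nonvanishing.
  rewrite (near fE y) // (near gE y) // mevalD !mevalM.
  by field; rewrite qy q'y.
- move=> [p [q [qx fE]]] [p' [q' [q'x gE]]]; exists (p * p'), (q * q').
  rewrite mevalM mulf_neq0 //; split=> //; near=> y.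
  rewrite (near fE y) // (near gE y) // !mevalM invfM; ring.
- move=> [p [q [qx fE]]] fx0.
  have px : p.@[x] != 0.
    by apply: contraNneq fx0 => px; rewrite (nbhs_singleton fE) px mul0r.
  split.
    near=> y; have qy : q.@[y] != 0 by near: y; exact: near_nonvanishing.
    have py : p.@[y] != 0 by near: y; exact: near_nonvanishing.
    by rewrite (near fE y) // mulf_neq0 // invr_neq0.
  exists q, p; split=> //; near=> y; by rewrite (near fE y) // invf_div.
Unshelve. all: by end_near. Qed.

Lemma regular_sub X (A : set X) (x : set_type A) (g : X -> k) :
  regular_at (val x) g -> regular_at x (fun y : set_type A => g (val y)).
Proof. by move=> hg; exists g => //; near=> y. Unshelve. all: by end_near. Qed.

Lemma nice_sub X (A : set X) : nice X -> nice (set_type A).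
Proof.
move=> nX x; split=> [c|f g|f g|f].
- by apply: (@regular_sub _ _ _ (fun=> c)); exact: regular_cst.
- move=> [f' hf' fE] [g' hg' gE]; exists (fun y => f' y + g' y); first exact: regularD.
  by near=> y; rewrite (near fE y) // (near gE y).
- move=> [f' hf' fE] [g' hg' gE]; exists (fun y => f' y * g' y); first exact: regularM.
  by near=> y; rewrite (near fE y) // (near gE y).
- move=> [f' hf' fE] fx0; have f'x : f' (val x) != 0 by rewrite -(nbhs_singleton fE).
  have f'n := near_val (near_regular_neq0 nX hf' f'x).
  split; first by near=> y; rewrite (near fE y) // (near f'n y).
  exists (fun y => (f' y)^-1); first exact: regularV.
  by near=> y; rewrite (near fE y).
Unshelve. all: by end_near. Qed.

Lemma morphism_comp X Y (Z : funSpaceType k) (h : X -> Y) (h' : Y -> Z) :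
  is_morphism h -> is_morphism h' -> is_morphism (h' \o h).
Proof.
move=> [ch rh] [ch' rh']; split; first by move=> x; exact: (continuous_comp (ch x) (ch' (h x))).
by move=> x f hf; exact: rh _ _ (rh' _ _ hf).
Qed.

Lemma nice_iso X Y (h : X -> Y) : is_isomorphism h -> nice Y -> nice X.
Proof.
move=> [[ch rh] [h' [ch' rh'] [hK h'K]]] nY x.
have toY f : regular_at x f -> regular_at (h x) (f \o h').
  by move=> hf; apply: rh'; rewrite hK.
have toX (f : X -> k) : regular_at (h x) (f \o h') -> regular_at x f.
  by move=> /rh; apply: regular_near; near=> y; rewrite /= hK.
split=> [c|f g /toY hf /toY hg|f g /toY hf /toY hg|f /toY hf fx].
- by apply: toX; apply: regular_near (regular_cst (h x) c nY); near=> y.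
- by apply: toX; exact: regularD nY hf hg.
- by apply: toX; exact: regularM nY hf hg.
have fx' : (f \o h') (h x) != 0 by rewrite /= hK.
split; last by apply: toX; exact: regularV nY hf fx'.
have := ch x _ (near_regular_neq0 nY hf fx'); rewrite nbhs_simpl /=.
by apply: filterS => y; rewrite /= hK.
Unshelve. all: by end_near. Qed.

Lemma nice_cover X (I : Type) (U : I -> set X) : (forall i, open (U i)) ->
  (forall i, nice (set_type (U i))) -> \bigcup_i U i = setT -> nice X.
Proof.
move=> oU nU cU x.
have [i _ Ux] : (\bigcup_i U i) x by rewrite cU.
pose x' : set_type (U i) := exist _ x (mem_set Ux).
have toX (f : X -> k) : regular_at x' (fun y : set_type (U i) => f (val y)) -> regular_at x f.
  move=> [g hg fg]; apply: regular_near hg.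
  have := near_open_val (x := x') (P := fun y => f y = g y) (oU i) fg.
  by apply: filterS => y ->.
have toU f : regular_at x f -> regular_at x' (fun y : set_type (U i) => f (val y)).
  exact: (@regular_sub _ _ x').
split=> [c|f g /toU hf /toU hg|f g /toU hf /toU hg|f /toU hf fx].
- by apply: toX; exact: (regular_cst x' c (nU i)).
- by apply: toX; exact: (regularD (nU i) hf hg).
- by apply: toX; exact: (regularM (nU i) hf hg).
- split; last by apply: toX; exact: (regularV (nU i) hf fx).
  exact: (near_open_val (x := x') (P := fun y => f y != 0) (oU i) (near_regular_neq0 (nU i) hf fx)).
Qed.

Lemma nice_variety X : is_variety X -> nice X.
Proof.
move=> [[r [U [oU aU cU]]] _]; apply: nice_cover oU _ cU => i.
have [m [Z [h [_ iso]]]] := aU i; apply: nice_iso iso _.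
apply: nice_sub; exact: nice_affine.
Qed.

(** * Regular functions on a product *)

Section VProd.
Variables (X Y : funSpaceType k) (nX : nice X) (nY : nice Y).

(** Functions representing elements of the tensor product of the two local rings. They form a ring,
    and regular germs on the product are their fractions. *)
Definition tens (z : vprod X Y) (h : vprod X Y -> k) := exists r (f : 'I_r -> X -> k) (g : 'I_r -> Y -> k),
  [/\ forall i, regular_at z.1 (f i), forall i, regular_at z.2 (g i) & h =1 tensor f g].

Lemma tens_eq z h h' : h =1 h' -> tens z h -> tens z h'.
Proof. by move=> hh' [r [f [g [hf hg hE]]]]; exists r, f, g; split=> // w; rewrite -hh'. Qed.

Lemma tens_pure z f g : regular_at z.1 f -> regular_at z.2 g -> tens z (fun w => f w.1 * g w.2).
Proof.
move=> hf hg; exists 1%N, (fun=> f), (fun=> g); split=> // w.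
by rewrite /tensor big_ord1.
Qed.

Lemma tensD z h h' : tens z h -> tens z h' -> tens z (fun w => h w + h' w).
Proof.
move=> [r [f [g [hf hg hE]]]] [s [f' [g' [hf' hg' h'E]]]].
exists (r + s)%N, (fun i => match fintype.split i with inl j => f j | inr j => f' j end),
  (fun i => match fintype.split i with inl j => g j | inr j => g' j end).
split=> [i|i|w]; [by case: (fintype.split i)..|].
rewrite hE h'E /tensor big_split_ord /=; congr (_ + _); apply: eq_bigr => i _.
  by rewrite (unsplitK (inl _ i)).
by rewrite (unsplitK (inr _ i)).
Qed.

Lemma tens0 z : tens z (fun=> 0).
Proof.
exists 0%N, (fun _ _ => 0), (fun _ _ => 0); split=> [[]//|[]//|w].
by rewrite /tensor big_ord0.
Qed.

Lemma tens_sum z r (h : 'I_r -> vprod X Y -> k) : (forall i, tens z (h i)) ->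
  tens z (fun w => \sum_i h i w).
Proof.
move=> hh; elim: (index_enum _) => [|i s IH].
  by apply: tens_eq (tens0 z) => w; rewrite big_nil.
by apply: tens_eq (tensD (hh i) IH) => w; rewrite big_cons.
Qed.

Lemma tensM z h h' : tens z h -> tens z h' -> tens z (fun w => h w * h' w).
Proof.
move=> [r [f [g [hf hg hE]]]] [s [f' [g' [hf' hg' h'E]]]].
apply: tens_eq (tens_sum (h := fun i w => \sum_j (f i w.1 * f' j w.1) * (g i w.2 * g' j w.2)) _).
  move=> w; rewrite hE h'E /tensor mulr_suml; apply: eq_bigr => i _.
  by rewrite mulr_sumr; apply: eq_bigr => j _; ring.
move=> i; apply: tens_sum => j; apply: (tens_pure (f := fun y => f i y * f' j y) (g := fun y => g i y * g' j y)).
  exact: regularM.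
exact: regularM.
Qed.

Lemma tens_cst z c : tens z (fun=> c).
Proof.
apply: tens_eq (tens_pure (z := z) (regular_cst z.1 c nX) (regular_cst z.2 1 nY)) => w.
by rewrite mulr1.
Qed.

Lemma near_tens_neq0 z h : tens z h -> h z != 0 -> \forall w \near z, h w != 0.
Proof.
move=> [r [f [g [hf hg hE]]]] hz.
have nearU (Z : funSpaceType k) (t : Z) q (e : 'I_q -> Z -> k) :
    (forall i, regular_at t (e i)) ->
    exists2 U, open_nbhs t U & forall u, U u -> forall i, regular_at u (e i).
  move=> et; have : nbhs t [set u | forall i, regular_at u (e i)].
    by apply: filter_forall => i; apply: regular_at_near.
  rewrite nbhsE => -[U ? UP]; by exists U.
have [U [oU Uz] Uf] := nearU _ _ _ _ hf; have [V [oV Vz] Vg] := nearU _ _ _ _ hg.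
pose W : set (vprod X Y) := [set w | [/\ U w.1, V w.2 & tensor f g w != 0]].
have : nbhs z W.
  apply: open_nbhs_nbhs; split; last by split=> //; rewrite -hE.
  apply: open_vprod_subbase; exists U, V, r, f, g; split=> // i y hy; [exact: Uf|exact: Vg].
by apply: filterS => w [_ _]; rewrite hE.
Qed.

Lemma near_vprod1 (z : vprod X Y) (P : X -> Prop) : (\forall x \near z.1, P x) -> \forall w \near z, P w.1.
Proof.
move=> h; have : nbhs z.1 [set x | P x] by [].
rewrite nbhsE => -[B [oB Bz] BP].
have : nbhs z [set w : vprod X Y | [/\ B w.1, setT w.2 & tensor (fun _ : 'I_1 => fun=> 1 : k) (fun=> fun=> 1) w != 0]].
  apply: open_nbhs_nbhs; split; last by split=> //; rewrite /tensor big_ord1 mulr1 oner_neq0.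
  apply: open_vprod_subbase; exists B, setT, 1%N, (fun=> fun=> 1), (fun=> fun=> 1).
  by split=> // [|_ y _|_ y _]; [split=> //; exact: openT|exact: regular_cst|exact: regular_cst].
by apply: filterS => w [/BP].
Qed.

Lemma near_vprod2 (z : vprod X Y) (P : Y -> Prop) : (\forall y \near z.2, P y) -> \forall w \near z, P w.2.
Proof.
move=> h; have : nbhs z.2 [set x | P x] by [].
rewrite nbhsE => -[B [oB Bz] BP].
have : nbhs z [set w : vprod X Y | [/\ setT w.1, B w.2 & tensor (fun _ : 'I_1 => fun=> 1 : k) (fun=> fun=> 1) w != 0]].
  apply: open_nbhs_nbhs; split; last by split=> //; rewrite /tensor big_ord1 mulr1 oner_neq0.
  apply: open_vprod_subbase; exists setT, B, 1%N, (fun=> fun=> 1), (fun=> fun=> 1).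
  by split=> // [|_ y _|_ y _]; [split=> //; exact: openT|exact: regular_cst|exact: regular_cst].
by apply: filterS => w [_ /BP].
Qed.

Lemma vprod_regularP z h : regular_at z h <-> exists h1 h2, [/\ tens z h1, tens z h2, h2 z != 0
  & \forall w \near z, h w = h1 w / h2 w].
Proof.
split=> [[r [s [f [g [f' [g' [[hf hg] [hf' hg'] nz hE]]]]]]]|].
  by exists (tensor f g), (tensor f' g'); split=> //; [exists r, f, g|exists s, f', g'].
move=> [h1 [h2 [[r [f [g [hf hg h1E]]]] [s [f' [g' [hf' hg' h2E]]]] h2z hE]]].
exists r, s, f, g, f', g'; split=> //; first by rewrite -h2E.
by near=> w; rewrite (near hE w) // h1E h2E.
Unshelve. all: by end_near. Qed.

Lemma tens_regular z h : tens z h -> regular_at z h.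
Proof.
move=> hh; apply/vprod_regularP; exists h, (fun=> 1); split=> //; [exact: tens_cst|exact: oner_neq0|].
by near=> w; rewrite divr1.
Unshelve. all: by end_near. Qed.

Lemma nice_vprod : nice (vprod X Y).
Proof.
move=> z; split=> [c|f g|f g|f].
- exact/tens_regular/tens_cst.
- move=> /vprod_regularP[p [q [hp hq qz fE]]] /vprod_regularP[p' [q' [hp' hq' q'z gE]]].
  apply/vprod_regularP; exists (fun w => p w * q' w + p' w * q w), (fun w => q w * q' w).
  split; [by apply: tensD; exact: tensM|exact: tensM|exact: mulf_neq0|].
  have nq := near_tens_neq0 hq qz; have nq' := near_tens_neq0 hq' q'z.
  near=> w; rewrite (near fE w) // (near gE w) //; field.
  by rewrite (near nq w) // (near nq' w).
- move=> /vprod_regularP[p [q [hp hq qz fE]]] /vprod_regularP[p' [q' [hp' hq' q'z gE]]].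
  apply/vprod_regularP; exists (fun w => p w * p' w), (fun w => q w * q' w).
  split; [exact: tensM|exact: tensM|exact: mulf_neq0|].
  by near=> w; rewrite (near fE w) // (near gE w) // invfM; ring.
- move=> /vprod_regularP[p [q [hp hq qz fE]]] fz.
  have pz : p z != 0 by apply: contraNneq fz => pz; rewrite (nbhs_singleton fE) pz mul0r.
  have nq := near_tens_neq0 hq qz; have np := near_tens_neq0 hp pz.
  split.
    near=> w; rewrite (near fE w) // mulf_neq0 ?invr_neq0 //.
      by rewrite (near np w).
    by rewrite (near nq w).
  apply/vprod_regularP; exists q, p; split=> //; near=> w; by rewrite (near fE w) // invf_div.
Unshelve. all: by end_near. Qed.

End VProd.

Lemma morphism_to_affine X m (h : X -> affine k m) : nice X ->
  (forall x j, regular_at x (fun y => h y j)) -> is_morphism h.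
Proof.
move=> nX hr.
have preg x (p : {mpoly k[m]}) : regular_at x (fun y => p.@[h y]).
  exact: (@regular_poly X x m p (fun j y => h y j) nX).
have ch : continuous h.
  move=> x U /nbhs_affineP[p px pU]; rewrite nbhs_simpl.
  have := near_regular_neq0 nX (preg x p) px; apply: filterS => y; exact: pU.
split=> // x f [p [q [qx fE]]].
have := regularM nX (preg x p) (regularV nX (preg x q) qx).
apply: regular_near; have := ch x _ fE; rewrite nbhs_simpl /=.
by apply: filterS => y /= ->.
Qed.

Lemma morphism_to_sub X (Y : funSpaceType k) (A : set Y) (h : X -> set_type A) :
  is_morphism (fun x => val (h x)) -> is_morphism h.
Proof.
move=> [ch rh]; have ch' : continuous h.
  move=> x U /nbhs_set_type[C oC CU]; rewrite nbhs_simpl.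
  have := ch x _ (open_nbhs_nbhs oC); rewrite nbhs_simpl /=.
  by apply: filterS => y; exact: CU.
split=> // x f [g hg fg].
apply: regular_near (rh x g hg); have := ch' x _ fg; rewrite nbhs_simpl /=.
by apply: filterS => y /= ->.
Qed.

Lemma morphism_val X (A : set X) : is_morphism (fun x : set_type A => val x).
Proof.
split; last by move=> x f; exact: regular_sub.
by move=> x U; exact: near_val.
Qed.

Lemma regular_coord m (x : affine k m) j : regular_at x (fun y : affine k m => y j).
Proof.
exists 'X_j, 1; rewrite meval1 oner_eq0; split=> //.
by near=> y; rewrite mevalXU meval1 divr1.
Unshelve. all: by end_near. Qed.

Lemma morphism_vprod X Y (X' Y' : funSpaceType k) (f : X -> X') (g : Y -> Y') :
  nice X -> nice Y -> is_morphism f -> is_morphism g ->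
  is_morphism (fun z : vprod X Y => (f z.1, g z.2) : vprod X' Y').
Proof.
move=> nX nY [cf rf] [cg rg].
have tpull (z : vprod X Y) h : tens (f z.1, g z.2 : Y') h ->
    tens z (fun w : vprod X Y => h (f w.1, g w.2)).
  move=> [r [u [v [hu hv hE]]]]; exists r, (fun i => u i \o f), (fun i => v i \o g).
  split=> [i|i|w]; [exact: rf|exact: rg|exact: hE].
have ch : continuous (fun z : vprod X Y => (f z.1, g z.2) : vprod X' Y').
  move=> z U /nbhs_vprod[s hs sU]; rewrite nbhs_simpl.
  suff : nbhs z [set w : vprod X Y | forall W, W \in s -> W (f w.1, g w.2)].
    by apply: filterS => w; exact: sU.
  elim: s hs {sU} => [|W s IH] hs; first exact: filterE.
  have /IH {}IH : forall V, V \in s -> vprod_subbase V /\ V (f z.1, g z.2).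
    by move=> V Vs; apply: hs; rewrite inE Vs orbT.
  have [[U1 [V1 [r [u [v [[oU oV] hu hv WE]]]]]]] := hs W (mem_head _ _).
  rewrite WE /= => -[Uz Vz tz].
  have n1 : \forall w \near z, tensor u v (f w.1, g w.2) != 0.
    apply: (near_tens_neq0 (z := z) (h := fun w => tensor u v (f w.1, g w.2)) _ tz).
    apply: (tpull z (tensor u v)); exists r, u, v; split=> // i; [exact: hu|exact: hv].
  have n2 := near_vprod1 nX nY (cf z.1 _ (open_nbhs_nbhs (conj oU Uz))).
  have n3 := near_vprod2 nX nY (cg z.2 _ (open_nbhs_nbhs (conj oV Vz))).
  near=> w => V; rewrite inE => /orP[/eqP ->|Vs]; last by apply: (near IH w).
  split=> /=; [exact: (near n2 w)|exact: (near n3 w)|exact: (near n1 w)].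
split=> // z h /vprod_regularP[h1 [h2 [t1 t2 h2z hE]]].
apply/vprod_regularP; exists (fun w => h1 (f w.1, g w.2)), (fun w => h2 (f w.1, g w.2)).
split=> //; [exact: tpull|exact: tpull|].
by have := ch z _ hE; rewrite nbhs_simpl.
Unshelve. all: by end_near. Qed.

End NiceSpaces.

(** * Algebraic torus actions are graded *)

Section RationalWeights.
Variables (k : closedFieldType) (n : nat).
Local Notation A := {mpoly k[n]}.

Lemma mcoeff_horner (R : {poly A}) s m :
  (R.[s%:MP])@_m = (map_poly (mcoeff m) R).[s].
Proof.
rewrite horner_coef (horner_coef_wide _ (size_poly _ _)) raddf_sum.
apply: eq_bigr => i _; rewrite coef_map /= mulrC -rmorphXn /= mul_mpolyC mcoeffZ.
by rewrite mulrC.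
Qed.

Lemma poly_cofinite_eq0 (R : {poly A}) (e : {poly k}) : e != 0 ->
  (forall s, e.[s] != 0 -> R.[s%:MP] = 0) -> R = 0.
Proof.
move=> e0 h; apply/polyP => j; rewrite coef0; apply/mpolyP => m; rewrite mcoeff0.
have : map_poly (mcoeff m) R * e = 0.
  apply: poly_eval0 => s; rewrite hornerM -mcoeff_horner.
  by have [->|/h ->] := eqVneq e.[s] 0; rewrite ?mulr0 // mcoeff0 mul0r.
move=> /eqP; rewrite mulf_eq0 (negPf e0) orbF => /eqP /polyP/(_ j).
by rewrite coef0 coef_map.
Qed.

Lemma mcoeff_expM_low (N b : A) D m : N@_0%MM = 0 -> (mdeg m < D)%N ->
  (N ^+ D * b)@_m = 0.
Proof.
move=> N0; elim: D m => // D IH m mD; rewrite exprS -mulrA mcoeffM big1 // => -[m1 m2] /= /eqP mE.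
have [m10|m10] := eqVneq (m1 : 'X_{1..n}) 0%MM; first by rewrite m10 N0 mul0r.
have arith : forall d d1 d2, (d = d1 + d2 -> d < D.+1 -> 0 < d1 -> d2 < D)%N by lia.
rewrite IH ?mulr0 //; apply: (arith (mdeg m) (mdeg m1)) => //.
  by rewrite -mdegD; exact: congr1.
by rewrite lt0n mdeg_eq0.
Qed.

(* Over a point s with Q(s) invertible as a power series, c(s) = P(s)/Q(s) is a
   polynomial of bounded degree, hence a truncation of P(s) times the geometric
   series of Q(s)^-1, whose denominators are powers of the constant term. *)
Lemma rational_coeffs (c : k -> A) (P Q : {poly A}) : (Q.[1])@_0%MM != 0 ->
  (forall s, s != 0 -> c s * Q.[s%:MP] = P.[s%:MP]) ->
  exists (q e : {poly k}) (M : {poly A}), [/\ q != 0, e != 0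
    & forall s, s != 0 -> e.[s] != 0 -> q.[s] *: c s = M.[s%:MP]].
Proof.
move=> Q1 cE; pose e := map_poly (mcoeff 0%MM) Q.
have e0 : e != 0.
  by apply: contraNneq Q1 => e0; rewrite -mpolyC1 mcoeff_horner -/e e0 horner0.
(* [D] bounds the size of [P(s)] for all [s] at once, hence that of [c(s)] wherever [Q(s)] is
   nonzero. *)
pose D := (\max_(i < size P) msize P`_i).
pose x : {poly A} := map_poly (@mpolyC n k) e; pose N := x - Q.
(* The truncated geometric series: [Q S = x^D - N^D], so [e^D c = P S + N^D c]. As [N(s)] has no
   constant term, the last summand contributes nothing in degrees below [D]. *)
pose S := \sum_(i < D) x ^+ (D.-1 - i) * N ^+ i.
have xN : x ^+ D - N ^+ D = Q * S by rewrite subrXX /N opprB addrC subrK.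
pose M : {poly A} := \sum_(m : 'X_{1..n < D})
  map_poly (@mpolyC n k) (map_poly (mcoeff m) (P * S)) * ('X_[m])%:P.
have xE s : x.[s%:MP] = (e.[s])%:MP by rewrite horner_map.
exists (e ^+ D), e, M; split=> // [|s s0 es]; first by rewrite expf_neq0.
have Qs : Q.[s%:MP] != 0.
  by apply: contraNneq es => Qs; rewrite -mcoeff_horner Qs mcoeff0.
have sc : (msize (c s) <= D)%N.
  have [->|c0] := eqVneq (c s) 0; first by rewrite msize0.
  apply: (@leq_trans (msize P.[s%:MP])).
    by rewrite -cE // msizeM //; move: (mmeasure_poly_eq0 mdeg Q.[s%:MP]);
      rewrite (negPf Qs); move: (msize Q.[s%:MP]) => u /=; case: u => // u _;
      rewrite addnS /= leq_addr.
  rewrite horner_coef; apply: leq_trans (mmeasure_sum _ _ _ _) _.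
  apply/bigmax_leqP => i _; rewrite mulrC -rmorphXn /= mul_mpolyC.
  by apply: leq_trans (msizeZ_le _ _) _; exact: (leq_bigmax i).
have N0 : (N.[s%:MP])@_0%MM = 0.
  by rewrite hornerD hornerN mcoeffB xE mcoeffC eqxx mulr1 mcoeff_horner subrr.
have main : (e ^+ D).[s] *: c s = (P * S).[s%:MP] + N.[s%:MP] ^+ D * c s.
  rewrite hornerM -cE // -mulrA -hornerM -xN hornerD hornerN !horner_exp xE.
  by rewrite -rmorphXn /= mulrBr mulrC mul_mpolyC mulrC subrK.
have sZ : (msize ((e ^+ D).[s] *: c s) <= D)%N by apply: leq_trans (msizeZ_le _ _) _.
rewrite (mpolywE sZ) horner_sum; apply: eq_bigr => m _.
rewrite hornerM hornerC horner_map /= mul_mpolyC; congr (_ *: _).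
by rewrite main mcoeffD (mcoeff_expM_low _ N0 (bmdeg m)) addr0 mcoeff_horner.
Qed.

Variable G1 : k -> n.-tuple A.
Hypothesis G1M : forall s u a, s != 0 -> u != 0 -> (a \mPo G1 s) \mPo G1 u = a \mPo G1 (s * u).
Hypothesis G11 : forall a, a \mPo G1 1 = a.

Lemma G1_inj u a : u != 0 -> a \mPo G1 u = 0 -> a = 0.
Proof.
by move=> u0 au; rewrite -(G11 a) -(mulfV u0) -G1M ?invr_eq0 // au comp_mpoly0.
Qed.

Lemma horner_map_comp (g : n.-tuple A) (M : {poly A}) s :
  (map_poly (comp_mpoly g) M).[s%:MP] = M.[s%:MP] \mPo g.
Proof. by rewrite -{1}(comp_mpolyC s g) horner_map. Qed.

Section Orbit.
Variable b : A.

(** The orbit of [b] is the fraction [M / q] in the parameter [s], up to the finitely many roots of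
    [e] and the point 0. *)
Let weight_frac (q : {poly k}) (M : {poly A}) := q != 0 /\ exists2 e : {poly k}, e != 0 &
  forall s, s != 0 -> e.[s] != 0 -> q.[s] *: (b \mPo G1 s) = M.[s%:MP].

(** The orbit at [s u] is read off the fraction at [s u], or at [s] followed by the action of [u];
    agreement for all but finitely many [s] is an identity of polynomials. *)
Let weight_fracE q M u : u != 0 -> weight_frac q M ->
  map_poly (@mpolyC n k) q * (M \Po (u%:MP *: 'X)) =
  map_poly (@mpolyC n k) (q \Po (u *: 'X)) * map_poly (comp_mpoly (G1 u)) M.
Proof.
move=> u0 [q0 [e e0 h]]; apply/eqP; rewrite -subr_eq0; apply/eqP.
have eu0 : e \Po (u *: 'X) != 0.
  have : size (u *: 'X : {poly k}) = 2%N by rewrite size_scale // size_polyX.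
  by move=> su; rewrite comp_poly2_eq0.
apply: (@poly_cofinite_eq0 _ ('X * e * (e \Po (u *: 'X)))) => [|s].
  by rewrite !mulf_neq0 // polyX_eq0.
rewrite !hornerM hornerX horner_comp hornerZ hornerX !mulf_eq0 !negb_or -andbA.
move=> /and3P[s0 es eus]; rewrite hornerD hornerN !hornerM horner_comp hornerZ hornerX.
rewrite -rmorphM /= -h ?mulf_neq0 // !horner_map /= horner_comp hornerZ hornerX.
by rewrite horner_map_comp -h // comp_mpolyZ G1M // !mul_mpolyC !scalerA mulrC (mulrC s) subrr.
Qed.

(** A nonzero root [a] of [q] is a root of [M]: choose [u] with [q(a u)] nonzero and evaluate
    [weight_fracE] at [a]. The common factor is cancelled, so the only pole left is 0. *)
Let weight_frac_noroot q M : weight_frac q M ->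
  exists q' M', weight_frac q' M' /\ forall a, a != 0 -> q'.[a] != 0.
Proof.
move: {2}(size q).+1 (ltnSn (size q)) => N; elim: N q M => // N IH q M qN qM.
have [h|] := pselect (forall a, a != 0 -> q.[a] != 0); first by exists q, M.
move=> /existsNP[a /not_implyP[a0 /negP]]; rewrite negbK => qa.
have q0 : q != 0 by case: qM.
have Ma : M.[a%:MP] = 0.
  have /closed_nonrootP[u] : 'X * (q \Po (a *: 'X)) != 0.
    have sa : size (a *: 'X : {poly k}) = 2%N by rewrite size_scale // size_polyX.
    by rewrite mulf_neq0 ?polyX_eq0 // comp_poly2_eq0.
  rewrite /root hornerM hornerX horner_comp hornerZ hornerX mulf_eq0 negb_or => /andP[u0 qu].
  have := congr1 (fun p => p.[a%:MP]) (weight_fracE u0 qM).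
  rewrite /= !hornerM !horner_map /= (eqP qa) mul0r horner_comp hornerZ hornerX (mulrC u).
  move=> /esym/eqP; rewrite mul_mpolyC mscalerI (negPf qu) /= horner_map_comp.
  by move=> /eqP; exact: G1_inj.
have [q1 qE] : exists q1, q = q1 * ('X - a%:P) by apply/factor_theorem.
have [M1 ME] : exists M1, M = M1 * ('X - (a%:MP)%:P) by apply/factor_theorem/eqP.
have q10 : q1 != 0 by apply: contraNneq q0 => e; rewrite qE e mul0r.
apply: (IH q1 M1).
  by move: qN; rewrite qE size_Mmonic ?monicXsubC // size_XsubC addn2.
split=> //; have [_ [e e0 h]] := qM; exists (e * ('X - a%:P)).
  by rewrite mulf_neq0 // polyXsubC_eq0.
move=> s s0; rewrite hornerM hornerXsubC mulf_eq0 negb_or => /andP[es sa].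
have := h s s0 es; rewrite qE ME !hornerM !hornerXsubC -rmorphB /= mulrC -scalerA => h1.
apply: (scalerI sa); rewrite h1 mulrC mul_mpolyC //.
Qed.

(** With denominator [c X^N] the orbit is a Laurent polynomial in the parameter, and comparing
    coefficients in [weight_fracE] shows that its coefficients are weight vectors. *)
Lemma rational_weights (P Q : {poly A}) : (Q.[1])@_0%MM != 0 ->
  (forall s, s != 0 -> (b \mPo G1 s) * Q.[s%:MP] = P.[s%:MP]) ->
  exists2 L : seq (int * A), b = \sum_(p <- L) p.2
  & forall p u, p \in L -> u != 0 -> p.2 \mPo G1 u = u ^ p.1 *: p.2.
Proof.
move=> Q1 /(rational_coeffs Q1)[q0 [e0 [M0 [q00 e00 h0]]]].
have [q [M [qM qa]]] : exists q M, weight_frac q M /\ forall a, a != 0 -> q.[a] != 0.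
  exact: (weight_frac_noroot (conj q00 (ex_intro2 _ _ e0 e00 h0))).
have [rs qE] := closed_field_poly_normal q; pose N := size rs.
pose c := lead_coef q; have c0 : c != 0 by rewrite lead_coef_eq0; case: qM.
have {}qE : q = c *: 'X^N.
  rewrite {1}qE -/c; congr (_ *: _); rewrite /N.
  have : all (pred1 0) rs.
    apply/allP => z zr /=; apply: contraT => /qa; rewrite qE hornerZ mulf_eq0 (negPf c0) /=.
    by rewrite -/(root _ z) root_prod_XsubC zr.
  elim: (rs) => [|z r IH] /=; first by rewrite big_nil.
  by case/andP=> /eqP -> /IH rE; rewrite big_cons rE subr0 exprS.
have MjE j u : u != 0 -> M`_j \mPo G1 u = u ^ (j%:Z - N%:Z) *: M`_j.
  move=> u0; have := congr1 (fun p : {poly A} => p`_(N + j)) (weight_fracE u0 qM).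
  rewrite qE comp_polyZ comp_Xn_poly exprZn scalerA !map_polyZ /= !map_polyXn.
  rewrite -!scalerAl !coefZ !coefXnM ltnNge leq_addr /= addKn coef_map /=.
  have -> : (M \Po (u%:MP *: 'X))`_j = (u ^+ j)%:MP * M`_j.
    rewrite comp_polyE coef_sum -[in RHS](coefK M) coef_poly.
    under eq_bigr do rewrite exprZn !coefZ coefXn.
    have [jM|jM] := ltnP j (size M).
      rewrite (bigD1 (Ordinal jM)) //= eqxx mulr1 big1 ?addr0 ?rmorphXn; first by rewrite mulrC.
      by move=> i ij; rewrite (negPf (_ : j != i)) ?mulr0 //; apply: contraNneq ij => ji; apply/eqP/val_inj.
    rewrite mulr0 big1 // => i _; rewrite (negPf (_ : j != i)) ?mulr0 //.
    by apply: contraTneq (ltn_ord i) => <-; rewrite -leqNgt.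
  rewrite !mul_mpolyC scalerA => e.
  have cu0 : c * u ^+ N != 0 by rewrite mulf_neq0 ?expf_neq0.
  apply: (scalerI cu0); rewrite -e scalerA -mulrA; congr (_ *: _); congr (_ * _).
  by rewrite !exprnP -expfzDr // addrC subrK.
exists [seq (j%:Z - N%:Z, c^-1 *: M`_j) | j <- index_iota 0 (size M)]; last first.
  by move=> p u /mapP[j _ ->] u0 /=; rewrite comp_mpolyZ MjE // !scalerA mulrC.
have [_ [e en0 h]] := qM.
have /closed_nonrootP[s] : 'X * e != 0 by rewrite mulf_neq0 ?polyX_eq0.
rewrite /root hornerM hornerX mulf_eq0 negb_or => /andP[s0 es].
have csN : c * s ^+ N != 0 by rewrite mulf_neq0 ?expf_neq0.
have s1 : s^-1 != 0 by rewrite invr_eq0.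
(* Acting by the inverse of one good point [s] recovers [b] from its orbit. *)
apply: (scalerI csN); have := congr1 (comp_mpoly (G1 s^-1)) (h s s0 es).
rewrite comp_mpolyZ G1M // mulfV // G11 qE hornerZ hornerXn => ->.
rewrite big_map scaler_sumr big_mkord horner_coef raddf_sum /=.
apply: eq_bigr => j _; rewrite rmorphM /= -rmorphXn /= comp_mpolyC MjE // mulrC mul_mpolyC !scalerA.
congr (_ *: _); rewrite exprz_inv opprB expfzDr // -!exprnP -exprnN.
by field; rewrite c0 expf_neq0.
Qed.

End Orbit.
End RationalWeights.

(** * From one-parameter subgroups to the whole torus *)

Section TorusWeights.
Variables (k : closedFieldType) (char0 : [pchar k] =i pred0) (r n : nat).
Local Notation A := {mpoly k[n]}.
Variable G : ('I_r -> k) -> n.-tuple A.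
Hypothesis GM : forall t u a, torus_pt t -> torus_pt u ->
  (a \mPo G t) \mPo G u = a \mPo G (fun i => t i * u i).
Hypothesis G1 : forall a, a \mPo G (fun=> 1) = a.

Definition one_param (i : 'I_r) (s : k) : 'I_r -> k := fun j => if j == i then s else 1.

Lemma one_param_pt i s : s != 0 -> torus_pt (one_param i s).
Proof. by move=> s0 j; rewrite /one_param; case: ifP => // _; exact: oner_neq0. Qed.

Let U i s (a : A) := a \mPo G (one_param i s).
Let wt i (j : int) (a : A) := forall s, s != 0 -> U i s a = s ^ j *: a.

Let UM i s u a : s != 0 -> u != 0 -> U i u (U i s a) = U i (s * u) a.
Proof.
move=> s0 u0; rewrite /U GM; [|exact: one_param_pt..]; congr (_ \mPo G _).
by apply: funext => j; rewrite /one_param; case: ifP => // _; rewrite mulr1.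
Qed.

Let U1 i a : U i 1 a = a.
Proof.
rewrite -[RHS]G1; congr (_ \mPo G _); apply: funext => j.
by rewrite /one_param; case: ifP.
Qed.

Let UC i i' s s' a : s != 0 -> s' != 0 -> U i s (U i' s' a) = U i' s' (U i s a).
Proof.
move=> s0 s0'; rewrite /U !GM; try exact: one_param_pt.
by congr (_ \mPo G _); apply: funext => j; rewrite mulrC.
Qed.

Let wt_extract i (L : seq (int * A)) j : (forall p, p \in L -> wt i p.1 p.2) ->
  \sum_(p <- L) p.2 = 0 -> \sum_(p <- L | p.1 == j) p.2 = 0.
Proof.
move=> hL sL.
have := @semiinv_extract k 1 n char0 (fun t => G (one_param i (t 0)))
  [seq (const_mx p.1, p.2) | p <- L] (const_mx j).
rewrite !big_map /= sL => h; rewrite -[RHS]h //; last first.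
  move=> _ /mapP[p pL ->] t t0 /=; rewrite -/(U i _ _) hL //.
  by rewrite /torus_char big_ord1 mxE.
apply: eq_bigl => p; apply/eqP/eqP => [->//|/rowP/(_ 0)]; by rewrite !mxE.
Qed.

Hypothesis rational : forall i l, exists P Q : {poly A}, (Q.[1])@_0%MM != 0 /\
  forall s, s != 0 -> tnth (G (one_param i s)) l * Q.[s%:MP] = P.[s%:MP].

Let one_param_weights i a : exists2 L : seq (int * A), a = \sum_(p <- L) p.2
  & forall p, p \in L -> wt i p.1 p.2.
Proof.
elim/mpoly_ring_ind: a => [c|l|a b [La -> ha] [Lb -> hb]|a b [La -> ha] [Lb -> hb]].
- exists [:: (0, c%:MP)]; first by rewrite big_seq1.
  by move=> p; rewrite inE => /eqP -> s s0; rewrite /U comp_mpolyC expr0z scale1r.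
- have [P [Q [Q1 h]]] := rational i l.
  have [||s s0|L LE hL] := @rational_weights k n (fun s => G (one_param i s)) _ _ 'X_l P Q Q1.
  + by move=> s u a s0 u0; exact: UM.
  + exact: U1.
  + by rewrite comp_mpolyXU -tnth_nth h.
  by exists L => // p pL s; exact: hL.
- by exists (La ++ Lb); [rewrite big_cat|move=> p; rewrite mem_cat => /orP[/ha|/hb]].
- exists [seq (p.1 + q.1, p.2 * q.2) | p <- La, q <- Lb].
    by rewrite big_allpairs_dep mulr_suml; apply: eq_bigr => p _; rewrite mulr_sumr.
  move=> _ /allpairsP[[p q] [/= /ha hp /hb hq ->]] s s0 /=.
  by rewrite /U rmorphM /= -!/(U i s _) hp // hq // -scalerAl -scalerAr scalerA expfzDr.
Qed.

(** Once the terms of equal weight under the i-th factor are collected, the parts are unique; since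
    the factors commute, each part inherits the weights of [a] under the other factors. *)
Let refine i a : exists2 L : seq (int * A), a = \sum_(p <- L) p.2 &
  forall p, p \in L -> wt i p.1 p.2 /\ forall i' j, wt i' j a -> wt i' j p.2.
Proof.
have [L LE hL] := one_param_weights i a.
exists [seq (j, \sum_(p <- L | p.1 == j) p.2) | j <- undup (map fst L)].
  rewrite big_map /= LE (exchange_big_dep xpredT) //= big_seq [RHS]big_seq.
  apply: eq_bigr => p pL; rewrite -big_filter.
  rewrite (_ : [seq j <- _ | _] = [:: p.1]) ?big_seq1 //.
  rewrite -(filter_pred1_uniq (undup_uniq (map fst L))) ?mem_undup ?map_f //.
  by apply: eq_filter => j; rewrite /= eq_sym.
move=> _ /mapP[j _ ->] /=; split.
  move=> s s0; rewrite /U raddf_sum scaler_sumr big_seq_cond [RHS]big_seq_cond.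
  by apply: eq_bigr => p /andP[pL /eqP <-]; exact: hL.
move=> i' j' ha s s0; apply/eqP; rewrite -subr_eq0; apply/eqP.
rewrite /U raddf_sum scaler_sumr -sumrB.
have := @wt_extract i [seq (p.1, U i' s p.2 - s ^ j' *: p.2) | p <- L] j.
rewrite !big_map /=; apply.
  move=> _ /mapP[p pL ->] u u0 /=; rewrite /U comp_mpolyB comp_mpolyZ -!/(U _ _ _).
  by rewrite UC // hL // /U comp_mpolyZ scalerBr !scalerA mulrC.
by rewrite sumrB -scaler_sumr -LE -(ha s s0) /U LE [X in _ - X]raddf_sum subrr.
Qed.

Let simultaneous (s : seq 'I_r) a : exists2 L : seq ({ffun 'I_r -> int} * A),
  a = \sum_(p <- L) p.2
  & forall p i, p \in L -> i \in s -> wt i (p.1 i) p.2.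
Proof.
elim: s a => [|i s IH] a.
  by exists [:: ([ffun=> 0], a)]; rewrite ?big_seq1.
have [L -> hL] := IH a.
elim: L hL => [|p L IHL] hL; first by exists [::]; rewrite ?big_nil.
rewrite big_cons; have [|L' -> hL'] := IHL.
  by move=> p' i' h; apply: hL; rewrite inE h orbT.
have [M bE hM] := refine i p.2.
exists ([seq ([ffun i' => if i' == i then q.1 else p.1 i'], q.2) | q <- M] ++ L').
  by rewrite big_cat /= big_map bE.
move=> p' i'; rewrite mem_cat => /orP[/mapP[q qM ->] i's|h]; last exact: hL'.
have [h1 h2] := hM q qM; rewrite /= ffunE; case: eqP => [->//|/eqP ii].
by apply/h2/hL; rewrite ?mem_head //; move: i's; rewrite inE (negPf ii).
Qed.

Lemma torus_weights a : exists2 L : seq ('rV[int]_r * A), a = \sum_(p <- L) p.2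
  & forall p, p \in L -> semiinv G p.1 p.2.
Proof.
have [L aE hL] := simultaneous (enum 'I_r) a.
exists [seq (\row_i p.1 i, p.2) | p : {ffun 'I_r -> int} * A <- L]; first by rewrite big_map.
have sem w b : (forall i, wt i (w i) b) -> semiinv G (\row_i w i) b.
  move=> hb t t0.
  (* A point of the torus is the product of its one-parameter components, inserted one at a time. *)
  have part (s : seq 'I_r) : uniq s ->
      b \mPo G (fun j => if j \in s then t j else 1) = (\prod_(i <- s) t i ^ w i) *: b.
    elim: s => [_|i s IH /= /andP[si us]]; first by rewrite big_nil scale1r G1.
    have := congr1 (U i (t i)) (IH us); rewrite /U GM; last 2 first.
    - by move=> j; case: ifP => // _; exact: oner_neq0.
    - exact: one_param_pt.
    rewrite comp_mpolyZ -/(U _ _ _) hb // scalerA big_cons mulrC => <-.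
    congr (_ \mPo G _); apply: funext => j; rewrite inE /one_param.
    by case: eqP => [->|_]; rewrite ?(negPf si) ?mul1r ?mulr1.
  have := part (enum 'I_r) (enum_uniq _).
  rewrite (_ : (fun j => _) = t); last by apply: funext => j; rewrite mem_enum.
  by move=> ->; rewrite /torus_char big_enum /=; under [in RHS]eq_bigr do rewrite mxE.
move=> _ /mapP[p pL ->]; apply: sem => i; apply: hL => //.
by rewrite mem_enum.
Qed.

End TorusWeights.

Lemma morphism_pair (k : fieldType) (Z X Y : funSpaceType k) (f : Z -> X) (g : Z -> Y) :
  nice Z -> is_morphism f -> is_morphism g -> is_morphism (fun z => (f z, g z) : vprod X Y).
Proof.
move=> nZ [cf rf] [cg rg].
have tpull (z : Z) (h : vprod X Y -> k) : tens (f z, g z) h -> regular_at z (fun w => h (f w, g w)).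
  move=> [r [u [v [hu hv hE]]]].
  have : regular_at z (fun w => \sum_i u i (f w) * v i (g w)).
    elim: (index_enum _) => [|i s IH].
      by apply: regular_near (regular_cst z 0 nZ); near=> w; rewrite big_nil.
    have := regularD nZ (regularM nZ (rf _ _ (hu i)) (rg _ _ (hv i))) IH.
    by apply: regular_near; near=> w; rewrite big_cons.
  by apply: regular_near; near=> w; rewrite hE.
have ch : continuous (fun z => (f z, g z) : vprod X Y).
  move=> z U /nbhs_vprod[s hs sU]; rewrite nbhs_simpl.
  suff : nbhs z [set w : Z | forall W, W \in s -> W (f w, g w)].
    by apply: filterS => w; exact: sU.
  elim: s hs {sU} => [|W s IH] hs; first exact: filterE.
  have /IH {}IH : forall V, V \in s -> vprod_subbase V /\ V (f z, g z).
    by move=> V Vs; apply: hs; rewrite inE Vs orbT.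
  have [[U1 [V1 [r [u [v [[oU oV] hu hv WE]]]]]]] := hs W (mem_head _ _).
  rewrite WE /= => -[Uz Vz tz].
  have n1 : \forall w \near z, tensor u v (f w, g w) != 0.
    apply: (near_regular_neq0 (f := fun w => tensor u v (f w, g w)) nZ _ tz).
    apply: (tpull z (tensor u v)); exists r, u, v; split=> // i; [exact: hu|exact: hv].
  have n2 : \forall w \near z, U1 (f w) := cf z _ (open_nbhs_nbhs (conj oU Uz)).
  have n3 : \forall w \near z, V1 (g w) := cg z _ (open_nbhs_nbhs (conj oV Vz)).
  near=> w => V; rewrite inE => /orP[/eqP ->|Vs]; last by apply: (near IH w).
  split=> //=; [exact: (near n2 w)|exact: (near n3 w)|exact: (near n1 w)].
split=> // z h /vprod_regularP[h1 [h2 [t1 t2 h2z hE]]].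
have := regularM nZ (tpull z _ t1) (regularV nZ (tpull z _ t2) h2z).
by apply: regular_near; have := ch z _ hE; rewrite nbhs_simpl /=; apply: filterS => w ->.
Unshelve. all: by end_near. Qed.

Lemma morphism_id (k : fieldType) (X : funSpaceType k) : is_morphism (fun x : X => x).
Proof. by split=> // x U. Qed.

Lemma meval0_mcoeff (R : comNzRingType) n (p : {mpoly R[n]}) : p.@[fun=> 0] = p@_0%MM.
Proof.
elim/mpoly_ring_ind: p => [c|i|p q IHp IHq|p q IHp IHq].
- by rewrite mevalC mcoeffC eqxx mulr1.
- by rewrite mevalXU mcoeffX -mdeg_eq0 mdeg1.
- by rewrite mevalD mcoeffD IHp IHq.
- by rewrite mevalM IHp IHq -[RHS]/(mcoeff 0%MM _) rmorphM.
Qed.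

(** * Regular families over the multiplicative group are rational *)

Section CurveRational.
Variables (k : closedFieldType) (n : nat).
Local Notation A := {mpoly k[n]}.

(** The product of affine n-space with the multiplicative group, placed in affine (n+1)-space with
    the parameter as last coordinate, so that its regular functions are locally fractions of
    polynomials. *)
Definition punctured : set (affine k n.+1) := [set z | z ord_max != 0].

Lemma punctured_neq0 (z : set_type punctured) : val z ord_max != 0.
Proof. exact: set_mem (valP z). Qed.

Definition slice (z : affine k n.+1) : affine k n := [ffun j => z (widen_ord (leqnSn n) j)].

Definition unslice (x : 'I_n -> k) (s : k) : affine k n.+1 :=
  [ffun i => if unlift ord_max i is Some j then x j else s].

Lemma unslice_max x s : unslice x s ord_max = s.
Proof. by rewrite ffunE unlift_none. Qed.

Lemma unslice_widen x s j : unslice x s (widen_ord (leqnSn n) j) = x j.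
Proof.
rewrite ffunE (_ : widen_ord _ _ = lift ord_max j) ?liftK //.
by apply: val_inj; rewrite /= /bump leqNgt ltn_ord.
Qed.

Lemma slice_unslice x s : slice (unslice x s) =1 x.
Proof. by move=> j; rewrite ffunE unslice_widen. Qed.

(** Regularity at the single point (0, 1) suffices: the local fraction there, cleared of its domain
    of validity, is an identity of polynomials, and the denominator stays nonzero at (0, 1). *)
Lemma curve_rational (c : k -> n.-tuple A) l :
  is_morphism (fun z : set_type punctured =>
    [ffun l => (tnth (c (val z ord_max)) l).@[slice (val z)]] : affine k n) ->
  exists P Q : {poly A}, (Q.[1])@_0%MM != 0 /\
    forall s, s != 0 -> tnth (c s) l * Q.[s%:MP] = P.[s%:MP].
Proof.
move=> [_ reg].
have pz0 : punctured (unslice (fun=> 0) 1).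
  by rewrite /punctured /= unslice_max oner_neq0.
pose z0 : set_type punctured := exist _ (unslice (fun=> 0) 1) (mem_set pz0).
have z0E : val z0 = unslice (fun=> 0) 1 by [].
have [g [p [q [qz gpq]]] Fg] := reg z0 _ (regular_coord _ l).
have [C oC CF] := nbhs_set_type Fg.
have /nbhs_affineP[R1 R1z R1C] := open_nbhs_nbhs oC.
have /nbhs_affineP[R2 R2z R2g] := gpq.
(* The factors of [R] vanish wherever the expression [p / q] may fail, so the equation multiplied by
   [R] holds on the whole space. *)
pose R := q * R1 * R2.
have main z : punctured z -> (tnth (c (z ord_max)) l).@[slice z] * (q * R).@[z] = (p * R).@[z].
  move=> pz; rewrite !mevalM.
  have [->|qz'] := eqVneq q.@[z] 0; first by rewrite !mul0r !mulr0.
  have [->|R1z'] := eqVneq R1.@[z] 0; first by rewrite !(mulr0, mul0r).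
  have [->|R2z'] := eqVneq R2.@[z] 0; first by rewrite !(mulr0, mul0r).
  have := CF (exist _ z (mem_set pz)) (R1C _ R1z').
  rewrite /= ffunE R2g // => ->; by field.
have evalE (S : {mpoly k[n.+1]}) (v : 'I_n -> k) s :
    ((muni S).[s%:MP]).@[v] = S.@[unslice v s].
  rewrite meval_muni unslice_max -[LHS]/(meval v _) -horner_map /= mevalC; congr (_.[_]).
  by apply: eq_map_poly => a; apply: meval_eq => i; rewrite unslice_widen.
have [P1 P1E] : exists P1 : {poly A}, forall v s, (P1.[s%:MP]).@[v] = (p * R).@[unslice v s].
  by exists (muni (p * R)) => v s; exact: evalE.
have [Q1 Q1E] : exists Q1 : {poly A}, forall v s, (Q1.[s%:MP]).@[v] = (q * R).@[unslice v s].
  by exists (muni (q * R)) => v s; exact: evalE.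
exists P1, Q1; split.
  rewrite -mpolyC1 -meval0_mcoeff Q1E /R !mevalM -z0E.
  by rewrite !mulf_neq0.
move=> s s0; apply/eqP; rewrite -subr_eq0; apply/eqP/mpoly_eval0 => v.
have pu : punctured (unslice v s) by rewrite /punctured /= unslice_max.
rewrite mevalB P1E mevalM Q1E -(main _ pu) unslice_max.
by rewrite (meval_eq _ (slice_unslice v s)) subrr.
Qed.

End CurveRational.

Lemma multiplicative1 (G H : groupType) (phi : {multiplicative G -> H}) : phi 1%g = 1%g.
Proof. by apply: (mulgI (phi 1%g)); rewrite -gmulfM !mulg1. Qed.

Lemma multiplicativeV (G H : groupType) (phi : {multiplicative G -> H}) x :
  phi x^-1%g = (phi x)^-1%g.
Proof. by apply: (mulgI (phi x)); rewrite -gmulfM !mulgV multiplicative1. Qed.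

(** * Coordinates on an abstract torus and its action *)

Section TorusSubgroup.
Variables (k : closedFieldType) (char0 : [pchar k] =i pred0) (r n : nat).
Local Notation A := {mpoly k[n]}.
Variables (G : algGroupType k) (phi : {multiplicative G -> polyAut k n}).
Local Notation T := (set_type [set t : affine k r | forall i, t i != 0]).
Variables (f : G -> T) (f' : T -> G).
Hypothesis (f'_morph : is_morphism f') (fK : cancel f f') (f'K : cancel f' f).
Hypothesis fM : forall (x y : G) i, val (f (x * y)%g) i = val (f x) i * val (f y) i.
Hypothesis phi_alg : is_algebraic_hom phi.

Lemma torus_ptP (t : 'I_r -> k) : torus_pt t ->
  [set t : affine k r | forall i, t i != 0] [ffun i => t i].
Proof. by move=> t0 i; rewrite ffunE. Qed.

(** Total in [t], with default value 1 off the torus, so that weights are handled with plain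
    functions. *)
Definition torus_elt (t : 'I_r -> k) : G :=
  if pselect (torus_pt t) is left t0 then f' (exist _ [ffun i => t i] (mem_set (torus_ptP t0)))
  else 1%g.

Lemma torus_eltE t (x : T) : (forall i, t i = val x i) -> torus_elt t = f' x.
Proof.
move=> tx; rewrite /torus_elt; case: pselect => [t0|[]].
  by congr f'; apply: val_inj; apply/ffunP => i; rewrite ffunE.
by move=> i; rewrite tx; exact: (set_mem (valP x)).
Qed.

Lemma torus_elt_val t i : torus_pt t -> val (f (torus_elt t)) i = t i.
Proof.
by move=> t0; rewrite /torus_elt; case: pselect => // h; rewrite f'K /= ffunE.
Qed.

Lemma torus_eltM t u : torus_pt t -> torus_pt u ->
  (torus_elt t * torus_elt u)%g = torus_elt (fun i => t i * u i).
Proof.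
move=> t0 u0; rewrite -[LHS]fK; apply/esym/torus_eltE => i.
by rewrite fM !torus_elt_val.
Qed.

Lemma torus_elt1 : torus_elt (fun=> 1) = 1%g.
Proof.
have p1 : torus_pt (fun _ : 'I_r => 1 : k) by move=> i; exact: oner_neq0.
have := torus_eltM p1 p1; rewrite (_ : (fun i => _) = fun=> 1).
  by rewrite -[X in _ = X]mulg1 => /mulgI.
by apply: funext => i; rewrite mulr1.
Qed.

Lemma torus_elt_surj x : exists2 t, torus_pt t & torus_elt t = x.
Proof.
exists (val (f x)); first by move=> i; exact: (set_mem (valP (f x))).
by rewrite (@torus_eltE _ (f x)) ?fK.
Qed.

Definition torus_action (t : 'I_r -> k) : n.-tuple A := aut_tuple (phi (torus_elt t)).

Lemma torus_actionM t u a : torus_pt t -> torus_pt u ->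
  (a \mPo torus_action t) \mPo torus_action u = a \mPo torus_action (fun i => t i * u i).
Proof. by move=> t0 u0; rewrite -comp_autM -gmulfM torus_eltM. Qed.

Lemma torus_action1 a : a \mPo torus_action (fun=> 1) = a.
Proof. by rewrite /torus_action torus_elt1 multiplicative1 comp_aut1. Qed.

Lemma torus_action_rational i l : exists P Q : {poly A}, (Q.[1])@_0%MM != 0 /\
  forall s, s != 0 -> tnth (torus_action (one_param i s)) l * Q.[s%:MP] = P.[s%:MP].
Proof.
apply: (@curve_rational k n (fun s => torus_action (one_param i s))).
have nZ : nice (set_type (@punctured k n)) by apply: nice_sub; exact: nice_affine.
have inT (z : set_type (@punctured k n)) :
    [set t : affine k r | forall i, t i != 0] [ffun j => one_param i (val z ord_max) j].
  by move=> j; rewrite ffunE; exact: one_param_pt (punctured_neq0 z) j.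
pose a (z : set_type (@punctured k n)) : T :=
  exist _ [ffun j => one_param i (val z ord_max) j] (mem_set (inT z)).
have ma : is_morphism a.
  apply: morphism_to_sub; apply: morphism_to_affine => // x j /=.
  rewrite /one_param; have [ji|ji] := eqVneq j i.
    have := @regular_sub _ _ (@punctured k n) x _ (regular_coord (val x) ord_max).
    by apply: regular_near; near=> y; rewrite ffunE ji eqxx.
  by apply: regular_near (regular_cst x 1 nZ); near=> y; rewrite ffunE (negPf ji).
have mb : is_morphism (fun z : set_type (@punctured k n) => slice (val z)).
  apply: morphism_to_affine => // x j.
  have := @regular_sub _ _ (@punctured k n) x _ (regular_coord (val x) (widen_ord (leqnSn n) j)).
  by apply: regular_near; near=> y; rewrite ffunE.
have := morphism_comp (morphism_pair nZ (morphism_comp ma f'_morph) mb) phi_alg.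
congr is_morphism; apply: funext => z /=; apply/ffunP => m; rewrite !ffunE.
congr (_.@[_]); rewrite /torus_action tnth_aut_tuple (@torus_eltE _ (a z)) // => j.
by rewrite /= ffunE.
Unshelve. all: by end_near. Qed.

Lemma torus_action_weights a : exists2 L : seq ('rV[int]_r * A), a = \sum_(p <- L) p.2
  & forall p, p \in L -> semiinv torus_action p.1 p.2.
Proof. exact: torus_weights torus_actionM torus_action1 torus_action_rational a. Qed.

End TorusSubgroup.

(** * Prescribing the values of characters *)

Section DiagonalForm.
Context {k : closedFieldType}.

Lemma exists_root (a : k) N : (0 < N)%N -> exists b, b ^+ N = a.
Proof.
move=> N0; have [b bE] := solve_monicpoly (fun i => if i == 0%N then a else 0) N0.
exists b; rewrite bE; case: N N0 {bE} => // N _.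
by rewrite big_ord_recl /= expr0 mulr1 big1 ?addr0 // => i _; rewrite mul0r.
Qed.

Lemma expfz_prod (I : Type) (s : seq I) (F : I -> k) (z : int) :
  (\prod_(i <- s) F i) ^ z = \prod_(i <- s) F i ^ z.
Proof. by apply: (big_morph (fun x => x ^ z)) => [x y|]; rewrite ?expfzMl ?exp1rz. Qed.

Lemma expfz_sum (I : Type) (s : seq I) (x : k) (F : I -> int) : x != 0 ->
  x ^ (\sum_(i <- s) F i) = \prod_(i <- s) x ^ F i.
Proof. by move=> x0; apply: (big_morph (fun z => x ^ z)) => [y z|]; rewrite ?expfzDr ?expr0z. Qed.

Lemma torus_char_exp r (e : 'I_r -> k) (chi : 'rV[int]_r) p (f : 'I_p -> k) (M : 'M[int]_(r, p)) :
  (forall j, f j != 0) ->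
  torus_char chi (fun i => \prod_j f j ^ M i j) = \prod_j f j ^ ((chi *m M) 0 j).
Proof.
move=> f0; rewrite /torus_char; under eq_bigr do rewrite expfz_prod.
rewrite exchange_big; apply: eq_bigr => j _; rewrite mxE expfz_sum //.
by apply: eq_bigr => i _; rewrite exprz_exp mulrC.
Qed.

(* Prescribed values of r independent characters: extract roots of order
   det B and use the adjugate of the exponent matrix B. *)
Lemma torus_char_onto r (B : 'M[int]_r) (d : 'I_r -> k) : \det B != 0 ->
  (forall j, d j != 0) ->
  exists2 t, torus_pt t & forall j, torus_char (row j B) t = d j.
Proof.
move=> B0 d0; have [|e eE] := @choice _ _ (fun j (c : k) => c != 0 /\ c ^ (\det B) = d j) => [j|].
  have N0 : (0 < `|\det B|)%N by rewrite absz_gt0.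
  have [b bE] := exists_root (d j) N0.
  have b0 : b != 0 by apply: contraNneq (d0 j) => b0; rewrite -bE b0 expr0n -leqn0 leqNgt N0.
  have [p|m] : (exists m : nat, \det B = m%:Z) + (exists m : nat, \det B = - m%:Z).
    by case: (\det B) => m; [left; exists m|right; exists m.+1; rewrite NegzE].
  - by exists b; split=> //; move: bE; case: p => m ->; rewrite absz_nat.
  - exists b^-1; split; first by rewrite invr_eq0.
    by move: bE; case: m => m ->; rewrite abszN absz_nat exprz_inv opprK.
exists (fun i => \prod_j e j ^ (\adj B) i j).
  by move=> i; apply/prodf_neq0 => j _; rewrite expfz_neq0 //; have [] := eE j.
move=> j; rewrite torus_char_exp // => [|i]; last by have [] := eE i.
rewrite -row_mul mul_mx_adj (bigD1 j) //= mxE mxE eqxx mulr1n big1 ?mulr1.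
  by have [] := eE j.
by move=> i ij; rewrite !mxE eq_sym (negPf ij) mulr0n expr0z.
Qed.

Lemma Jac_diag n (d : polyAut k n) (t : 'I_n -> k) :
  (forall i, polyAut_coord d i = t i *: 'X_i) -> Jac d = (\prod_i t i)%:MP.
Proof.
move=> dE; rewrite JacE (@jac_lin k n (diag_mx (\row_i t i))) => [|i].
  by congr (_%:MP); rewrite det_diag; apply: eq_bigr => i _; rewrite mxE.
rewrite tnth_aut_tuple dE (bigD1 i) //= !mxE eqxx mulr1n big1 ?addr0 // => j ji.
by rewrite !mxE eq_sym (negPf ji) mulr0n scale0r.
Qed.

End DiagonalForm.

(** * Conjugation of the torus onto the diagonal one *)

Section TorusConjugacy.
Context {k : closedFieldType} {r : nat}.
Hypothesis char0 : [pchar k] =i pred0.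
Local Notation A := {mpoly k[r.+1]}.

(** The points with coordinates powers of 2 form a copy of the lattice of one-parameter subgroups; a
    character is 1 there only where the pairing is 0. *)
Lemma two_power_char (chi lam : 'rV[int]_r) :
  torus_char chi (fun i => (2%:R : k) ^ lam 0 i) = 2%:R ^ (\sum_i chi 0 i * lam 0 i).
Proof.
rewrite expfz_sum ?nat2_neq0 //; apply: eq_bigr => i _.
by rewrite exprz_exp mulrC.
Qed.

Lemma torus_subgroup_conj (H : set (polyAut k r.+1)) : is_torus_subgroup r H ->
  H `<=` AutS k r.+1 -> exists2 y, AutS k r.+1 y & H = conj_set y (diagTS k r.+1).
Proof.
move=> [G [phi [[f [[fm [f' f'm [fK f'K]]] fM]] phi_alg phi_inj ->]]] HS.
pose g := @torus_elt k r G f'; pose T := torus_action phi f'.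
have gmor t u := @torus_eltM k r G f f' fK f'K fM t u.
have weights a := torus_action_weights char0 f'm fK f'K fM phi_alg a.
have T_jac t : torus_pt t -> jac (tnth (T t)) = 1.
  by move=> _; rewrite /T /torus_action -JacE; apply: HS; exists (g t).
have trivial t : torus_pt t -> phi (g t) = 1%g -> forall i, t i = 1.
  move=> t0; rewrite -(multiplicative1 phi) => /phi_inj g1 i.
  rewrite -(torus_elt_val f'K i t0) -/(g t) g1 -(torus_elt1 fK f'K fM).
  by rewrite torus_elt_val // => j; exact: oner_neq0.
have pow2_pt (lam : 'rV[int]_r) : torus_pt (fun i => (2%:R : k) ^ lam 0 i).
  by move=> i; rewrite expfz_neq0 // nat2_neq0.
have pow2_trivial (lam : 'rV[int]_r) :
    phi (g (fun i => 2%:R ^ lam 0 i)) = 1%g -> lam = 0.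
  move=> h; apply/rowP => i; rewrite mxE.
  exact: (expz2_eq1 char0 (trivial _ (pow2_pt lam) h i)).
have [L hL] := choice (fun l : 'I_r.+1 => let: ex_intro2 L h1 h2 := weights 'X_l in
  ex_intro (fun L => 'X_l = \sum_(p <- L) p.2 /\ forall p, p \in L -> semiinv T p.1 p.2) L (conj h1 h2)).
(* All weights that occur in the coordinates; passing to [seq_sub s] makes the indexing by weights
   injective. *)
pose s := flatten [seq [seq p.1 | p <- L l] | l <- enum 'I_r.+1].
pose x l (j : seq_sub s) := \sum_(p <- L l | p.1 == val j) p.2.
have x_sum l : 'X_l = \sum_j x l j.
  have [-> _] := hL l; rewrite /x (exchange_big_dep xpredT) //= big_seq [RHS]big_seq.
  apply: eq_bigr => p pL; have ps : p.1 \in s.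
    by apply/flatten_mapP; exists l; [rewrite mem_enum|exact: (map_f fst)].
  by rewrite (big_pred1 (SeqSub ps)) // => j; rewrite /= eq_sym.
have x_semi l (j : seq_sub s) : semiinv T (val j) (x l j).
  rewrite /x big_seq_cond; apply: semiinv_sum => p /andP[pL /eqP <-].
  by have [_] := hL l; apply.
have faithful (lam : 'rV[int]_r) : lam != 0 ->
    exists l (j : seq_sub s), x l j != 0 /\ \sum_i val j 0 i * lam 0 i != 0.
  move=> lam0; apply: contrapT => h; case/negP: lam0; apply/eqP/pow2_trivial.
  apply: polyAut_inj => l; rewrite polyAut_coord1 -comp_X_aut -/(torus_action _ _ _) -/T.
  rewrite x_sum raddf_sum /=; apply: eq_bigr => j _.
  rewrite x_semi // two_power_char; have [->|xj] := eqVneq (x l j) 0; first by rewrite scaler0.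
  have [->|e] := eqVneq (\sum_i val j 0 i * lam 0 i) 0; first by rewrite expr0z scale1r.
  by case: h; exists l, j.
have [y Sy hy] := torus_linearization char0 T_jac val_inj x_semi x_sum faithful.
have [psi psiE] := choice hy; exists y^-1%g; first exact: AutSV.
have conjE t m : torus_pt t ->
    polyAut_coord (y * phi (g t) / y)%g m = torus_char (psi m) t *: 'X_m.
  move=> t0; rewrite polyAut_coordM polyAut_coordM (psiE m t t0) comp_mpolyZ.
  by rewrite -polyAut_coordM mulgV polyAut_coord1.
(* The Jacobian 1 of [y] is both invariant and semi-invariant of weight the sum of the [psi m]. *)
have psi_sum : \sum_m psi m = 0.
  have h : semiinv T (\sum_m psi m) 1.
    by have := semiinv_jac T_jac psiE; rewrite -[jac _]/(Jac y) Sy.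
  exact: (semiinv_inj char0 (oner_neq0 _) h (semiinv1 T)).
have prod_psi (t : 'I_r -> k) : torus_pt t -> \prod_m torus_char (psi m) t = 1.
  move=> t0; rewrite -[RHS](torus_char0 t) -psi_sum; apply/esym.
  by apply: (big_morph (torus_char^~ t)) => [a b|]; [exact: torus_charD|exact: torus_char0].
have toD t : torus_pt t -> diagTS k r.+1 (y * phi (g t) / y)%g.
  move=> t0; split; last by apply: AutSJ Sy (HS _ _); exists (g t).
  by exists (fun m => torus_char (psi m) t) => m; rewrite torus_char_neq0 // conjE.
pose B : 'M[int]_r := \matrix_(i, j) psi (widen_ord (leqnSn r) i) 0 j.
have rowB i : row i B = psi (widen_ord (leqnSn r) i) by apply/rowP => j; rewrite !mxE.
(* An integral vector [v] orthogonal to the first [r] weights is orthogonal to the last one too, so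
   the point with coordinates [2 ^ v_i] acts trivially and [v = 0]. *)
have B0 : \det B != 0.
  rewrite -det_tr; apply/det0P => -[v v0 vB].
  have vpsi m : \sum_i psi m 0 i * v 0 i = 0.
    have h i : \sum_j psi (widen_ord (leqnSn r) i) 0 j * v 0 j = 0.
      have /rowP/(_ i) := vB; rewrite [LHS]mxE [RHS]mxE => vBi; rewrite -[RHS]vBi.
      by apply: eq_bigr => j _; rewrite !mxE mulrC.
    have [[j ->]//|->] := ord_widen_or_max m.
    move: psi_sum; rewrite big_ord_recr /= => /eqP; rewrite addrC addr_eq0 => /eqP ->.
    under eq_bigr do rewrite mxE summxE mulNr mulr_suml.
    by rewrite sumrN exchange_big big1 ?oppr0 // => j _; exact: h.
  case/negP: v0; apply/eqP/pow2_trivial; set u := phi _.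
  suff : (y * u / y)%g = 1%g by move/(canRL (mulgVK _)); rewrite mul1g => /(canRL (mulKg _)); rewrite mulVg.
  apply: polyAut_inj => m; rewrite conjE // two_power_char vpsi expr0z scale1r.
  by rewrite polyAut_coord1.
apply/seteqP; split=> [_ [h _ <-]|_ [h [[d dE] Sd] <-]].
  have [t t0 <-] := torus_elt_surj fK h; exists (y * phi (g t) / y)%g; first exact: toD.
  by rewrite invgK !mulgA mulVg mul1g mulgVK.
have d0 i : d i != 0 by have [] := dE i.
(* This prescribes the first [r] diagonal entries; determinant 1 settles the last. *)
have [t' t'0 t'E] := torus_char_onto B0 (fun j => d0 (widen_ord (leqnSn r) j)).
exists (g t') => //; apply: (mulgI y); apply: (mulIg y^-1%g).
rewrite invgK !mulgA mulgV mul1g mulgK; apply: polyAut_inj => m.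
rewrite conjE //; have [_ ->] := dE m; congr (_ *: _).
have tw j : torus_char (psi (widen_ord (leqnSn r) j)) t' = d (widen_ord (leqnSn r) j).
  by rewrite -t'E rowB.
have [[j ->]//|->] := ord_widen_or_max m.
have := prod_psi t' t'0; rewrite big_ord_recr /=; under eq_bigr do rewrite tw.
have /esym/eqP := Jac_diag (fun i => proj2 (dE i)).
rewrite Sd -mpolyC1 -subr_eq0 -mpolyCB mpolyC_eq0 subr_eq0 big_ord_recr /= => /eqP d1 h1.
have P0 : \prod_(i < r) d (widen_ord (leqnSn r) i) != 0 by apply/prodf_neq0 => i _; exact: d0.
by apply: (mulfI P0); rewrite h1 d1.
Qed.

End TorusConjugacy.

(** * Identity components and normalizers *)

Section IdentityComponent.
Variable k : fieldType.

Lemma morphism_cst (X Y : funSpaceType k) (y : Y) : nice X -> is_morphism (fun _ : X => y).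
Proof.
move=> nX; split=> [x|x f _]; first exact: cst_continuous.
by apply: regular_near (regular_cst x (f y) nX); near=> z.
Unshelve. all: by end_near. Qed.

Variable G : algGroupType k.

Lemma nice_group : nice G. Proof. exact: nice_variety alg_is_variety. Qed.

Lemma translL_morphism (g : G) : is_morphism (fun x : G => (g * x)%g).
Proof.
have := morphism_pair nice_group (morphism_cst g nice_group) (morphism_id G).
by move=> h; exact: (morphism_comp h alg_mul_morphism).
Qed.

Lemma translR_morphism (g : G) : is_morphism (fun x : G => (x * g)%g).
Proof.
have := morphism_pair nice_group (morphism_id G) (morphism_cst g nice_group).
by move=> h; exact: (morphism_comp h alg_mul_morphism).
Qed.

Lemma connected_image (X Y : topologicalType) (f : X -> Y) (A : set X) :
  continuous f -> connected A -> connected (f @` A).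
Proof.
by move=> cf cA; apply: connected_continuous_connected => //; exact: continuous_subspaceT.
Qed.

Local Notation G0 := (connected_component setT (1%g : G)).

Lemma connected_in_component (A : set G) a : connected A -> A a ->
  forall x, A x -> G0 (a^-1 * x)%g.
Proof.
move=> cA Aa x Ax.
have cA' : connected ((fun y => (a^-1 * y)%g) @` A).
  by apply: connected_image cA; have [] := translL_morphism a^-1%g.
have A1 : ((fun y => (a^-1 * y)%g) @` A) 1%g by exists a; rewrite // mulVg.
by apply: (connected_component_max A1 (@subsetT _ _) cA'); exists x.
Qed.

Lemma component_conj (g x : G) : G0 x -> G0 (g * x / g)%g.
Proof.
move=> Gx; pose c y := (g * y / g)%g.
have c1 : (c @` G0) 1%g.
  by exists 1%g; [exact: connected_component_refl|rewrite /c mulg1 mulgV].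
have cc : connected (c @` G0).
  apply: connected_image; last exact: component_connected.
  by have [] := morphism_comp (translL_morphism g) (translR_morphism g^-1%g).
by apply: (connected_component_max c1 (@subsetT _ _) cc); exists x.
Qed.

End IdentityComponent.

Lemma identity_component_normal (k : fieldType) n (H H0 : set (polyAut k n)) h x :
  is_identity_component H H0 -> H h -> H0 x -> H0 (h * x / h)%g.
Proof.
move=> [G [phi [_ -> ->]]] [g _ <-] [y Gy <-]; exists (g * y / g)%g; first exact: component_conj.
by rewrite !gmulfM multiplicativeV.
Qed.

(** * Containment in conjugates of the monomial group *)

Section Maximality.
Context {k : closedFieldType}.
Hypothesis char0 : [pchar k] =i pred0.

Lemma conj_setK n (g : polyAut k n) (S : set (polyAut k n)) h :
  conj_set g S h <-> S (g^-1 * h * g)%g.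
Proof.
split=> [[x Sx <-]|Sh]; first by rewrite !mulgA mulVg mul1g mulgVK.
by exists (g^-1 * h * g)%g => //; rewrite !mulgA mulgV mul1g mulgK.
Qed.

(** The index [r.+2] expresses dimension at least 2, where [normalizer_monomial] is available. *)
Lemma torus_by_finite_monomial r (H H0 : set (polyAut k r.+2)) :
  H `<=` AutS k r.+2 -> is_identity_component H H0 -> is_torus_subgroup r.+1 H0 ->
  exists2 g, AutS k r.+2 g & H `<=` conj_set g (@monoS k r.+2).
Proof.
move=> HS idH torH.
have H0H : H0 `<=` H.
  by move: idH => [G [phi [_ -> ->]]] _ [x _ <-]; exists x.
have [g Sg H0E] := torus_subgroup_conj char0 torH (subset_trans H0H HS).
exists g => // h Hh; apply/conj_setK; split; last exact: (AutSJV Sg (HS h Hh)).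
apply: normalizer_monomial => // d Dd.
have : H0 (g * d / g)%g by rewrite H0E; exists d.
move/(identity_component_normal idH Hh); rewrite H0E => /conj_setK[].
by rewrite !invgM !invgK !mulgA.
Qed.

(** Roots are chosen freely for all entries but the last, which is the inverse of their product; its
    N-th power is correct because the entries of [d] have product 1. *)
Lemma diagTS_root r (d : polyAut k r.+1) N : (0 < N)%N -> diagTS k r.+1 d ->
  exists2 e, diagTS k r.+1 e & (e ^+ N)%g = d.
Proof.
move=> N0 [[t dE] Sd].
have t0 i : t i != 0 by have [] := dE i.
have [e eE] := choice (fun i => exists_root (t i) N0).
have e0 i : e i != 0.
  by apply: contraNneq (t0 i) => ei; rewrite -eE ei expr0n -leqn0 leqNgt N0.
pose P := \prod_(i < r) e (widen_ord (leqnSn r) i).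
have P0 : P != 0 by apply/prodf_neq0 => i _; exact: e0.
pose u i := if unlift ord_max i is Some j then e (widen_ord (leqnSn r) j) else P^-1.
have u0 i : u i != 0 by rewrite /u; case: unlift => [j|]; rewrite ?invr_eq0.
have uw j : u (widen_ord (leqnSn r) j) = e (widen_ord (leqnSn r) j).
  have wl : widen_ord (leqnSn r) j = lift ord_max j.
    by apply: val_inj; rewrite /= /bump leqNgt ltn_ord.
  by rewrite /u {1}wl liftK.
have um : u ord_max = P^-1 by rewrite /u unlift_none.
have tprod : \prod_i t i = 1.
  have /esym/eqP := Jac_diag (fun i => proj2 (dE i)).
  by rewrite Sd -mpolyC1 -subr_eq0 -mpolyCB mpolyC_eq0 subr_eq0 => /eqP.
exists (diag_aut u0).
  split; first by exists u => i; rewrite diag_autE.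
  rewrite /AutS /= (Jac_diag (diag_autE u0)) big_ord_recr /= um.
  by under eq_bigr do rewrite uw; rewrite mulfV.
have powE j i : polyAut_coord (diag_aut u0 ^+ j)%g i = u i ^+ j *: 'X_i.
  elim: j i => [|j IH] i; first by rewrite expg0 polyAut_coord1 expr0 scale1r.
  by rewrite expgS polyAut_coordM diag_autE comp_mpolyZ comp_X_aut IH scalerA exprS.
apply: polyAut_inj => i; rewrite powE; have [_ ->] := dE i; congr (_ *: _).
have [[j ->]|->] := ord_widen_or_max i; first by rewrite uw eE.
rewrite um exprVn /P -prodrXl; under eq_bigr do rewrite eE.
have Q0 : \prod_(j < r) t (widen_ord (leqnSn r) j) != 0 by apply/prodf_neq0 => j _.
by apply: (mulfI Q0); rewrite mulfV // -[LHS]tprod big_ord_recr //=.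
Qed.

Lemma monomial_power n (m : polyAut k n) : monomial_aut m -> diagT k n (m ^+ #|'S_n|)%g.
Proof.
move=> [s [c mE]].
have powE j : exists c', forall i, c' i != 0 /\ polyAut_coord (m ^+ j)%g i = c' i *: 'X_((s ^+ j)%g i).
  elim: j => [|j [c' IH]].
    by exists (fun=> 1) => i; rewrite oner_neq0 expg0 polyAut_coord1 scale1r perm1.
  exists (fun i => c i * c' (s i)) => i.
  have [ci mi] := mE i; have [ci' mi'] := IH (s i); split; first by rewrite mulf_neq0.
  by rewrite expgS polyAut_coordM mi comp_mpolyZ comp_X_aut mi' scalerA expgS permM.
have [c' c'E] := powE #|'S_n|; exists c' => i; have [c0 ->] := c'E i; split=> //.
have -> : (s ^+ #|'S_n|)%g = 1%g; last by rewrite perm1.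
by rewrite -cardsT; apply: (@cyclic.expg_cardG _ (fingroup.setT_group _) s); rewrite inE.
Qed.

Lemma monoS_maximal_conj r (g : polyAut k r.+2) : AutS k r.+2 g ->
  @monoS k r.+2 `<=` conj_set g (@monoS k r.+2) -> monomial_aut g.
Proof.
move=> Sg sub; rewrite -[g]invgK; apply: monomial_autV; apply: normalizer_monomial => // d Dd.
have N0 : (0 < #|'S_r.+2|)%N by apply/card_gt0P; exists 1%g.
have [e De <-] := diagTS_root N0 Dd.
have /sub/conj_setK[me _] : @monoS k r.+2 e.
  by case: De => De Se; split=> //; exact: diagT_monomial.
have := monomial_power me; congr (diagT _ _ _); rewrite invgK.
by elim: #|_| => [|N IH]; rewrite ?expg0 ?mulg1 ?mulVg // !expgS IH !mulgA mulgK.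
Qed.

Lemma monoS_conj n (g : polyAut k n) : monomial_aut g -> AutS k n g ->
  conj_set g (@monoS k n) = @monoS k n.
Proof.
move=> mg Sg; apply: conj_set_subset => x [mx Sx]; split.
- exact: (monomial_autM (monomial_autM mg mx) (monomial_autV mg)).
- exact: AutSJ.
- exact: (monomial_autM (monomial_autM (monomial_autV mg) mx) mg).
- exact: AutSJV.
Qed.

End Maximality.

Lemma conj_mul (G : groupType) (g a b : G) : (g * (a * b) / g = (g * a / g) * (g * b / g))%g.
Proof. by rewrite !mulgA mulgVK. Qed.

(** * Conjugates of algebraic subgroups *)

Section Conjugation.
Variables (k : fieldType) (n : nat).

Lemma polyAut_act_morphism (g : polyAut k n) :
  is_morphism (polyAut_act g : affine k n -> affine k n).
Proof.
have na := @nice_affine k n; apply: morphism_to_affine => // x j.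
have := @regular_poly _ _ x _ (polyAut_coord g j) (fun i y => (y : affine k n) i) na (regular_coord x).
by apply: regular_near; near=> y; rewrite ffunE.
Unshelve. all: by end_near. Qed.

Variables (g : polyAut k n) (G : algGroupType k) (phi : {multiplicative G -> polyAut k n}).

Definition conj_hom (x : G) : polyAut k n := (g * phi x / g)%g.

Fact conj_hom_mul : {morph conj_hom : x y / (x * y)%g}.
Proof.
by move=> x y; rewrite /conj_hom gmulfM; exact: conj_mul.
Qed.

HB.instance Definition _ := isMultiplicative.Build G (polyAut k n) conj_hom conj_hom_mul.

Lemma conj_hom_algebraic : is_algebraic_hom phi -> is_algebraic_hom conj_hom.
Proof.
move=> hphi; have nG := @nice_group k G; have na := @nice_affine k n.
have h1 := morphism_vprod nG na (@morphism_id k G) (polyAut_act_morphism g^-1%g).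
have := morphism_comp (morphism_comp h1 hphi) (polyAut_act_morphism g).
by congr is_morphism; apply: funext => z /=; rewrite -!polyAut_actM.
Qed.

Lemma conj_hom_image (C : set G) : conj_set g (phi @` C) = conj_hom @` C.
Proof.
apply/seteqP; split=> [_ [_ [x Cx <-] <-]|_ [x Cx <-]]; first by exists x.
by exists (phi x) => //; exists x.
Qed.

End Conjugation.

Section ConjugateSubgroups.
Variables (k : fieldType) (n : nat) (g : polyAut k n).

Lemma conj_is_algebraic H : is_algebraic H -> is_algebraic (conj_set g H).
Proof.
move=> [G [phi [hphi ->]]]; exists G, (conj_hom g phi); split.
  exact: conj_hom_algebraic.
exact: conj_hom_image.
Qed.

Lemma conj_identity_component H H0 : is_identity_component H H0 ->
  is_identity_component (conj_set g H) (conj_set g H0).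
Proof.
move=> [G [phi [hphi -> ->]]]; exists G, (conj_hom g phi); split; try exact: conj_hom_image.
exact: conj_hom_algebraic.
Qed.

Lemma conj_torus_subgroup r H : is_torus_subgroup r H -> is_torus_subgroup r (conj_set g H).
Proof.
move=> [G [phi [tG hphi phi_inj ->]]]; exists G, (conj_hom g phi); split.
- exact: tG.
- exact: conj_hom_algebraic.
- by move=> x y /mulIg /mulgI /phi_inj.
- exact: conj_hom_image.
Qed.

End ConjugateSubgroups.

(** * Finiteness of the set of components *)

Section ChainCondition.

(** Each index is taken where the values on the tail after the previous index attain their
    minimum. *)
Lemma nat_nondecreasing_subsequence (u : nat -> nat) :
  exists2 s : nat -> nat, {homo s : i j / (i < j)%N} & {homo u \o s : i j / (i <= j)%N}.
Proof.
have tail_min N : exists i, (N <= i)%N /\ forall j, (N <= j)%N -> (u i <= u j)%N.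
  have [P PE] : exists P : pred nat, forall v, P v <-> exists2 i, (N <= i)%N & u i = v.
    by exists (fun v => `[< exists2 i, (N <= i)%N & u i = v >]) => v; split=> /asboolP.
  have exP : exists v, P v by exists (u N); apply/PE; exists N.
  case: (ex_minnP exP) => v /PE[i Ni <-] vmin; exists i; split=> // j Nj.
  by apply: vmin; apply/PE; exists j.
have [m mP] := choice tail_min.
pose s := fix s i := if i is i'.+1 then m (s i').+1 else m 0%N.
have s_incr i : (s i < s i.+1)%N by have [] := mP (s i).+1.
have s_min i j : (s i <= j)%N -> (u (s i) <= u j)%N.
  case: i => [|i] /= h; first by have [_] := mP 0%N; apply.
  have [h1 h2] := mP (s i).+1; apply: h2; exact: leq_trans h1 h.
have s_homo : {homo s : i j / (i < j)%N} by apply: homo_ltn s_incr; exact: ltn_trans.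
exists s => // i j ij /=; apply: s_min; rewrite leq_eqVlt in ij.
by case/predU1P: ij => [->//|/s_homo/ltnW].
Qed.

Lemma dickson_subsequence m (u : nat -> 'X_{1..m}) (J : seq 'I_m) :
  exists2 s : nat -> nat, {homo s : i j / (i < j)%N}
  & forall l, l \in J -> {homo (fun i => u (s i) l) : i j / (i <= j)%N}.
Proof.
elim: J => [|l J [s sh hs]]; first by exists id.
have [s' sh' hs'] := nat_nondecreasing_subsequence (fun i => u (s i) l).
exists (s \o s') => [i j /sh' /sh //|l']; rewrite inE => /predU1P[->|l'J i j ij]; first exact: hs'.
apply: (hs l' l'J); rewrite leq_eqVlt in ij.
by case/predU1P: ij => [->//|/sh'/ltnW].
Qed.

Lemma dickson m (u : nat -> 'X_{1..m}) : exists i j, (i < j)%N /\ (u i <= u j)%MM.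
Proof.
have [s sh hs] := dickson_subsequence u (enum 'I_m).
exists (s 0%N), (s 1%N); split; first exact: sh.
by apply/mnm_lepP => l; apply: (hs l) => //; rewrite mem_enum.
Qed.

(* Hilbert's basis theorem as an ascending chain condition: pick f_i in the
   (i+1)-st ideal outside the i-th with least leading monomial.  By Dickson's
   lemma some earlier leading monomial divides a later one, and subtracting a
   multiple of the earlier polynomial contradicts minimality. *)
Lemma no_ascending_ideals (k : fieldType) m (I : nat -> set {mpoly k[m]}) :
  (forall i, I i 0) -> (forall i a b, I i a -> I i b -> I i (a - b)) ->
  (forall i a b, I i a -> I i (b * a)) ->
  (forall i, I i `<=` I i.+1) -> ~ forall i, exists2 a, I i.+1 a & ~ I i a.
Proof.
move=> I0 IB IM Iincr strict.
have mono i j : (i <= j)%N -> I i `<=` I j.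
  by elim: j => [|j IH]; [rewrite leqn0 => /eqP ->|rewrite leq_eqVlt => /predU1P[->//|/IH h x /h /Iincr]].
have least i : exists f, [/\ I i.+1 f, ~ I i f &
    forall g, I i.+1 g -> ~ I i g -> ~~ (mlead g < mlead f)%O].
  have [f If nIf] := strict i.
  move: {2}(mlead f) (erefl (mlead f)) => x.
  elim/(well_founded_ind (@ltom_wf m)): x f If nIf => x IH f If nIf xE.
  have [h|/existsNP[g /not_implyP[Ig /not_implyP[nIg /negP]]]] :=
    pselect (forall g, I i.+1 g -> ~ I i g -> ~~ (mlead g < mlead f)%O); first by exists f.
  by by rewrite negbK xE => gx; exact: (IH (mlead g) gx g Ig nIg erefl).
have [f fP] := choice least.
have [i [j [ij dv]]] := dickson (fun i => mlead (f i)).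
have [Ifj nIfj minj] := fP j; have [Ifi nIfi _] := fP i.
have fi0 : mleadc (f i) != 0.
  by rewrite mleadc_eq0; apply: contra_notN nIfi => /eqP ->.
pose d := (mlead (f j) - mlead (f i))%MM; pose c := mleadc (f j) / mleadc (f i).
have dE : (d + mlead (f i))%MM = mlead (f j) by rewrite submK.
pose h := c *: (f i * 'X_[d]).
have Ih : I j h by rewrite /h mulrC scalerAl; apply: IM; apply: (mono i.+1).
have Ig : I j.+1 (f j - h) by apply: IB => //; exact: Iincr.
have nIg : ~ I j (f j - h).
  move=> Ig'; apply: nIfj; rewrite -(subrK h (f j)) -[X in _ + X]opprK; apply: IB => //.
  by rewrite -mulN1r; exact: IM.
have hl : (mlead h <= mlead (f j))%O.
  apply: Order.POrderTheory.le_trans (mleadZ_le _ _) _.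
  by rewrite -dE addmC; have := mleadM_le (f i) 'X_[d]; rewrite mleadXm.
have hc : h@_(mlead (f j)) = mleadc (f j).
  by rewrite /h mcoeffZ -{1}dE mcoeffMX /c divfK.
have gc : (f j - h)@_(mlead (f j)) = 0 by rewrite mcoeffB hc subrr.
have gl : (mlead (f j - h) <= mlead (f j))%O.
  by apply: Order.POrderTheory.le_trans (mleadB_le _ _) _; rewrite Order.JoinTheory.leUx Order.POrderTheory.lexx.
move: (minj _ Ig nIg); rewrite Order.POrderTheory.lt_neqAle gl andbT negbK => /eqP ge.
apply: nIg; suff /eqP -> : f j - h == 0 by [].
by rewrite -mleadc_eq0 ge gc.
Qed.

End ChainCondition.

Section NoetherianComponents.
Variable k : fieldType.

(** The vanishing ideals of a strictly descending chain ascend strictly: a point outside a closed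
    set has a neighbourhood given by one polynomial that misses the set, and this polynomial
    separates the ideals. *)
Lemma no_descending_closed m (C : nat -> set (affine k m)) : (forall i, closed (C i)) ->
  (forall i, C i.+1 `<=` C i) -> ~ forall i, exists2 x, C i x & ~ C i.+1 x.
Proof.
move=> cC Csub strict.
apply: (@no_ascending_ideals k m (fun i => [set p | forall x : affine k m, C i x -> p.@[x] = 0])) => /=.
- by move=> i x _; rewrite meval0.
- by move=> i a b ha hb x Cx; rewrite mevalB ha // hb // subrr.
- by move=> i a b ha x Cx; rewrite mevalM ha // mulr0.
- by move=> i a ha x /Csub; exact: ha.
move=> i; have [x Cx nCx] := strict i.
have : nbhs x (~` C i.+1) by apply: open_nbhs_nbhs; split=> //; exact: closed_openC.
move=> /nbhs_affineP[p px pC]; exists p.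
  by move=> y Cy; apply/eqP; apply: contraT => /pC.
by move=> /(_ x Cx) /eqP; rewrite (negPf px).
Qed.

Lemma minimal_closed m (P : set (set (affine k m))) C0 : (forall C, P C -> closed C) -> P C0 ->
  exists2 C, P C & forall D, P D -> D `<=` C -> D = C.
Proof.
move=> Pc PC0; apply: contrapT => nomin.
have step (C : {C | P C}) : exists D : {D | P D}, sval D `<=` sval C /\ sval D <> sval C.
  case: C => C PC /=; apply: contrapT => h; apply: nomin; exists C => // D PD DC.
  by apply: contrapT => nDC; apply: h; exists (exist _ D PD).
have [f fP] := choice step.
pose s i := sval (iter i f (exist _ C0 PC0)).
apply: (@no_descending_closed m s) => [i|i|i].
- by apply: Pc; exact: svalP.
- by have [] := fP (iter i f (exist _ C0 PC0)).
have [sub neq] := fP (iter i f (exist _ C0 PC0)).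
apply: contrapT => h; apply: neq; apply/seteqP; split=> // x sx.
by apply: contrapT => nsx; apply: h; exists x.
Qed.

Lemma closed_val_image (X : topologicalType) (Z : set X) (K : set (set_type Z)) :
  closed Z -> closed K -> closed (val @` K).
Proof.
move=> cZ cK; have [C oC CK] := closed_openC cK.
rewrite (_ : val @` K = Z `&` ~` C); first by apply: closedI => //; exact: open_closedC.
have CE (z : set_type Z) : C (val z) <-> ~ K z by rewrite -[~ K z]/((~` K) z) -CK.
apply/seteqP; split=> [_ [z Kz <-]|x [Zx nCx]].
  by split; [exact: set_mem (valP z)|move/CE].
exists (exist _ x (mem_set Zx)) => //; apply: contrapT => nK; apply: nCx.
exact: (CE (exist _ x (mem_set Zx))).2.
Qed.

(* A closed set minimal among those on which F takes infinitely many values is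
   irreducible, hence connected. *)
Lemma finite_range_connected (X : funSpaceType k) (T : Type) (F : X -> T) : is_variety X ->
  (forall A a b, connected A -> A a -> A b -> F a = F b) -> finite_set (range F).
Proof.
move=> [[r [U [oU aU cU]]] _] Fc.
suff fU i : finite_set (F @` U i).
  apply: (@sub_finite_set _ _ (\bigcup_(i in [set: 'I_r]) (F @` U i))).
    move=> _ [x _ <-]; have [i _ Ux] : (\bigcup_i U i) x by rewrite cU.
    by exists i => //; exists x.
  by apply: bigcup_finite => // i _; exact: fU.
have [m [Z [h [cZ [_ [h' [ch' _] [hK _]]]]]]] := aU i.
pose e (z : set_type Z) : X := val (h' z).
have ce : continuous e by move=> z; exact: (continuous_comp (ch' z) (@initial_continuous _ _ _ _)).
(* The part of the chart [U i] lying over [D] in its closed affine model. *)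
pose E (D : set (affine k m)) := e @` [set z | D (val z)].
pose P (D : set (affine k m)) := [/\ closed D, D `<=` Z & ~ finite_set (F @` E D)].
apply: contrapT => inf.
have PZ : P Z.
  split=> // fin; apply: inf; apply: sub_finite_set fin => _ [x Ux <-].
  exists x => //; exists (h (exist _ x (mem_set Ux))) => /=; first exact: set_mem (valP _).
  by rewrite /e hK.
have Pc C : P C -> closed C by case.
have [D [cD DZ infD] Dmin] := minimal_closed Pc PZ.
have cE : connected (E D).
  move=> B [b Bb] [O oO BO] [K cK BK].
  (* [D1] and [D2] are closed and cover [D], so one of them carries infinitely many values and
     equals [D] by minimality. In the first case [B] is all of [E D], in the second it is empty. *)
  pose D1 := D `&` val @` (e @^-1` K); pose D2 := D `&` val @` (e @^-1` ~` O).
  have cpre (S : set X) : closed S -> closed (D `&` val @` (e @^-1` S)).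
    by move=> cS; apply: closedI => //; apply: closed_val_image => //; exact: closed_comp.
  have [fin1|inf1] := pselect (finite_set (F @` E D1)); last first.
    have D1D : D1 = D.
      by apply: Dmin; [split=> //; [exact: cpre|move=> x [/DZ]]|move=> x []].
    rewrite BK; apply/seteqP; split=> [x []//|_ [z Dz <-]]; split; first by exists z.
    have D1z : D1 (val z) by rewrite D1D.
    by case: D1z => _ [z' Kz' /val_inj <-].
  have D2D : D2 = D.
    apply: Dmin; last by move=> x [].
    split; [by apply: cpre; exact: open_closedC|by move=> x [/DZ]|move=> fin2].
    apply: infD; apply: sub_finite_set (_ : finite_set (F @` E D1 `|` F @` E D2)).
      move=> _ [_ [z Dz <-] <-]; have [Oz|nOz] := pselect (O (e z)).
        left; exists (e z) => //; exists z => //; split=> //; exists z => //=.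
        have EK : (E D `&` K) (e z) by rewrite -BK BO; split=> //; exists z.
        by case: EK.
      by right; exists (e z) => //; exists z => //; split=> //; exists z.
    by rewrite finite_setU.
  exfalso; move: Bb; rewrite BO => -[[z Dz <-] Oz].
  have D2z : D2 (val z) by rewrite D2D.
  by case: D2z => _ [z' Oz' /val_inj zz']; apply: Oz'; rewrite zz'.
apply: infD; have [[z Dz]|noz] := pselect (exists z : set_type Z, D (val z)).
  apply: (@sub_finite_set _ _ [set F (e z)]); last exact: finite_set1.
  by move=> _ [x Ex <-] /=; apply: (Fc _ _ _ cE Ex); exists z.
apply: (@sub_finite_set _ _ set0); last exact: finite_set0.
by move=> y [x [z Dz _] _]; apply: noz; exists z.
Qed.

End NoetherianComponents.

(** * Translations of the affine line *)

Section AffineLine.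
Variable k : closedFieldType.
Hypothesis char0 : [pchar k] =i pred0.

Lemma AutS1_translation (h : polyAut k 1) : AutS k 1 h ->
  exists c, polyAut_coord h ord0 = 'X_ord0 + c%:MP.
Proof.
rewrite /AutS /= /Jac det_mx11 mxE => dh.
have p0 i : (polyAut_coord h ord0 - 'X_ord0)^`M(i) = 0.
  by rewrite ord1 mderivB dh mderivX mnm1E eqxx submmm mpolyX0 scale1r subrr.
exists ((polyAut_coord h ord0 - 'X_ord0)@_0%MM).
by rewrite -(mpoly_const_mderiv0 char0 p0) addrC subrK.
Qed.

Lemma torus_by_finite_line (H H0 : set (polyAut k 1)) : H `<=` AutS k 1 ->
  is_identity_component H H0 -> is_torus_subgroup 0 H0 -> H `<=` [set 1%g].
Proof.
move=> HS [G [phi [_ HE H0E]]] [G' [psi [[f [[_ [f' _ [fK _]]] _]] _ _ H0E']]].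
have H01 h : H0 h -> h = 1%g.
  rewrite H0E' => -[x _ <-]; rewrite -(multiplicative1 psi); congr (psi _).
  by rewrite -[x]fK -[RHS]fK; congr f'; apply/val_inj/ffunP => -[].
(* [phi] is trivial on the identity component, hence constant on every connected set. *)
have fin : finite_set (range phi).
  apply: finite_range_connected; first exact: alg_is_variety.
  move=> A a b cA Aa Ab; have Gab := connected_in_component cA Aa Ab.
  have : phi (a^-1 * b)%g = 1%g by apply: H01; rewrite H0E; exists (a^-1 * b)%g.
  rewrite gmulfM multiplicativeV => e; apply: (mulgI (phi a)^-1%g).
  by rewrite mulVg e.
move=> h Hh; have [c hE] := AutS1_translation (HS h Hh).
have powE j : polyAut_coord (h ^+ j)%g ord0 = 'X_ord0 + (c *+ j)%:MP.
  elim: j => [|j IH]; first by rewrite expg0 polyAut_coord1 mulr0n mpolyC0 addr0.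
  by rewrite expgS polyAut_coordM hE comp_mpolyD comp_X_aut comp_mpolyC IH -addrA -mpolyCD mulrSr.
have [c0|c0] := eqVneq c 0.
  by apply: polyAut_inj => i; rewrite ord1 hE c0 mpolyC0 addr0 polyAut_coord1.
pose w j := (h ^+ j)%g.
have w_inj : injective w.
  move=> i j ij; have := powE i; rewrite -/(w i) ij powE => /addrI/eqP.
  rewrite -subr_eq0 -mpolyCB mpolyC_eq0 -![c *+ _]mulr_natr -mulrBr mulf_eq0 (negPf c0) /= subr_eq0.
  wlog le_ij : i j {ij} / (j <= i)%N => [W|].
    by case/orP: (leq_total j i) => [/W//|/W h1]; rewrite eq_sym => /h1.
  rewrite eq_sym -subr_eq0 -natrB // natr_eq0 // subn_eq0 => le_ji.
  by apply/eqP; rewrite eqn_leq le_ij andbT.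
(* A left inverse of [w], with value 0 off its range, would exhibit the natural numbers inside the
   image of a finite set. *)
have [|g gP] := @choice _ _ (fun x j => range w x -> w j = x) => [x|].
  by have [[j _ <-]|nx] := pselect (range w x); [exists j|exists 0%N].
case: infinite_nat; apply: (@sub_finite_set _ _ (g @` range phi)); last exact: finite_image.
move=> j _; exists (w j); last by apply: w_inj; apply: gP; exists j.
move: Hh; rewrite HE /w => -[x _ <-].
elim: (j) => [|i [y _ IH]]; first by exists 1%g; rewrite // expg0 multiplicative1.
by exists (x * y)%g => //; rewrite gmulfM expgS IH.
Qed.

End AffineLine.

(** * Closed linear groups *)

Section RegularFunctions.
Variables (k : fieldType) (X : funSpaceType k) (nX : nice X).

Lemma regular_sum (I : Type) (s : seq I) (P : pred I) (f : I -> X -> k) x :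
  (forall i, P i -> regular_at x (f i)) -> regular_at x (fun y => \sum_(i <- s | P i) f i y).
Proof.
move=> hf; elim: s => [|i s IH].
  by apply: regular_near (regular_cst x 0 nX); near=> y; rewrite big_nil.
have [Pi|Pi] := boolP (P i).
  by apply: regular_near (regularD nX (hf i Pi) IH); near=> y; rewrite big_cons Pi.
by apply: regular_near IH; near=> y; rewrite big_cons (negPf Pi).
Unshelve. all: by end_near. Qed.

Lemma regular_prod (I : Type) (s : seq I) (f : I -> X -> k) x :
  (forall i, regular_at x (f i)) -> regular_at x (fun y => \prod_(i <- s) f i y).
Proof.
move=> hf; elim: s => [|i s IH].
  by apply: regular_near (regular_cst x 1 nX); near=> y; rewrite big_nil.
by apply: regular_near (regularM nX (hf i) IH); near=> y; rewrite big_cons.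
Unshelve. all: by end_near. Qed.

Lemma regular_det m (M : X -> 'M[k]_m) x : (forall i j, regular_at x (fun y => M y i j)) ->
  regular_at x (fun y => \det (M y)).
Proof.
move=> hM; apply: regular_sum => s _; apply: regularM => //; first exact: regular_cst.
exact: regular_prod.
Qed.

Lemma regular_adj m (M : X -> 'M[k]_m) x i j : (forall i j, regular_at x (fun y => M y i j)) ->
  regular_at x (fun y => \adj (M y) i j).
Proof.
move=> hM.
have : regular_at x (fun y => (-1) ^+ (j + i) * \det (row' j (col' i (M y)))).
  apply: regularM => //; first exact: regular_cst.
  apply: regular_det => a b; apply: regular_near (hM (lift j a) (lift i b)).
  by near=> y; rewrite !mxE.
by apply: regular_near; near=> y; rewrite mxE.
Unshelve. all: by end_near. Qed.

Lemma closed_equations (I : Type) (f : I -> X -> k) :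
  (forall i x, regular_at x (f i)) -> closed [set x | forall i, f i x = 0].
Proof.
move=> hf; rewrite -openC openE => x /existsNP[i /eqP fx].
have := near_regular_neq0 nX (hf i x) fx; apply: filterS => y /eqP fy h.
exact: fy (h i).
Qed.

End RegularFunctions.

Section MatrixGroups.
Variables (k : closedFieldType) (n : nat).

Definition mxpt (x : affine k (n * n)) : 'M[k]_n := \matrix_(i, j) x (mxvec_index i j).
Definition ptmx (A : 'M[k]_n) : affine k (n * n) := [ffun l => mxvec A 0 l].

Lemma ptmxK : cancel ptmx mxpt.
Proof. by move=> A; apply/matrixP => i j; rewrite mxE ffunE mxvecE. Qed.

Lemma mxptK : cancel mxpt ptmx.
Proof. by move=> x; apply/ffunP => l; case/mxvec_indexP: l => i j; rewrite ffunE mxvecE mxE. Qed.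

Lemma lin_aut_mul (A B : 'M[k]_n) uA uB (uAB : A *m B \in unitmx) :
  lin_aut uAB = (@lin_aut k n A uA * @lin_aut k n B uB)%g.
Proof. by apply: polyAut_inj => i; rewrite /polyAut_coord /= pcomp_lin. Qed.

Lemma lin_aut_one (u1 : (1%:M : 'M[k]_n) \in unitmx) : lin_aut u1 = 1%g.
Proof. by apply: polyAut_inj => i; rewrite /polyAut_coord /= lin_tuple1. Qed.

Lemma lin_aut_inv (A : 'M[k]_n) uA (uV : invmx A \in unitmx) :
  lin_aut uV = (@lin_aut k n A uA)^-1%g.
Proof.
apply: (mulgI (lin_aut uA)); rewrite mulgV.
have uAV : A *m invmx A \in unitmx by rewrite mulmxV ?unitmx1.
rewrite -(lin_aut_mul uA uV uAV); apply: polyAut_inj => i.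
by rewrite /polyAut_coord /= mulmxV // lin_tuple1.
Qed.

(** Closedness is asked among all matrices, without a coordinate for the inverse determinant:
    Jacobian 1 fixes the determinant and makes inversion polynomial, through the adjugate. *)
Record closed_linear_group := ClosedLinearGroup {
  clg_set : set (polyAut k n);
  clg_AutS : clg_set `<=` AutS k n;
  clg_GLn : clg_set `<=` GLn k n;
  clg1 : clg_set 1%g;
  clgM : forall g h, clg_set g -> clg_set h -> clg_set (g * h)%g;
  clgV : forall g, clg_set g -> clg_set g^-1%g;
  clg_closed : closed [set x | exists uA : mxpt x \in unitmx, clg_set (lin_aut uA)]
}.

Variable K : closed_linear_group.

Definition matgrp_set : set (affine k (n * n)) :=
  [set x | exists uA : mxpt x \in unitmx, clg_set K (lin_aut uA)].
Definition matgrp : Type := set_type matgrp_set.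
HB.instance Definition _ := FunSpace.on matgrp.

Lemma matgrp_unit (x : matgrp) : mxpt (val x) \in unitmx.
Proof. by case: (set_mem (valP x)). Qed.

Definition matgrp_aut (x : matgrp) : polyAut k n := lin_aut (matgrp_unit x).

Lemma matgrp_autP x : clg_set K (matgrp_aut x).
Proof.
rewrite /matgrp_aut; case: (set_mem (valP x)) => uA.
by rewrite (bool_irrelevance (matgrp_unit x) uA).
Qed.

Lemma matgrp_ptmx (A : 'M[k]_n) (uA : A \in unitmx) : clg_set K (lin_aut uA) -> matgrp_set (ptmx A).
Proof. by rewrite /matgrp_set /= ptmxK => KA; exists uA. Qed.

Definition matgrp_pt (A : 'M[k]_n) (uA : A \in unitmx) (KA : clg_set K (lin_aut uA)) : matgrp :=
  exist _ (ptmx A) (mem_set (matgrp_ptmx KA)).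

Fact matgrp_mulP (x y : matgrp) (u : mxpt (val x) *m mxpt (val y) \in unitmx) : clg_set K (lin_aut u).
Proof. by rewrite (lin_aut_mul (matgrp_unit x) (matgrp_unit y)); apply: clgM; exact: matgrp_autP. Qed.

Fact matgrp_mul_unit (x y : matgrp) : mxpt (val x) *m mxpt (val y) \in unitmx.
Proof. by rewrite unitmx_mul !matgrp_unit. Qed.

Fact matgrp_invP (x : matgrp) (u : invmx (mxpt (val x)) \in unitmx) : clg_set K (lin_aut u).
Proof. by rewrite (lin_aut_inv (matgrp_unit x)); apply: clgV; exact: matgrp_autP. Qed.

Fact matgrp_inv_unit (x : matgrp) : invmx (mxpt (val x)) \in unitmx.
Proof. by rewrite unitmx_inv matgrp_unit. Qed.

Fact matgrp_oneP : clg_set K (lin_aut (unitmx1 _ n)).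
Proof. by rewrite lin_aut_one; exact: clg1. Qed.

Definition matgrp_mul x y := matgrp_pt (matgrp_mulP (matgrp_mul_unit x y)).
Definition matgrp_inv x := matgrp_pt (matgrp_invP (matgrp_inv_unit x)).
Definition matgrp_one := matgrp_pt matgrp_oneP.

Lemma matgrp_inj (x y : matgrp) : mxpt (val x) = mxpt (val y) -> x = y.
Proof. by move=> /(can_inj mxptK) /val_inj. Qed.

Fact matgrp_mulA : associative matgrp_mul.
Proof. by move=> x y z; apply: matgrp_inj; rewrite /= !ptmxK mulmxA. Qed.

Fact matgrp_mul1g : left_id matgrp_one matgrp_mul.
Proof. by move=> x; apply: matgrp_inj; rewrite /= !ptmxK mul1mx. Qed.

Fact matgrp_mulg1 : right_id matgrp_one matgrp_mul.
Proof. by move=> x; apply: matgrp_inj; rewrite /= !ptmxK mulmx1. Qed.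

Fact matgrp_mulVg : left_inverse matgrp_one matgrp_inv matgrp_mul.
Proof. by move=> x; apply: matgrp_inj; rewrite /= !ptmxK mulVmx ?matgrp_unit. Qed.

Fact matgrp_mulgV : right_inverse matgrp_one matgrp_inv matgrp_mul.
Proof. by move=> x; apply: matgrp_inj; rewrite /= !ptmxK mulmxV ?matgrp_unit. Qed.

HB.instance Definition _ := isGroup.Build matgrp
  matgrp_mulA matgrp_mul1g matgrp_mulg1 matgrp_mulVg matgrp_mulgV.

Lemma mxpt_mul (x y : matgrp) : mxpt (val (x * y)%g) = mxpt (val x) *m mxpt (val y).
Proof. by rewrite /= ptmxK. Qed.

Lemma nice_matgrp : nice matgrp.
Proof. by apply: nice_sub; exact: nice_affine. Qed.

Lemma regular_entry (x : matgrp) i j : regular_at x (fun y : matgrp => mxpt (val y) i j).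
Proof.
have := @regular_sub _ _ matgrp_set x _ (regular_coord (val x) (mxvec_index i j)).
by apply: regular_near; near=> y; rewrite mxE.
Unshelve. all: by end_near. Qed.

Lemma matgrp_det (x : matgrp) : \det (mxpt (val x)) = 1.
Proof.
have := clg_AutS (matgrp_autP x); rewrite /AutS /= JacE (@jac_lin k n (mxpt (val x))).
  by move/eqP; rewrite -mpolyC1 -subr_eq0 -mpolyCB mpolyC_eq0 subr_eq0 => /eqP.
by move=> i; rewrite tnth_aut_tuple lin_autE.
Qed.

Lemma morphism_to_matgrp (X : funSpaceType k) (h : X -> matgrp) : nice X ->
  (forall x i j, regular_at x (fun y => mxpt (val (h y)) i j)) -> is_morphism h.
Proof.
move=> nX hr; apply: morphism_to_sub; apply: morphism_to_affine => // x l.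
case/mxvec_indexP: l => i j; apply: regular_near (hr x i j).
by near=> y; rewrite mxE.
Unshelve. all: by end_near. Qed.

Fact matgrp_variety : is_variety matgrp.
Proof.
split.
  exists 1%N, (fun=> setT); split=> [i|i|]; first exact: openT.
    exists (n * n)%N, matgrp_set, val; split; first exact: clg_closed.
    split; first exact: morphism_val.
    exists (fun x : matgrp => exist (fun y => y \in setT) x (mem_set I)).
      by apply: morphism_to_sub; exact: morphism_id.
    by split=> // x; apply: val_inj.
  by apply/seteqP; split=> // x _; exists ord0.
rewrite -openC openE => z /= zneq.
have [i [j ij]] : exists i j, mxpt (val z.1) i j != mxpt (val z.2) i j.
  apply: contrapT => h; apply: zneq; apply: matgrp_inj; apply/matrixP => i j.
  by apply/eqP/negPn/negP => ij; apply: h; exists i, j.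
(* The difference of the (i, j) entries of the two factors is regular on the product and nonzero
   near [z], which separates [z] from the diagonal. *)
have n1 := nice_matgrp.
have t1 := tens_pure (z := z) (regular_entry z.1 i j) (regular_cst z.2 1 n1).
have t2 := tens_pure (z := z) (regular_cst z.1 (-1) n1) (regular_entry z.2 i j).
have := near_tens_neq0 (tensD t1 t2); rewrite mulr1 mulN1r subr_eq0 => /(_ ij).
by apply: filterS => w /=; rewrite mulr1 mulN1r subr_eq0 => /eqP h e; apply: h; rewrite e.
Qed.

Fact matgrp_mul_morphism : is_morphism (fun z : vprod matgrp matgrp => (z.1 * z.2)%g).
Proof.
have n1 := nice_matgrp; apply: morphism_to_matgrp => [|z i j]; first exact: nice_vprod.
have : regular_at z (fun w : vprod matgrp matgrp => \sum_l mxpt (val w.1) i l * mxpt (val w.2) l j).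
  apply: tens_regular => //; apply: tens_sum => l.
  exact: (tens_pure (z := z) (regular_entry z.1 i l) (regular_entry z.2 l j)).
by apply: regular_near; near=> w; rewrite mxpt_mul mxE.
Unshelve. all: by end_near. Qed.

Fact matgrp_inv_morphism : is_morphism (fun x : matgrp => x^-1%g).
Proof.
have n1 := nice_matgrp; apply: morphism_to_matgrp => // x i j.
apply: regular_near (regular_adj (M := fun y : matgrp => mxpt (val y)) n1 i j (regular_entry x)).
by near=> y; rewrite /= ptmxK /invmx matgrp_unit matgrp_det invr1 scale1r.
Unshelve. all: by end_near. Qed.

HB.instance Definition _ := isAlgGroup.Build k matgrp
  matgrp_variety matgrp_mul_morphism matgrp_inv_morphism.

Fact matgrp_aut_mul : {morph matgrp_aut : x y / (x * y)%g}.
Proof.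
move=> x y; rewrite /matgrp_aut -(lin_aut_mul _ _ (matgrp_mul_unit x y)).
by apply: polyAut_inj => i; rewrite !lin_autE mxpt_mul.
Qed.

HB.instance Definition _ := isMultiplicative.Build matgrp (polyAut k n) matgrp_aut matgrp_aut_mul.

Lemma matgrp_aut_algebraic : is_algebraic_hom matgrp_aut.
Proof.
have n1 := nice_matgrp; have n2 := @nice_affine k n.
apply: morphism_to_affine => [|z i]; first exact: nice_vprod.
have : regular_at z (fun w : vprod matgrp (affine k n) =>
    \sum_l mxpt (val w.1) i l * (w.2 : affine k n) l).
  apply: tens_regular => //; apply: tens_sum => l.
  exact: (tens_pure (z := z) (regular_entry z.1 i l) (regular_coord z.2 l)).
apply: regular_near; near=> w; rewrite ffunE lin_autE raddf_sum.
by apply: eq_bigr => l _; rewrite /= mevalZ mevalXU.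
Unshelve. all: by end_near. Qed.

Lemma matgrp_aut_pt A (uA : A \in unitmx) (KA : clg_set K (lin_aut uA)) :
  matgrp_aut (matgrp_pt KA) = lin_aut uA.
Proof. by apply: polyAut_inj => i; rewrite !lin_autE /= ptmxK. Qed.

Lemma matgrp_aut_range : range matgrp_aut = clg_set K.
Proof.
apply/seteqP; split=> [_ [x _ <-]|g Kg]; first exact: matgrp_autP.
have [M [uM gM]] := (GLnP g).1 (clg_GLn (c := K) Kg).
have KM : clg_set K (lin_aut uM) by rewrite -gM.
by exists (matgrp_pt KM); rewrite // matgrp_aut_pt -gM.
Qed.

Lemma matgrp_aut_inj : injective matgrp_aut.
Proof.
move=> x y xy; apply: matgrp_inj; apply: lin_coord_inj => i.
by rewrite -(lin_autE (matgrp_unit x)) -(lin_autE (matgrp_unit y)) -!/(matgrp_aut _) xy.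
Qed.

End MatrixGroups.

(** * Monomial and diagonal matrices as closed sets *)

Section MonomialMatrices.
Variables (k : closedFieldType) (n : nat).

(** At most one nonzero entry in each row and in each column. The distinctness of indices is a
    coefficient 0 or 1, so that each condition is a family of equations over one index type, as
    [closed_equations] expects. *)
Definition monomial_mx (A : 'M[k]_n) :=
  (forall p : 'I_n * 'I_n * 'I_n, (p.1.2 != p.2)%:R * (A p.1.1 p.1.2 * A p.1.1 p.2) = 0) /\
  (forall p : 'I_n * 'I_n * 'I_n, (p.1.2 != p.2)%:R * (A p.1.2 p.1.1 * A p.2 p.1.1) = 0).

Lemma monomial_autP (A : 'M[k]_n) (uA : A \in unitmx) : monomial_aut (lin_aut uA) <-> monomial_mx A.
Proof.
split=> [[s [c hA]]|[rowA colA]].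
  have AE : A = \matrix_(i, j) (c i *+ (s i == j)).
    apply: lin_coord_inj => i; rewrite -(lin_autE uA) (hA i).2 (bigD1 (s i)) //= mxE eqxx.
    by rewrite big1 ?addr0 // => j ji; rewrite mxE eq_sym (negPf ji) scale0r.
  split=> -[[i j] j'] /=; case: eqVneq => [_|jj]; rewrite ?mul0r // mul1r AE !mxE.
    case: (eqVneq (s i) j) => [sj|_]; last by rewrite mul0r.
    by rewrite sj (negPf jj) mulr0.
  case: (eqVneq (s j) i) => [sj|_]; last by rewrite mul0r.
  by case: (eqVneq (s j') i) => [sj'|_]; rewrite ?mulr0 //; move: jj; rewrite -(inj_eq (@perm_inj _ s)) sj sj' eqxx.
have ex i : exists j, A i j != 0.
  apply: contrapT => h; move: uA; rewrite unitmxE (expand_det_row A i) big1 ?unitr0 // => j _.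
  suff -> : A i j = 0 by rewrite mul0r.
  by apply/eqP/negPn/negP => ij; apply: h; exists j.
have [s sE] := choice ex.
have s_inj : injective s.
  move=> i i' ss; apply/eqP; apply: contraT => ii; have /eqP := colA (s i, i, i').
  by rewrite /= ii mul1r mulf_eq0 (negPf (sE i)) /= ss (negPf (sE i')).
exists (perm s_inj), (fun i => A i (s i)) => i; split=> //.
rewrite lin_autE (bigD1 (s i)) //= permE big1 ?addr0 // => j ji.
have /eqP := rowA (i, j, s i); rewrite /= ji mul1r mulf_eq0 (negPf (sE i)) orbF => /eqP ->.
by rewrite scale0r.
Qed.

Lemma diag_autP (A : 'M[k]_n) (uA : A \in unitmx) :
  diagT k n (lin_aut uA) <-> forall p : 'I_n * 'I_n, (p.1 != p.2)%:R * A p.1 p.2 = 0.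
Proof.
split=> [[t hA] [i j] /=|dA].
  have AE : A = diag_mx (\row_i t i).
    apply: lin_coord_inj => l; rewrite -(lin_autE uA) (hA l).2 (bigD1 l) //= !mxE eqxx.
    by rewrite big1 ?addr0 // => m ml; rewrite !mxE eq_sym (negPf ml) scale0r.
  by rewrite AE !mxE; case: eqVneq => _; rewrite ?mul0r ?mulr0.
have A0 i j : i != j -> A i j = 0 by move=> ij; have := dA (i, j); rewrite /= ij mul1r.
have AE : A = diag_mx (\row_i A i i).
  by apply/matrixP => i j; rewrite !mxE; case: eqVneq => [->//|/A0].
exists (fun i => A i i) => i; split.
  have : \det A != 0 by rewrite -unitfE -unitmxE.
  by rewrite {1}AE det_diag => /prodf_neq0/(_ i isT); rewrite mxE.
rewrite lin_autE (bigD1 i) //= big1 ?addr0 // => j ji.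
by rewrite A0 1?eq_sym // scale0r.
Qed.

Lemma lin_AutSP (A : 'M[k]_n) (uA : A \in unitmx) : AutS k n (lin_aut uA) <-> \det A - 1 = 0.
Proof.
rewrite /AutS /= JacE (@jac_lin k n A) => [|i]; last by rewrite tnth_aut_tuple lin_autE.
split=> /eqP; last by rewrite subr_eq0 => /eqP ->; rewrite mpolyC1.
by rewrite -mpolyC1 -subr_eq0 -mpolyCB mpolyC_eq0 => /eqP.
Qed.

Let regular_entry' i j (x : affine k (n * n)) : regular_at x (fun y => mxpt y i j).
Proof.
by apply: regular_near (regular_coord x (mxvec_index i j)); near=> y; rewrite mxE.
Unshelve. all: by end_near. Qed.

Lemma closed_det1 : closed [set x : affine k (n * n) | \det (mxpt x) - 1 = 0].
Proof.
have na := @nice_affine k (n * n).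
have h (x : affine k (n * n)) : regular_at x (fun y => \det (mxpt y) - 1).
  apply: (regularD na _ (regular_cst x (-1) na)).
  by apply: (regular_det na (M := fun y => mxpt y)) => i j; exact: regular_entry'.
have := closed_equations na (fun _ : unit => h); congr closed.
by apply/seteqP; split=> [x /(_ tt)|x hx _].
Qed.

Lemma closed_monomial_mx : closed [set x : affine k (n * n) | monomial_mx (mxpt x)].
Proof.
have na := @nice_affine k (n * n).
have h1 i j i' j' (b : k) (x : affine k (n * n)) :
    regular_at x (fun y => b * (mxpt y i j * mxpt y i' j')).
  by apply: (regularM na (regular_cst x b na)); apply: (regularM na); exact: regular_entry'.
apply: closedI; apply: (closed_equations na) => p x; exact: h1.
Qed.

Lemma closed_diag_mx : closed [set x : affine k (n * n) |
  forall p : 'I_n * 'I_n, (p.1 != p.2)%:R * mxpt x p.1 p.2 = 0].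
Proof.
have na := @nice_affine k (n * n); apply: (closed_equations na) => p x.
by apply: (regularM na (regular_cst x _ na)); exact: regular_entry'.
Qed.

Lemma unit_det1 (A : 'M[k]_n) : \det A - 1 = 0 -> A \in unitmx.
Proof. by move=> /eqP; rewrite subr_eq0 unitmxE unitfE => /eqP ->; exact: oner_neq0. Qed.

Lemma monoS_closed : closed [set x | exists uA : mxpt x \in unitmx, @monoS k n (lin_aut uA)].
Proof.
have := closedI closed_monomial_mx closed_det1; congr closed.
apply/seteqP; split=> [x [/= mx dx]|x [/= uA [/monomial_autP ? /lin_AutSP ?]]] //.
by exists (unit_det1 dx); split; [apply/monomial_autP|apply/lin_AutSP].
Qed.

Lemma diagTS_closed : closed [set x | exists uA : mxpt x \in unitmx, diagTS k n (lin_aut uA)].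
Proof.
have := closedI closed_diag_mx closed_det1; congr closed.
apply/seteqP; split=> [x [/= mx dx]|x [/= uA [/diag_autP ? /lin_AutSP ?]]] //.
by exists (unit_det1 dx); split; [apply/diag_autP|apply/lin_AutSP].
Qed.

Lemma diagT1 : diagT k n 1%g.
Proof. by exists (fun=> 1) => i; rewrite oner_neq0 polyAut_coord1 scale1r. Qed.

Lemma diagTM g h : diagT k n g -> diagT k n h -> diagT k n (g * h)%g.
Proof.
move=> [t gE] [u hE]; exists (fun i => t i * u i) => i.
have [t0 gi] := gE i; have [u0 hi] := hE i; split; first by rewrite mulf_neq0.
by rewrite polyAut_coordM gi comp_mpolyZ comp_X_aut hi scalerA.
Qed.

Lemma diagTV g : diagT k n g -> diagT k n g^-1%g.
Proof.
move=> [t gE]; exists (fun i => (t i)^-1) => i; have [t0 gi] := gE i.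
split; first by rewrite invr_eq0.
have := polyAut_coord1 (k := k) i; rewrite -(mulgV g) polyAut_coordM gi comp_mpolyZ comp_X_aut.
by move=> <-; rewrite scalerA mulVf // scale1r.
Qed.

Definition diag_group : closed_linear_group k n.
Proof.
exists (diagTS k n); try exact: diagTS_closed.
- by move=> g [].
- by move=> g [/diagT_monomial/monomial_GLn].
- by split; [exact: diagT1|exact: AutS1].
- by move=> g h [? ?] [? ?]; split; [exact: diagTM|exact: AutSM].
- by move=> g [? ?]; split; [exact: diagTV|exact: AutSV].
Defined.

Definition monomial_group : closed_linear_group k n.
Proof.
exists (@monoS k n); try exact: monoS_closed.
- by move=> g [].
- by move=> g [/monomial_GLn].
- by split; [exact/diagT_monomial/diagT1|exact: AutS1].
- by move=> g h [? ?] [? ?]; split; [exact: monomial_autM|exact: AutSM].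
- by move=> g [? ?]; split; [exact: monomial_autV|exact: AutSV].
Defined.

End MonomialMatrices.

(** * The identity component of the monomial group *)

Section MaximalElement.
Variables (k : closedFieldType) (r : nat).
Local Notation T := (set_type [set t : affine k r | forall i, t i != 0]).

Definition unimodular (t : 'I_r -> k) : affine k r.+1 := unslice t (\prod_j t j)^-1.

Lemma unimodular_neq0 t : torus_pt t -> forall i, unimodular t i != 0.
Proof.
move=> t0 i; have [[j ->]|->] := ord_widen_or_max i; first by rewrite unslice_widen.
by rewrite unslice_max invr_eq0; apply/prodf_neq0.
Qed.

Lemma unimodular_prod t : torus_pt t -> \prod_i unimodular t i = 1.
Proof.
move=> t0; rewrite big_ord_recr /= unslice_max; under eq_bigr do rewrite unslice_widen.
by rewrite mulfV //; apply/prodf_neq0.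
Qed.

Lemma diagTS_unimodular t (t0 : torus_pt t) : diagTS k r.+1 (diag_aut (unimodular_neq0 t0)).
Proof.
split.
  exists (unimodular t) => i; split; first exact: unimodular_neq0.
  by rewrite diag_autE.
by rewrite /AutS /= (Jac_diag (diag_autE _)) unimodular_prod.
Qed.

Lemma diagTS_unimodularP g : diagTS k r.+1 g ->
  exists t (t0 : torus_pt t), g = diag_aut (unimodular_neq0 t0).
Proof.
move=> [[u gE] Sg]; pose t j := u (widen_ord (leqnSn r) j).
have t0 : torus_pt t by move=> j; have [] := gE (widen_ord (leqnSn r) j).
exists t, t0; apply: polyAut_inj => i; rewrite diag_autE; have [_ ->] := gE i; congr (_ *: _).
have [[j ->]|->] := ord_widen_or_max i; first by rewrite unslice_widen.
have /esym/eqP := Jac_diag (fun i => (gE i).2).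
rewrite Sg -mpolyC1 -subr_eq0 -mpolyCB mpolyC_eq0 subr_eq0 big_ord_recr /= => /eqP h.
have P0 : \prod_j t j != 0 by apply/prodf_neq0.
by rewrite unslice_max; apply: (mulfI P0); rewrite mulfV // h.
Qed.

Lemma torus_val_pt (t : T) : torus_pt (val t).
Proof. exact: (set_mem (valP t)). Qed.

Lemma nice_torus : nice T. Proof. by apply: nice_sub; exact: nice_affine. Qed.

Lemma regular_torus_coord (t : T) j : regular_at t (fun u : T => val u j).
Proof.
exact: (@regular_sub _ _ [set t : affine k r | forall i, t i != 0] t _ (regular_coord (val t) j)).
Qed.

(** Irreducibility: nonempty open sets contain principal ones, and the product of the two
    polynomials with all coordinates is nonzero, so it takes a nonzero value at some point of the
    torus. *)
Lemma torus_connected : connected [set: T].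
Proof.
move=> B [b Bb] [O oO BO] [C cC BC].
have {}BO : B = O by rewrite BO setTI.
have {}BC : B = C by rewrite BC setTI.
apply: contrapT => BT; have [c nBc] : exists c, ~ B c.
  by apply: contrapT => h; apply: BT; apply/seteqP; split=> // x _; apply: contrapT => nBx; apply: h; exists x.
have nb : nbhs b B by apply: open_nbhs_nbhs; split=> //; rewrite BO.
have nc : nbhs c (~` B) by apply: open_nbhs_nbhs; split=> //; rewrite BC; exact: closed_openC.
have [C1 oC1 C1B] := nbhs_set_type nb; have [C2 oC2 C2B] := nbhs_set_type nc.
have /nbhs_affineP[p pb pC] := open_nbhs_nbhs oC1.
have /nbhs_affineP[q qc qC] := open_nbhs_nbhs oC2.
have pq0 : p * q * \prod_(j < r) 'X_j != 0.
  rewrite !mulf_neq0 //.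
  - by apply: contraNneq pb => ->; rewrite meval0.
  - by apply: contraNneq qc => ->; rewrite meval0.
  - by apply/prodf_neq0 => j _; apply/eqP => /(congr1 (mcoeff U_(j)))/eqP; rewrite mcoeffX eqxx mcoeff0 oner_eq0.
have [v] : exists v : 'I_r -> k, (p * q * \prod_(j < r) 'X_j).@[v] != 0.
  apply: contrapT => h; move: pq0; rewrite (mpoly_eval0 (p := p * q * _)) ?eqxx // => v.
  by apply/eqP/negPn/negP => hv; apply: h; exists v.
rewrite !mevalM !mulf_eq0 !negb_or rmorph_prod /= => /andP[/andP[pv qv] /prodf_neq0 Xv].
have v0 : [set t : affine k r | forall i, t i != 0] [ffun j => v j].
  by move=> j; rewrite ffunE; have := Xv j isT; rewrite mevalXU.
have ve (s : {mpoly k[r]}) : s.@[[ffun j => v j] : affine k r] = s.@[v].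
  by apply: meval_eq => j; rewrite ffunE.
pose vt : T := exist _ [ffun j => v j] (mem_set v0).
have Cp : C1 (val vt) by apply: pC; rewrite /= ve.
have Cq : C2 (val vt) by apply: qC; rewrite /= ve.
by have := C2B _ Cq; apply; exact: C1B.
Qed.

Section DiagonalPoints.
Variables (K : closed_linear_group k r.+1) (DK : diagTS k r.+1 `<=` clg_set K).

(** [K] is kept general because the same parametrization is used inside the monomial group and onto
    the diagonal group itself. *)
Definition diag_pt (t : T) : matgrp K := matgrp_pt (DK (diagTS_unimodular (torus_val_pt t))).

Lemma diag_pt_entry t i j : mxpt (val (diag_pt t)) i j = unimodular (val t) i *+ (i == j).
Proof. by rewrite /= ptmxK !mxE. Qed.

Lemma diag_pt_aut t : matgrp_aut (diag_pt t) = diag_aut (unimodular_neq0 (torus_val_pt t)).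
Proof. exact: matgrp_aut_pt. Qed.

Lemma diag_pt_morphism : is_morphism diag_pt.
Proof.
have nT := nice_torus; apply: morphism_to_matgrp => // t i j.
have h : regular_at t (fun u : T => unimodular (val u) i).
  have [[l ->]|->] := ord_widen_or_max i.
    by apply: regular_near (regular_torus_coord t l); near=> u; rewrite unslice_widen.
  have := regularV nT (regular_prod nT (index_enum _) (regular_torus_coord t)).
  have P0 : \prod_l val t l != 0 by apply/prodf_neq0 => l _; exact: torus_val_pt.
  by move=> /(_ P0); apply: regular_near; near=> u; rewrite unslice_max.
have [ij|ij] := eqVneq i j.
  by apply: regular_near h; near=> u; rewrite diag_pt_entry ij eqxx.
by apply: regular_near (regular_cst t 0 nT); near=> u; rewrite diag_pt_entry (negPf ij).
Unshelve. all: by end_near. Qed.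

Lemma diag_pt_surj (x : matgrp K) : diagT k r.+1 (matgrp_aut x) -> exists t, diag_pt t = x.
Proof.
move=> Dx; have [|t [t0 xE]] := @diagTS_unimodularP (matgrp_aut x).
  by split=> //; exact: clg_AutS (matgrp_autP x).
have t0' : [set t : affine k r | forall i, t i != 0] [ffun i => t i] by move=> i; rewrite ffunE.
exists (exist _ [ffun i => t i] (mem_set t0')); apply: matgrp_aut_inj; rewrite diag_pt_aut xE.
apply: polyAut_inj => i; rewrite !diag_autE; congr (_ *: _); congr (unslice _ _ _).
  by apply: funext => j; rewrite ffunE.
by congr (_^-1); apply: eq_bigr => j _; rewrite ffunE.
Qed.

End DiagonalPoints.

(** Among monomial matrices of determinant 1, the diagonal ones are connected, as image of a torus,
    closed by the vanishing of the other entries, and open by the non-vanishing of the diagonal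
    product. *)
Lemma monomial_identity_component :
  is_identity_component (@monoS k r.+1) (diagTS k r.+1).
Proof.
pose K := monomial_group k r.+1; exists (matgrp K), (@matgrp_aut k r.+1 K).
split; [exact: matgrp_aut_algebraic|by rewrite (matgrp_aut_range K)|].
have DK : diagTS k r.+1 `<=` clg_set K by move=> g [/diagT_monomial].
pose D := [set x : matgrp K | diagT k r.+1 (matgrp_aut x)].
have nK := @nice_matgrp _ _ K.
have D1 : D 1%g by rewrite /D /= multiplicative1; exact: diagT1.
have DE : D = range (diag_pt DK).
  apply/seteqP; split=> [x Dx|_ [t _ <-]]; first by have [t <-] := diag_pt_surj DK Dx; exists t.
  by rewrite /D /= diag_pt_aut; have [] := diagTS_unimodular (torus_val_pt t).
have cD : connected D.
  by rewrite DE; apply: connected_image torus_connected; have [] := diag_pt_morphism DK.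
have closedD : closed D.
  have h (p : 'I_r.+1 * 'I_r.+1) (x : matgrp K) :
      regular_at x (fun y : matgrp K => (p.1 != p.2)%:R * mxpt (val y) p.1 p.2).
    exact: (regularM nK (regular_cst x _ nK) (regular_entry x _ _)).
  have := closed_equations nK h; congr closed.
  apply/seteqP; split=> x.
    exact: (diag_autP (matgrp_unit x)).2.
  exact: (diag_autP (matgrp_unit x)).1.
(* A monomial matrix has one nonzero entry per row, so it is diagonal as soon as its diagonal has no
   zero. *)
have openDE x : D x <-> \prod_i mxpt (val x) i i != 0.
  split=> [/diag_autP dx|px].
    have : mxpt (val x) = diag_mx (\row_i mxpt (val x) i i).
      apply/matrixP => i j; rewrite [RHS]mxE [X in X *+ _]mxE.
      by case: eqVneq => [->//|ij]; have := dx (i, j); rewrite /= ij mul1r.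
    move/(congr1 determinant); rewrite matgrp_det det_diag => /esym.
    by under eq_bigr do rewrite mxE; move=> ->; exact: oner_neq0.
  have [/monomial_autP[rowx _] _] := matgrp_autP x.
  apply/diag_autP => -[i j] /=; have [|ij] := eqVneq i j; first by rewrite mul0r.
  have := rowx (i, i, j); rewrite /= ij !mul1r => /eqP; rewrite mulf_eq0.
  by move/prodf_neq0/(_ i isT): px => /negPf -> /eqP.
have openD : open D.
  rewrite openE => x /openDE px.
  have := near_regular_neq0 nK (regular_prod nK (index_enum _) (fun i => regular_entry x i i)) px.
  by apply: filterS => y py; apply/openDE.
suff -> : connected_component setT (1%g : matgrp K) = D.
  apply/seteqP; split=> [g Dg|_ [x Dx <-]]; last by split=> //; have [] := matgrp_autP x.
  have : (range (@matgrp_aut _ _ K)) g by rewrite matgrp_aut_range; exact: (DK _ Dg).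
  by move=> [x _ xg]; exists x; rewrite // /D /= xg; case: Dg.
apply/seteqP; split; last exact: (connected_component_max D1 (@subsetT _ _) cD).
have c1 : connected_component setT (1%g : matgrp K) 1%g by exact: connected_component_refl.
(* [D] cuts out an open and closed nonempty part of the component of 1, which is therefore the whole
   component. *)
have := component_connected (A := setT) (x := 1%g : matgrp K)
  (B := connected_component setT (1%g : matgrp K) `&` D).
move=> h; rewrite -h; [by move=> x []|by exists 1%g|by exists D|by exists D].
Qed.

(** The inverse of [diag_pt] reads off the first [r] diagonal entries; the last one is determined by
    them. *)
Lemma diag_torus : is_torus_subgroup r (diagTS k r.+1).
Proof.
pose K := diag_group k r.+1; exists (matgrp K), (@matgrp_aut k r.+1 K).
have DK : diagTS k r.+1 `<=` clg_set K by [].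
have nK := @nice_matgrp _ _ K.
have Dx (x : matgrp K) : diagT k r.+1 (matgrp_aut x) by have [] := matgrp_autP x.
split; [|exact: matgrp_aut_algebraic|exact: matgrp_aut_inj|by rewrite (matgrp_aut_range K)].
have f0 (x : matgrp K) : [set t : affine k r | forall i, t i != 0]
    [ffun i => mxpt (val x) (widen_ord (leqnSn r) i) (widen_ord (leqnSn r) i)].
  have [t <-] := diag_pt_surj DK (Dx x); move=> i.
  by rewrite ffunE diag_pt_entry eqxx mulr1n unslice_widen; exact: torus_val_pt.
pose f (x : matgrp K) : T := exist _ [ffun i =>
  mxpt (val x) (widen_ord (leqnSn r) i) (widen_ord (leqnSn r) i)] (mem_set (f0 x)).
have fE x i : val (f x) i = mxpt (val x) (widen_ord (leqnSn r) i) (widen_ord (leqnSn r) i).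
  by rewrite /= ffunE.
have fpt t : f (diag_pt DK t) = t.
  by apply: val_inj; apply/ffunP => i; rewrite fE diag_pt_entry eqxx mulr1n unslice_widen.
exists f; split.
  split.
    apply: morphism_to_sub; apply: morphism_to_affine => // x i.
    apply: regular_near (regular_entry x (widen_ord (leqnSn r) i) (widen_ord (leqnSn r) i)).
    by near=> y; rewrite ffunE.
  exists (diag_pt DK); first exact: diag_pt_morphism.
  by split=> // x; have [t <-] := diag_pt_surj DK (Dx x); rewrite fpt.
move=> x y i; rewrite !fE mxpt_mul mxE (bigD1 (widen_ord (leqnSn r) i)) //= big1 ?addr0 // => j ji.
have [t <-] := diag_pt_surj DK (Dx x).
by rewrite diag_pt_entry eq_sym (negPf ji) mul0r.
Unshelve. all: by end_near. Qed.

Lemma monomial_algebraic : is_algebraic (@monoS k r.+1).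
Proof.
pose K := monomial_group k r.+1; exists (matgrp K), (@matgrp_aut k r.+1 K).
by split; [exact: matgrp_aut_algebraic|rewrite (matgrp_aut_range K)].
Qed.

End MaximalElement.

(** * Maximality of the monomial group and its uniqueness up to conjugacy *)

Theorem theorem14 (k : closedFieldType) (char0 : [pchar k] =i pred0)
    (n : nat) (n_gt0 : (0 < n)%N) :
  let torus_by_finite : set (set (polyAut k n)) :=
    [set H | [/\ is_algebraic H, H `<=` AutS k n
      & exists2 H0, is_identity_component H H0 & is_torus_subgroup n.-1 H0]] in
  let N : set (polyAut k n) := normalizer (SLn k n) (diagTS k n) in
  [/\ N = normalizer (GLn k n) (diagT k n) `&` SLn k n,
      maximal_in torus_by_finite N
    & forall M : set (polyAut k n), maximal_in torus_by_finite M ->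
        exists2 g, AutS k n g & M = conj_set g N].
Proof.
case: n n_gt0 => // r r_gt0 tbf; rewrite normalizer_SLn // normalizer_GLn //=.
have tbf_mono : tbf monoS.
  split; [exact: monomial_algebraic|by move=> g []|].
  by exists (diagTS k r.+1); [exact: monomial_identity_component|exact: diag_torus].
have tbf_conj g H : AutS k r.+1 g -> tbf H -> tbf (conj_set g H).
  move=> Sg [aH HS [H0 idH torH]]; split; first exact: conj_is_algebraic.
    by move=> _ [h /HS Sh <-]; exact: AutSJ.
  by exists (conj_set g H0); [exact: conj_identity_component|exact: conj_torus_subgroup].
(* Two facts suffice: every member lies in a conjugate of [monoS], and [monoS] lies in a conjugate
   of itself only if the two are equal. In dimension 1 both hold because all members are trivial. *)
have [sub_conj conj_eq] : (forall H, tbf H -> exists2 g, AutS k r.+1 g & H `<=` conj_set g monoS) /\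
    (forall g, AutS k r.+1 g -> monoS `<=` conj_set g monoS -> conj_set g monoS = monoS).
  case: r r_gt0 @tbf tbf_mono {tbf_conj} => [|r] _ tbf tbf_mono.
    have trivial H : tbf H -> H `<=` [set 1%g].
      by move=> [_ HS [H0 idH torH]]; exact: (torus_by_finite_line char0 HS idH torH).
    have mono1 : @monoS k 1 1%g by split; [exact/diagT_monomial/diagT1|exact: AutS1].
    split=> [H /trivial H1|g Sg _].
      exists 1%g; first exact: AutS1.
      by move=> h /H1 ->; apply/conj_setK; rewrite !mulg1 invg1.
    apply/seteqP; split=> x.
      move=> /conj_setK /(trivial _ tbf_mono) /= gx.
      suff -> : x = 1%g by [].
      by apply: (mulgI g^-1%g); apply: (mulIg g); rewrite gx mulg1 mulVg.
    by move=> /(trivial _ tbf_mono) ->; apply/conj_setK; rewrite mulg1 mulVg.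
  split=> [H [_ HS [H0 idH torH]]|g Sg sub]; first exact: (torus_by_finite_monomial char0 HS idH torH).
  by apply: monoS_conj => //; exact: (monoS_maximal_conj char0 Sg sub).
split=> //.
  split=> // H tbfH sub; have [g Sg Hg] := sub_conj H tbfH.
  have gE := conj_eq g Sg (subset_trans sub Hg).
  by apply/seteqP; split; [rewrite -gE|exact: sub].
(* The conjugate of [monoS] containing [M] belongs to the family, so maximality of [M] gives
   equality. *)
move=> M [tbfM Mmax]; have [g Sg Mg] := sub_conj M tbfM.
by exists g => //; rewrite (Mmax _ (tbf_conj g _ Sg tbf_mono) Mg).
Qed.
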